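(* Let $k\ge1$, $r\ge2$ be integers with $\gcd(k+1,r-1)=1$ and $\alpha=\alpha_{k,r}=-(k+1)/(r-1)$. Let $T\in\{\mathrm{AS},\mathrm{AA},\mathrm{SA},\mathrm{SS}\}$ and let $\Lambda$ be a $(k,r,N)$-admissible superpartition of bi-degree $(n|m)$ in the index set of type $T$. Then $P^T_\Lambda(x;\alpha_{k,r})$ is the unique polynomial $P$ satisfying (1) $P=m^T_\Lambda+\sum_{\Gamma<\Lambda}c_{\Lambda,\Gamma}m^T_\Gamma$ with $c_{\Lambda,\Gamma}\in\mathbb{C}$; (2) $S^*(u)P=\varepsilon_{\Lambda^*}(\alpha,u)P$ and $S^\circledast(u,u)P=\varepsilon_{\Lambda^\circledast}(\alpha,u)P$, where the operators and eigenvalues are taken at $\alpha=\alpha_{k,r}$.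
   Context: Fix $N\ge1$, $0\le m\le N$; $I=\{1,\dots,m\}$, $J=\{m+1,\dots,N\}$, $x=(x_1,\dots,x_N)$. $K_{i,j}$ exchanges $x_i,x_j$. For $K\subseteq\{1,\dots,N\}$, $S_K$ = permutations fixing every element outside $K$; $\mathrm{Asym}_Kf=\sum_{\sigma\in S_K}\mathrm{sgn}(\sigma)f(x_{\sigma(1)},\dots,x_{\sigma(N)})$, $\mathrm{Sym}_Kf=\sum_{\sigma\in S_K}f(x_{\sigma(1)},\dots,x_{\sigma(N)})$. Compositions $\eta\in\mathbb{Z}_{\ge0}^N$, $\eta^+$ decreasing rearrangement; dominance on partitions of equal size; $\eta\succ\nu$ iff $\eta\ne\nu$ and $\eta^+>\nu^+$, or $\eta^+=\nu^+$ and $\sum_{i\le k}\eta_i\ge\sum_{i\le k}\nu_i$ for all $k$. Cherednik operators $\xi_j=\alpha x_j\partial_{x_j}+\sum_{i<j}\frac{x_j}{x_j-x_i}(1-K_{i,j})+\sum_{i>j}\frac{x_i}{x_j-x_i}(1-K_{i,j})-(j-1)$. For $\alpha$ formal, $E_\eta(x;\alpha)$ is the unique polynomial $x^\eta+\sum_{\nu\prec\eta}c_{\eta,\nu}x^\nu$ with $\xi_jE_\eta=\bar\eta_jE_\eta$, $\bar\eta_j=\alpha\eta_j-\#\{i<j:\eta_i\ge\eta_j\}-\#\{i>j:\eta_i>\eta_j\}$. Superpartition of bi-degree $(n|m)$: $\Lambda=(\Lambda_1,\dots,\Lambda_m;\Lambda_{m+1},\dots,\Lambda_N)$, nonnegative,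 $\Lambda_1\ge\dots\ge\Lambda_m$, $\Lambda_{m+1}\ge\dots\ge\Lambda_N$, sum $n$; strict if $\Lambda_1>\dots>\Lambda_m$. $\Lambda^\circledast=(\Lambda_1+1,\dots,\Lambda_m+1,\Lambda_{m+1},\dots,\Lambda_N)^+$, $\Lambda^*=(\Lambda_1,\dots,\Lambda_N)^+$. $\Lambda>\Omega$ iff $\Lambda^*>\Omega^*$, or $\Lambda^*=\Omega^*$ and $\Lambda^\circledast>\Omega^\circledast$. With $\eta_\Lambda=(\Lambda_m,\dots,\Lambda_1,\Lambda_N,\dots,\Lambda_{m+1})$: $P^{AS}_\Lambda=c\,\mathrm{Asym}_I\mathrm{Sym}_JE_{\eta_\Lambda}$, $P^{AA}_\Lambda=c\,\mathrm{Asym}_I\mathrm{Asym}_JE_{\eta_\Lambda}$, $P^{SA}_\Lambda=c\,\mathrm{Sym}_I\mathrm{Asym}_JE_{\eta_\Lambda}$, $P^{SS}_\Lambda=c\,\mathrm{Sym}_I\mathrm{Sym}_JE_{\eta_\Lambda}$, $c$ chosen so the coefficient of $x_1^{\Lambda_1}\cdots x_N^{\Lambda_N}$ is $1$. Index sets: AS strict; AA strict with $\Lambda_{m+1}>\dots>\Lambda_N$; SA $\Lambda_{m+1}>\dots>\Lambda_N$; SS all. Monomials ($\lambda=(\Lambda_1..\Lambda_m)$, $\mu=(\Lambda_{m+1}..\Lambda_N)$): $m^{AS}_\Lambda=a_\lambda(x_1..x_m)m_\mu(x_{m+1}..x_N)$, $m^{AA}_\Lambda=a_\lambda a_\mu$,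 $m^{SA}_\Lambda=m_\lambda a_\mu$, $m^{SS}_\Lambda=m_\lambda m_\mu$, with $a_\nu(y_1..y_p)=\sum_{\sigma\in S_p}\mathrm{sgn}(\sigma)\prod_i y_{\sigma(i)}^{\nu_i}$ and $m_\nu$ the monomial symmetric function. Admissibility: weakly $(k,r,N)$-admissible: $\Lambda^\circledast_i-\Lambda^*_{i+k}\ge r$ for $1\le i\le N-k$; moderately: $\Lambda^\circledast_i-\Lambda^\circledast_{i+k}\ge r$ for $1\le i\le N-k$; strongly: moderately and $\Lambda^*_i-\Lambda^*_{i+k+1}\ge r$ for $1\le i\le N-k-1$. ''$(k,r,N)$-admissible'' = strongly, or strict and weakly. For such $\Lambda$, $P^T_\Lambda(x;\alpha)$ has no pole at $\alpha_{k,r}$, and $P^T_\Lambda(x;\alpha_{k,r})$ denotes its value there. Sekiguchi operators: $S^*(u)=\prod_{i=1}^N(u+\xi_i)$, $S^\circledast(u,v)=\prod_{i=1}^m(u+\xi_i+\alpha)\prod_{i=m+1}^N(v+\xi_i)$, $u,v$ formal parameters; for a partition $\lambda$ (padded with zeros to $N$ parts), $\varepsilon_\lambda(\alpha,u)=\prod_{i=1}^N(u+\alpha\lambda_i-i+1)$.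
   Formalization: Added hypothesis: P^T_Λ(x;α) has no pole at α_{k,r}; this is not automatic for strict, weakly admissible Λ of type SA or SS, e.g. N=m=3, T=SS, k=1, r=2, Λ=(2,1,0): P=m_(2,1)+6/(α+2) m_(1,1,1) has a pole at α=-2. *)

(* Defs.v *)
From HB Require Import structures.
From mathcomp Require Import all_boot all_order all_algebra fingroup perm.
From mathcomp Require Import mpoly complex reals.
From mathcomp Require classical_sets.

Set Implicit Arguments.
Unset Strict Implicit.
Unset Printing Implicit Defensive.

Import GRing.Theory.
Local Open Scope ring_scope.

(* Indices are 0-based throughout: the variable x_i is ['X_j] with j = i - 1,
   so I = {1..m} is [setI_ N m] and J = {m+1..N} is [setJ_ N m].
   Partitions are sequences, read with [nth 0]; compositions and
   superpartitions are exponent vectors in ['X_{1..N}]. *)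

Definition setI_ (N m : nat) : {set 'I_N} := [set i : 'I_N | (i < m)%N].
Definition setJ_ (N m : nat) : {set 'I_N} := [set i : 'I_N | (m <= i)%N].

Section Combinatorics.
Local Open Scope nat_scope.
Variable N : nat.
Implicit Types (eta nu L G : 'X_{1..N}) (lam mu : seq nat).

Definition parts eta : seq nat := [seq eta i | i <- enum 'I_N].

Definition decr_rearr (s : seq nat) : seq nat := sort geq s.

Definition psums_ge (s t : seq nat) : bool :=
  all (fun k => sumn (take k t) <= sumn (take k s)) (iota 0 (size s + size t).+1).

Definition dom_ge lam mu : bool := (sumn lam == sumn mu) && psums_ge lam mu.
Definition dom_gt lam mu : bool := (lam != mu) && dom_ge lam mu.

Definition comp_gt eta nu : bool :=
  let ep := decr_rearr (parts eta) in
  let np := decr_rearr (parts nu) in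
  (eta != nu) &&
  (dom_gt ep np || ((ep == np) && psums_ge (parts eta) (parts nu))).

Variable m : nat.

Definition noninc_on (K : {set 'I_N}) L : bool :=
  [forall i in K, forall j in K, (i < j) ==> (L j <= L i)].
Definition decr_on (K : {set 'I_N}) L : bool :=
  [forall i in K, forall j in K, (i < j) ==> (L j < L i)].

Definition superpartition L : bool :=
  noninc_on (setI_ N m) L && noninc_on (setJ_ N m) L.
Definition strict L : bool := decr_on (setI_ N m) L.

Definition sp_star L : seq nat := decr_rearr (parts L).
Definition sp_circ L : seq nat :=
  decr_rearr [seq L i + (i < m) | i <- enum 'I_N].

Definition sp_gt L G : bool :=
  dom_gt (sp_star L) (sp_star G) ||
  ((sp_star L == sp_star G) && dom_gt (sp_circ L) (sp_circ G)).

(* (L_m, ..., L_1, L_N, ..., L_{m+1}) *)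
Definition eta_of L : 'X_{1..N} :=
  [multinom nth 0 (rev (take m (parts L)) ++ rev (drop m (parts L))) i | i < N].

(* The differences in the admissibility conditions are between integers;
   a - b >= r is written b + r <= a. *)
Definition weakly_admissible (k r : nat) L : Prop :=
  forall i : nat, i + k < N ->
    nth 0 (sp_star L) (i + k) + r <= nth 0 (sp_circ L) i.
Definition moderately_admissible (k r : nat) L : Prop :=
  forall i : nat, i + k < N ->
    nth 0 (sp_circ L) (i + k) + r <= nth 0 (sp_circ L) i.
Definition strongly_admissible (k r : nat) L : Prop :=
  moderately_admissible k r L /\
  forall i : nat, i + k.+1 < N ->
    nth 0 (sp_star L) (i + k.+1) + r <= nth 0 (sp_star L) i.
Definition admissible (k r : nat) L : Prop :=
  strongly_admissible k r L \/ (strict L /\ weakly_admissible k r L).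

End Combinatorics.

Inductive symtype := AS | AA | SA | SS.

Definition in_index (N m : nat) (T : symtype) (L : 'X_{1..N}) : bool :=
  superpartition m L &&
  match T with
  | AS => strict m L
  | AA => strict m L && decr_on (setJ_ N m) L
  | SA => decr_on (setJ_ N m) L
  | SS => true
  end.

Section Operators.
Variables (R : idomainType) (N : nat).
Implicit Types (p q : {mpoly R[N]}) (K : {set 'I_N}) (nu L : 'X_{1..N}).

(* [msym s p] is p(x_{s(1)}, ..., x_{s(N)}). *)
Definition Asym_on K p : {mpoly R[N]} :=
  \sum_(s : 'S_N | perm_on K s) (-1) ^+ s *: msym s p.
Definition Sym_on K p : {mpoly R[N]} :=
  \sum_(s : 'S_N | perm_on K s) msym s p.

Definition symmetrizer (m : nat) (T : symtype) p : {mpoly R[N]} :=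
  let I := setI_ N m in let J := setJ_ N m in
  match T with
  | AS => Asym_on I (Sym_on J p)
  | AA => Asym_on I (Asym_on J p)
  | SA => Sym_on I (Asym_on J p)
  | SS => Sym_on I (Sym_on J p)
  end.

Definition alt_mono K nu : {mpoly R[N]} :=
  \sum_(s : 'S_N | perm_on K s) (-1) ^+ s *: \prod_(i in K) 'X_(s i) ^+ nu i.

(* The monomial symmetric function sums the distinct rearrangements, each
   with coefficient 1; hence [undup]. *)
Definition sym_mono K nu : {mpoly R[N]} :=
  \sum_(p <- undup [seq \prod_(i in K) ('X_(s i) : {mpoly R[N]}) ^+ nu i
                   | s : 'S_N <- enum (perm_on K)]) p.

Definition mono (m : nat) (T : symtype) L : {mpoly R[N]} :=
  let I := setI_ N m in let J := setJ_ N m in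
  match T with
  | AS => alt_mono I L * sym_mono J L
  | AA => alt_mono I L * alt_mono J L
  | SA => sym_mono I L * alt_mono J L
  | SS => sym_mono I L * sym_mono J L
  end.

(* Exact quotient p / q: 0 if q does not divide p, and otherwise the quotient,
   which is unique for q != 0. *)
Definition exact_quo p q : {mpoly R[N]} :=
  classical_sets.xget 0 (fun g : {mpoly R[N]} => g * q = p).

Lemma exact_quoE p q g : q != 0 -> g * q = p -> exact_quo p q = g.
Proof.
move=> q0 gE; rewrite /exact_quo.
case: classical_sets.xgetP => [h _ hE|/(_ g)/(_ gE)] //.
by apply: (mulIf q0); rewrite gE.
Qed.

Definition dunkl_quo (i j : 'I_N) p : {mpoly R[N]} :=
  exact_quo (p - msym (tperm i j) p) ('X_j - 'X_i).

Definition cherednik (a : R) (j : 'I_N) p : {mpoly R[N]} :=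
  a *: ('X_j * p^`M(j))
  + \sum_(i < N | (i < j)%N) 'X_j * dunkl_quo i j p
  + \sum_(i < N | (j < i)%N) 'X_i * dunkl_quo i j p
  - p *+ j.

Definition bar (a : R) (eta : 'X_{1..N}) (j : 'I_N) : R :=
  a *+ eta j
  - #|[set i : 'I_N | (i < j)%N && (eta j <= eta i)%N]|%:R
  - #|[set i : 'I_N | (j < i)%N && (eta j < eta i)%N]|%:R.

(* The factors of the Sekiguchi operators are composed in increasing order of
   the index, the factor of index 1 being applied last. *)
Definition sekiguchi_star (a u : R) p : {mpoly R[N]} :=
  foldr (fun i q => u *: q + cherednik a i q) p (enum 'I_N).

Definition sekiguchi_circ (m : nat) (a u v : R) p : {mpoly R[N]} :=
  foldr (fun (i : 'I_N) q => if (i < m)%N then (u + a) *: q + cherednik a i q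
                    else v *: q + cherednik a i q) p (enum 'I_N).

End Operators.

Definition eps (R : idomainType) (N : nat) (lam : seq nat) (a u : R) : R :=
  \prod_(i < N) (u + a *+ nth 0%N lam i - i%:R).

Section Jack.
Variables (F : fieldType) (N : nat).

(* F(alpha), with alpha the image of the variable. *)
Definition ratfun : fieldType := {fraction {poly F}}.
Definition alpha_gen : ratfun := FracField.tofrac 'X.

Definition is_nsJack (eta : 'X_{1..N}) (E : {mpoly ratfun[N]}) : Prop :=
  (exists c : 'X_{1..N} -> ratfun,
     E = 'X_[eta] + \sum_(nu : 'X_{1..N < (mdeg eta).+1} | comp_gt eta nu)
                      c nu *: 'X_[nu])
  /\ forall j : 'I_N, cherednik alpha_gen j E = bar alpha_gen eta j *: E.

Definition nsJack (eta : 'X_{1..N}) : {mpoly ratfun[N]} :=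
  classical_sets.xget 0 (is_nsJack eta).

Definition jack (m : nat) (T : symtype) (L : 'X_{1..N}) : {mpoly ratfun[N]} :=
  let Q := symmetrizer m T (nsJack (eta_of m L)) in (Q@_L)^-1 *: Q.

Definition ratfun_value (a : F) (f : ratfun) (y : F) : Prop :=
  exists n d : {poly F},
    [/\ d.[a] != 0, f = FracField.tofrac n / FracField.tofrac d
      & y = n.[a] / d.[a]].

(* Total version: 0 if f has a pole at a. *)
Definition ratfun_eval (a : F) (f : ratfun) : F :=
  classical_sets.xget 0 (ratfun_value a f).

Lemma ratfun_evalE (a : F) (n d : {poly F}) : d.[a] != 0 ->
  ratfun_eval a (FracField.tofrac n / FracField.tofrac d) = n.[a] / d.[a].
Proof.
have nz (q : {poly F}) : q.[a] != 0 -> FracField.tofrac q != 0.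
  by move=> qa; rewrite tofrac_eq0; apply: contraNneq qa => ->; rewrite horner0.
move=> da; rewrite /ratfun_eval.
case: classical_sets.xgetP => [y _ [n' [d' [d'a /eqP fE ->]]]|H]; last first.
  by case: (H (n.[a] / d.[a])); exists n, d.
move: fE; rewrite eqr_div ?nz // -!tofracM tofrac_eq => /eqP nd.
by apply/eqP; rewrite eqr_div // -!hornerM nd.
Qed.

(* Regularity of P^T_L at alpha_{k,r} has to be assumed: it does not follow
   from L being strict and weakly admissible when T is SA or SS. For instance,
   for N = m = 3 and T = SS,
     P_(2,1,0) = m_(2,1,0) + 6/(alpha + 2) m_(1,1,1)
   has a pole at alpha_{1,2} = -2. *)
Definition no_pole_at (a : F) (p : {mpoly ratfun[N]}) : Prop :=
  forall nu : 'X_{1..N}, exists y : F, ratfun_value a p@_nu y.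

Definition jack_at (a : F) (m : nat) (T : symtype) (L : 'X_{1..N}) :
  {mpoly F[N]} := map_mpoly (ratfun_eval a) (jack m T L).

Definition triangular (m : nat) (T : symtype) (L : 'X_{1..N})
    (P : {mpoly F[N]}) : Prop :=
  exists c : 'X_{1..N} -> F,
    P = mono F m T L
      + \sum_(G : 'X_{1..N < (mdeg L).+1} |
               [&& in_index m T G, mdeg G == mdeg L & sp_gt m L G])
          c G *: mono F m T G.

(* The parameter u is the variable of {poly F}: the operators act on
   polynomials in x with coefficients in F[u]. *)
Definition sekiguchi_eigen (a : F) (m : nat) (L : 'X_{1..N})
    (P : {mpoly F[N]}) : Prop :=
  let Pu : {mpoly {poly F}[N]} := map_mpoly polyC P in
  sekiguchi_star a%:P 'X Pu = eps N (sp_star L) a%:P 'X *: Pu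
  /\ sekiguchi_circ m a%:P 'X 'X Pu = eps N (sp_circ m L) a%:P 'X *: Pu.

End Jack.

Definition alpha_kr (F : fieldType) (k r : nat) : F :=
  - (k.+1)%:R / (r.-1)%:R.

(* Main.v *)
(** The value [P0] of the Jack polynomial at [alpha = -(k+1)/(r-1)] is triangular
    because every non-symmetric Jack polynomial is, and it is an eigenfunction by
    specialization. For uniqueness, let [P] be a second solution. A maximal
    monomial of [P - P0], sorted within the two blocks, is a superpartition
    [G < L] with the same Sekiguchi eigenvalues as [L]. Comparing the multisets of
    values [(k+1) L_i + (r-1) i] of [L] and [G], for both partitions attached to
    them, leaves a single possibility: [L] is strict, [G] is not, and [L] has two
    overlapping pairs of rows [(A, A+k)] and [(B, B+k)], all of them from the
    block I, of difference exactly [r-1]. If the type is antisymmetric in I, then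
    [G] is not in the index set. Otherwise [P_L] has a pole. Indeed [P_L] is a
    combination of the [E_nu], [nu] a rearrangement of [L], with coefficients that
    are units at [alpha], so if [P_L] were regular then every [E_nu] would be.
    Sorting [nu] by groups of rows keeps [E_nu] regular, and the part of the result
    in the variables carrying the rows [A..B+k] is a non-symmetric Jack
    polynomial; its value at [(1,...,1)] is an explicit product in which more factors
    of the denominator than of the numerator vanish at [alpha]. *)

Require Import Defs.
From HB Require Import structures.
From mathcomp Require Import all_boot all_order all_algebra fingroup perm.
From mathcomp Require Import mpoly complex reals.
From mathcomp Require Import zify ring.
From mathcomp Require boolp classical_sets.

Set Implicit Arguments.
Unset Strict Implicit.
Unset Printing Implicit Defensive.

Import GRing.Theory Num.Theory.
Local Open Scope ring_scope.

(** * Cherednik operators on monomials *)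

Section AdjacentTransposition.
Variable N : nat.
Implicit Types (x y i j : 'I_N).

Lemma ltn_ord_neq i j : (i < j)%N -> i != j.
Proof. by rewrite -val_eqE neq_ltn => ->. Qed.

Lemma gtn_ord_neq i j : (j < i)%N -> i != j.
Proof. by rewrite -val_eqE neq_ltn => ->; rewrite orbT. Qed.

Lemma tperm_adjE x y i : y = x.+1 :> nat ->
  tperm x y i = (if i == x :> nat then x.+1 else if i == x.+1 :> nat then x : nat else i) :> nat.
Proof.
move=> xy; case: tpermP => [->|->|/eqP + /eqP]; first by rewrite eqxx.
  by rewrite xy eqxx; case: eqP => //; lia.
by rewrite -!val_eqE /= xy => /negPf-> /negPf->.
Qed.

Lemma ltn_tperm_adj x y i j : y = x.+1 :> nat ->
  (i, j) != (x, y) -> (i, j) != (y, x) -> (tperm x y i < tperm x y j)%N = (i < j)%N.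
Proof.
move=> xy; rewrite !xpair_eqE -!val_eqE /= !(tperm_adjE _ xy).
by do !case: eqP; lia.
Qed.

End AdjacentTransposition.

Section PairUpdate.
Variable N : nat.
Implicit Types (m k : 'X_{1..N}) (i j l : 'I_N).

Definition set_pair m i j (b a : nat) : 'X_{1..N} :=
  [multinom if l == i then b else if l == j then a else m l | l < N].

Lemma set_pairE m i j b a l :
  set_pair m i j b a l = if l == i then b else if l == j then a else m l.
Proof. by rewrite mnmE. Qed.

Lemma set_pair_id m i j : set_pair m i j (m i) (m j) = m.
Proof. by apply/mnmP => l; rewrite set_pairE; case: eqP => [->|_] //; case: eqP => [->|]. Qed.

Lemma set_pairC m i j b a : i != j -> set_pair m i j b a = set_pair m j i a b.
Proof.
move=> ij; apply/mnmP => l; rewrite !set_pairE.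
by case: (eqVneq l i) => // ->; rewrite (negPf ij).
Qed.

Lemma set_pair_eq m k i j b a : i != j ->
  (set_pair m i j b a == k) = [&& k == set_pair m i j (k i) (k j), k i == b & k j == a].
Proof.
move=> ij; apply/eqP/and3P => [<-|[/eqP kE /eqP kb /eqP ka]]; last by rewrite -kb -ka.
by rewrite !set_pairE !eqxx (eq_sym j) (negPf ij); split.
Qed.

Lemma set_pair_tperm m i j :
  [multinom m (tperm i j l) | l < N] = set_pair m i j (m j) (m i).
Proof.
apply/mnmP => l; rewrite set_pairE mnmE.
case: tpermP => [->|->|/eqP/negPf-> /eqP/negPf->] //; rewrite eqxx //.
by case: eqP => [->|].
Qed.

Lemma set_pairDr m i j b a : i != j ->
  (set_pair m i j b a + U_(j))%MM = set_pair m i j b a.+1.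
Proof.
move=> ij; apply/mnmP => l; rewrite mnmDE mnm1E !set_pairE (eq_sym j).
case: (eqVneq l i) => [->|_]; first by rewrite (negPf ij) addn0.
by case: (eqVneq l j) => _; rewrite ?addn1 ?addn0.
Qed.

Lemma set_pairDl m i j b a : i != j ->
  (set_pair m i j b a + U_(i))%MM = set_pair m i j b.+1 a.
Proof. by move=> ij; rewrite !(@set_pairC m i) // set_pairDr // eq_sym. Qed.

Definition exchanged i j m k : bool :=
  (k == set_pair m i j (k i) (k j)) && (k i + k j == m i + m j)%N.

Lemma exchanged_refl i j m : exchanged i j m m.
Proof. by rewrite /exchanged set_pair_id !eqxx. Qed.

Lemma exchangedC i j m k : i != j -> exchanged i j m k = exchanged j i m k.
Proof. by move=> ij; rewrite /exchanged set_pairC // addnC (addnC (m i)). Qed.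

Lemma exchanged_sum i j m k : exchanged i j m k -> (k i + k j = m i + m j)%N.
Proof. by case/andP => _ /eqP. Qed.

Lemma exchanged_off i j m k l : exchanged i j m k -> l != i -> l != j -> k l = m l.
Proof. by case/andP => /eqP -> _ li lj; rewrite set_pairE (negPf li) (negPf lj). Qed.

Lemma eq_exchanged i j m k : i != j -> (m == k) = exchanged i j m k && (k j == m j).
Proof.
move=> ij; rewrite -[X in X == k](set_pair_id m i j) set_pair_eq // /exchanged.
by case: (k == _) => //=; lia.
Qed.

Lemma tperm_eq_exchanged i j m k : i != j ->
  ([multinom m (tperm i j l) | l < N] == k) = exchanged i j m k && (k j == m i).
Proof.
move=> ij; rewrite set_pair_tperm set_pair_eq // /exchanged.
by case: (k == _) => //=; lia.
Qed.

End PairUpdate.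

Lemma sumr_eq_ord (R : pzSemiRingType) (n x : nat) (c : bool) :
  \sum_(l < n) (c && (l == x :> nat))%:R = (c && (x < n)%N)%:R :> R.
Proof.
elim: n => [|n IH]; first by rewrite big_ord0 andbF.
rewrite big_ord_recr /= IH ltnS.
by case: c {IH} => //=; case: (ltngtP n x) => /=; rewrite ?addr0 ?add0r.
Qed.

Section ExchangeQuotient.
Variables (R : idomainType) (N : nat).
Implicit Types (p q g : {mpoly R[N]}) (m k : 'X_{1..N}) (i j l : 'I_N).

Lemma subX_neq0 i j : i != j -> 'X_j - 'X_i != 0 :> {mpoly R[N]}.
Proof.
move=> ij; apply/eqP => /(congr1 (mcoeff U_(i))).
rewrite mcoeffB !mcoeffXU eqxx mcoeff0 eq_sym (negPf ij) sub0r => /eqP.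
by rewrite oppr_eq0 oner_eq0.
Qed.

Lemma dunkl_quo_uniq i j p g : i != j ->
  g * ('X_j - 'X_i) = p - msym (tperm i j) p -> dunkl_quo i j p = g.
Proof. by move=> ij; apply: exact_quoE; apply: subX_neq0. Qed.

(* Unfolding these makes [ring] and the unifier diverge. *)
#[local] Opaque dunkl_quo msym mderiv mpolyX tperm
  mpoly_mul mpoly_add mpoly_opp mpoly_scale.

Lemma telescope_tpermX i j m : i != j -> (m i <= m j)%N ->
  (\sum_(l < m j - m i) 'X_[set_pair m i j (m i + l) (m j - l).-1]) * ('X_j - 'X_i)
  = 'X_[m] - msym (tperm i j) 'X_[m] :> {mpoly R[N]}.
Proof.
move=> ij mij; pose f h : {mpoly R[N]} := 'X_[set_pair m i j (m i + h) (m j - h)].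
have f_first : 'X_[m] = f 0%N by rewrite /f addn0 subn0 set_pair_id.
have f_last : msym (tperm i j) 'X_[m] = f (m j - m i)%N.
  by rewrite msymX tpermV set_pair_tperm /f subnKC // subKn.
rewrite f_last [in RHS]f_first -[RHS]opprB -(telescope_sumr f (leq0n (m j - m i))).
rewrite big_mkord -sumrN mulr_suml; apply: eq_bigr => l _; have ln := ltn_ord l.
rewrite mulrBr -!mpolyXD set_pairDr // set_pairDl // opprB.
by congr ('X_[_] - 'X_[_]); congr set_pair; lia.
Qed.

Lemma ex_dunkl_quo i j p : i != j -> exists g, g * ('X_j - 'X_i) = p - msym (tperm i j) p.
Proof.
move=> ij; rewrite (mpolyE p).
elim/big_ind: _ => [|p1 p2 [g1 p1E] [g2 p2E]|m _].
- by exists 0; rewrite msym0 subrr mul0r.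
- by exists (g1 + g2); rewrite mulrDl p1E p2E msymD opprD addrACA.
suff [g gE] : exists g, g * ('X_j - 'X_i) = 'X_[m] - msym (tperm i j) 'X_[m] :> {mpoly R[N]}.
  by exists (p@_m *: g); rewrite -scalerAl gE msymZ scalerBr.
have [le_mij|/ltnW le_mji] := leqP (m i) (m j).
  by rewrite -(telescope_tpermX ij le_mij); eexists.
rewrite tpermC -telescope_tpermX 1?eq_sym //.
by rewrite -['X_i - _]opprB mulrN -mulNr; eexists.
Qed.

Lemma mul_dunkl_quo i j p : i != j ->
  dunkl_quo i j p * ('X_j - 'X_i) = p - msym (tperm i j) p.
Proof. by move=> ij; have [g gE] := ex_dunkl_quo p ij; rewrite (dunkl_quo_uniq ij gE). Qed.

Lemma dunkl_quoC i j p : i != j -> dunkl_quo i j p = - dunkl_quo j i p.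
Proof.
move=> ij; have ji : j != i by rewrite eq_sym.
by apply: dunkl_quo_uniq => //; rewrite mulNr -mulrN opprB (mul_dunkl_quo p ji) (tpermC j i).
Qed.

Lemma dunkl_quo_linear i j c p q : i != j ->
  dunkl_quo i j (c *: p + q) = c *: dunkl_quo i j p + dunkl_quo i j q.
Proof.
move=> ij; apply: dunkl_quo_uniq => //.
by rewrite mulrDl -scalerAl !mul_dunkl_quo // msymD msymZ scalerBr opprD addrACA.
Qed.

(* The coefficient of ['X_[k]] in [x_j (1 - K_ij) / (x_j - x_i)] applied to
   ['X_[m]], and in [x_i (1 - K_ij) / (x_j - x_i)]. *)
Definition low_coef i j m k : int :=
  (exchanged i j m k && (m i < k j <= m j)%N)%:Z
  - (exchanged i j m k && (m j < k j <= m i)%N)%:Z.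
Definition high_coef i j m k : int :=
  (exchanged i j m k && (m i <= k j < m j)%N)%:Z
  - (exchanged i j m k && (m j <= k j < m i)%N)%:Z.

Lemma mcoeff_XjdunklX_ordered i j m k : i != j -> (m i <= m j)%N ->
  ('X_j * dunkl_quo i j 'X_[m])@_k = (exchanged i j m k && (m i < k j <= m j)%N)%:R :> R.
Proof.
move=> ij mij; rewrite (dunkl_quo_uniq ij (telescope_tpermX ij mij)) mulr_sumr raddf_sum /=.
under eq_bigr => l _.
  rewrite mulrC -mpolyXD set_pairDr // mcoeffX set_pair_eq //.
  have -> : [&& k == set_pair m i j (k i) (k j), k i == (m i + l)%N & k j == (m j - l).-1.+1]
     = exchanged i j m k && (m i <= k i)%N && (l == (k i - m i)%N :> nat).
    by rewrite /exchanged; case: (k == _) => //=; have := ltn_ord l; lia.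
  over.
rewrite sumr_eq_ord; congr (_ %:R); case ex: (exchanged i j m k) => //=.
by have := exchanged_sum ex; lia.
Qed.

(* x_i (1 - K) / (x_j - x_i) = x_j (1 - K) / (x_j - x_i) - (1 - K) *)
Lemma mcoeff_XidunklX_Xj i j m k : i != j ->
  ('X_i * dunkl_quo i j 'X_[m])@_k = ('X_j * dunkl_quo i j 'X_[m])@_k
    - (exchanged i j m k && (k j == m j))%:R + (exchanged i j m k && (k j == m i))%:R :> R.
Proof.
move=> ij; rewrite -eq_exchanged // -tperm_eq_exchanged //; set mt := [multinom _ | _ < _].
have -> : 'X_i * dunkl_quo i j 'X_[m] = 'X_j * dunkl_quo i j 'X_[m] - 'X_[m] + 'X_[mt]
    :> {mpoly R[N]}.
  have := mul_dunkl_quo 'X_[m] ij; rewrite msymX tpermV -/mt => quoE.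
  by rewrite -(subKr 'X_[m] 'X_[mt]) -quoE; move: (dunkl_quo _ _ _) => d; ring.
by rewrite mcoeffD mcoeffB !mcoeffX.
Qed.

Lemma mcoeff_XjdunklX i j m k : i != j ->
  ('X_j * dunkl_quo i j 'X_[m])@_k = (low_coef i j m k)%:~R :> R.
Proof.
move=> ij; have [mij|/ltnW mji] := leqP (m i) (m j).
  rewrite mcoeff_XjdunklX_ordered // pmulrn; congr (_%:~R); rewrite /low_coef.
  by case: (exchanged _ _ _ _) => //=; lia.
have ji : j != i by rewrite eq_sym.
rewrite dunkl_quoC // mulrN mcoeffN mcoeff_XidunklX_Xj // mcoeff_XjdunklX_ordered //.
rewrite -(exchangedC _ _ ij) !pmulrn -!(intrD, intrB, intrN); congr (_%:~R); rewrite /low_coef.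
by case ex: (exchanged _ _ _ _) => //=; have := exchanged_sum ex; lia.
Qed.

Lemma mcoeff_XidunklX i j m k : i != j ->
  ('X_i * dunkl_quo i j 'X_[m])@_k = (high_coef i j m k)%:~R :> R.
Proof.
move=> ij; rewrite mcoeff_XidunklX_Xj // mcoeff_XjdunklX // !pmulrn -!(intrD, intrB).
congr (_%:~R); rewrite /low_coef /high_coef.
by case: (exchanged _ _ _ _) => //=; lia.
Qed.

Lemma mcoeff_Xderiv j p k : ('X_j * p^`M(j))@_k = p@_k *+ k j.
Proof.
have [kj|kj] := posnP (k j).
  rewrite kj mulr0n; apply: memN_msupp_eq0; apply/negP => /msuppM_le.
  case/allpairsP => [[u v] /= [+ _ kE]]; rewrite msuppX inE => /eqP uE.
  by move: kj; rewrite kE uE mnmDE mnm1E eqxx.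
have kE : k = (U_(j) + (k - U_(j)))%MM.
  apply/mnmP => l; rewrite mnmDE mnmBE mnm1E.
  by case: (eqVneq j l) => [<-|_]; lia.
rewrite {1}kE mulrC mcoeffMX mcoeff_deriv addmC -kE; congr (_ *+ _).
by rewrite mnmBE mnm1E eqxx; lia.
Qed.

End ExchangeQuotient.

Section CherednikOperator.
Variables (R : idomainType) (N : nat).
Implicit Types (a : R) (p q : {mpoly R[N]}) (m k : 'X_{1..N}) (i j : 'I_N).

Definition low_sum j p : {mpoly R[N]} := \sum_(i < N | (i < j)%N) 'X_j * dunkl_quo i j p.
Definition high_sum j p : {mpoly R[N]} := \sum_(i < N | (j < i)%N) 'X_i * dunkl_quo i j p.

Lemma cherednikE a j p :
  cherednik a j p = a *: ('X_j * p^`M(j)) + low_sum j p + high_sum j p - p *+ j.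
Proof. by []. Qed.

Lemma low_sum_linear j : linear (low_sum j).
Proof.
move=> c p q; rewrite /low_sum scaler_sumr -big_split /=; apply: eq_bigr => i /ltn_ord_neq ij.
by rewrite dunkl_quo_linear // mulrDr -scalerAr.
Qed.

Lemma high_sum_linear j : linear (high_sum j).
Proof.
move=> c p q; rewrite /high_sum scaler_sumr -big_split /=; apply: eq_bigr => i /gtn_ord_neq ij.
by rewrite dunkl_quo_linear // mulrDr -scalerAr.
Qed.

Lemma cherednik_linear a j : linear (@cherednik R N a j).
Proof.
move=> c p q; rewrite !cherednikE low_sum_linear high_sum_linear mderivD mderivZ mulrnDl.
rewrite mulrDr -scalerAr scalerDr scalerA (mulrC a) -scalerA scalerBr !scalerDr scalerMnr.
by rewrite opprD [RHS]addrACA; congr (_ + _); rewrite [RHS]addrACA; congr (_ + _);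
   rewrite [RHS]addrACA.
Qed.

HB.instance Definition _ a j :=
  GRing.isLinear.Build R {mpoly R[N]} {mpoly R[N]} _ (@cherednik R N a j)
    (cherednik_linear a j).

Lemma mcoeff_cherednik a j p k (s : seq 'X_{1..N}) : uniq s -> {subset msupp p <= s} ->
  (cherednik a j p)@_k = \sum_(m <- s) p@_m * (cherednik a j 'X_[m])@_k.
Proof.
move=> s_uniq ps; rewrite {1}(mpolyE p) linear_sum raddf_sum /=.
rewrite [RHS](bigID (mem (msupp p))) /= [X in _ = _ + X]big1 ?addr0 => [|m]; last first.
  by move=> /memN_msupp_eq0->; rewrite mul0r.
rewrite -[RHS]big_filter.
rewrite (perm_big [seq m <- s | m \in msupp p]) /=; last first.
  apply: uniq_perm; rewrite ?msupp_uniq ?filter_uniq // => m.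
  by rewrite mem_filter; case: (boolP (m \in msupp p)) => //= /ps->.
by apply: eq_bigr => m _; rewrite linearZ /= mcoeffZ.
Qed.

Definition cherednik_int j m k : int :=
  \sum_(i < N | (i < j)%N) low_coef i j m k + \sum_(i < N | (j < i)%N) high_coef i j m k
  - (j * (m == k))%N%:Z.

Lemma mcoeff_cherednikX a j m k :
  (cherednik a j 'X_[m])@_k = a *+ ((m == k) * m j) + (cherednik_int j m k)%:~R.
Proof.
rewrite cherednikE mcoeffB !mcoeffD mcoeffZ mcoeff_Xderiv mcoeffMn mcoeffX !raddf_sum /=.
rewrite !intrD intrN !rmorph_sum /= addrA addrA; congr (_ + _ + _ - _).
- by case: eqVneq => [->|_]; rewrite ?mulr1n ?mul1n ?mulr_natr // !mul0rn mulr0.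
- by apply: eq_bigr => i /ltn_ord_neq ij; rewrite mcoeff_XjdunklX.
- by apply: eq_bigr => i /gtn_ord_neq ij; rewrite mcoeff_XidunklX.
- by rewrite -mulrnA mulnC.
Qed.

End CherednikOperator.

Section Intertwining.
Variables (R : idomainType) (N : nat).
Implicit Types (a : R) (p g : {mpoly R[N]}) (i j l : 'I_N) (s : 'S_N).

Lemma msymXU s i : msym s 'X_i = 'X_(s i) :> {mpoly R[N]}.
Proof.
rewrite msymX; congr ('X_[_]); apply/mnmP => l.
by rewrite mnmE !mnm1E -(inj_eq (@perm_inj _ s)) permKV.
Qed.

Lemma msym_tpermK i j : involutive (@msym N R (tperm i j)).
Proof. by move=> p; rewrite -msymMm tperm2 msym1m. Qed.

Lemma msym_dunkl_quo s i j p : i != j ->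
  msym s (dunkl_quo i j p) = dunkl_quo (s i) (s j) (msym s p).
Proof.
move=> ij; apply/esym/dunkl_quo_uniq; first by rewrite (inj_eq perm_inj).
have -> : msym (tperm (s i) (s j)) (msym s p) = msym s (msym (tperm i j) p).
  by rewrite -!msymMm -tpermJ -conjgC.
by rewrite -msymB -mul_dunkl_quo // msymM msymB !msymXU.
Qed.

Lemma msym_Xderiv s j p : msym s ('X_j * p^`M(j)) = 'X_(s j) * (msym s p)^`M(s j).
Proof. by apply/mpolyP => k; rewrite mcoeff_sym !mcoeff_Xderiv mcoeff_sym mnmE. Qed.

Lemma Xderiv_mulX j l g :
  'X_j * ('X_l * g)^`M(j) = 'X_l * ('X_j * g^`M(j)) + (j == l)%:R *: ('X_l * g).
Proof.
rewrite mderivM mderivX mnm1E eq_sym mulrDr addrC mulrCA; congr (_ + _).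
case: eqVneq => [->|_]; last by rewrite !scale0r mul0r mulr0.
rewrite !scale1r (_ : (U_(l) - U_(l))%MM = 0%MM) ?mpolyX0 ?mul1r //.
by apply/mnmP => h; rewrite mnmBE mnm0E subnn.
Qed.

Lemma dunkl_quo_mulX i j l g : i != j -> l != i -> l != j ->
  dunkl_quo i j ('X_l * g) = 'X_l * dunkl_quo i j g.
Proof.
move=> ij li lj; apply: dunkl_quo_uniq => //.
by rewrite -mulrA mul_dunkl_quo // msymM msymXU tpermD 1?eq_sym // mulrBr.
Qed.

Lemma dunkl_quo_mulXl i j g : i != j ->
  dunkl_quo i j ('X_i * g) = 'X_j * dunkl_quo i j g - g.
Proof.
move=> ij; apply: dunkl_quo_uniq => //.
rewrite mulrBl -mulrA mul_dunkl_quo // msymM msymXU tpermL.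
by move: (msym _ _) => h; ring.
Qed.

Lemma dunkl_quo_mulXr i j g : i != j ->
  dunkl_quo i j ('X_j * g) = 'X_i * dunkl_quo i j g + g.
Proof.
move=> ij; apply: dunkl_quo_uniq => //.
rewrite mulrDl -mulrA mul_dunkl_quo // msymM msymXU tpermR.
by move: (msym _ _) => h; ring.
Qed.

Lemma msym_low_sum s j p : msym s (low_sum j p) =
  \sum_(i < N | (i < j)%N) 'X_(s j) * dunkl_quo (s i) (s j) (msym s p).
Proof.
rewrite raddf_sum /=; apply: eq_bigr => i ij.
by rewrite msymM msymXU msym_dunkl_quo ?ltn_ord_neq.
Qed.

Lemma msym_high_sum s j p : msym s (high_sum j p) =
  \sum_(i < N | (j < i)%N) 'X_(s i) * dunkl_quo (s i) (s j) (msym s p).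
Proof.
rewrite raddf_sum /=; apply: eq_bigr => i ij.
by rewrite msymM msymXU msym_dunkl_quo ?gtn_ord_neq.
Qed.

Lemma msym_cherednik s a j p : msym s (cherednik a j p) =
  a *: ('X_(s j) * (msym s p)^`M(s j)) + msym s (low_sum j p) + msym s (high_sum j p)
  - msym s p *+ j.
Proof. by rewrite cherednikE msymB !msymD msymZ msym_Xderiv msymMn. Qed.

Section SimpleTransposition.
Variables (x y : 'I_N).
Hypothesis xy : y = x.+1 :> nat.
Local Notation s := (tperm x y).

Lemma cherednik_msym_adj_off a j p : j != x -> j != y ->
  cherednik a j (msym s p) = msym s (cherednik a j p).
Proof.
move=> jx jy; have sj : s j = j by rewrite tpermD // eq_sym.
have lt_sj i : (s i < j)%N = (i < j)%N.
  by rewrite -{1}sj ltn_tperm_adj // xpair_eqE ?(negPf jx) ?(negPf jy) andbF.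
have lt_js i : (j < s i)%N = (j < i)%N.
  by rewrite -{1}sj ltn_tperm_adj // xpair_eqE ?(negPf jx) ?(negPf jy).
have msym_low : msym s (low_sum j p) = low_sum j (msym s p).
  rewrite msym_low_sum /low_sum [RHS](reindex_inj (@perm_inj _ s)) [RHS](eq_bigl _ _ lt_sj).
  by apply: eq_bigr => i _; rewrite sj.
have msym_high : msym s (high_sum j p) = high_sum j (msym s p).
  rewrite msym_high_sum /high_sum [RHS](reindex_inj (@perm_inj _ s)) [RHS](eq_bigl _ _ lt_js).
  by apply: eq_bigr => i _; rewrite sj.
by rewrite msym_cherednik cherednikE msym_low msym_high sj.
Qed.

Lemma low_sum_msym_adj p :
  low_sum y (msym s p) = 'X_y * dunkl_quo x y (msym s p) + msym s (low_sum x p).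
Proof.
rewrite [low_sum y _]/low_sum [LHS](bigD1 x) /=; last by rewrite xy.
apply: (congr1 (+%R _)).
rewrite msym_low_sum.
rewrite [LHS](reindex_inj (@perm_inj _ s)) /= tpermL; apply: eq_bigl => i.
by rewrite -val_eqE /= !(tperm_adjE _ xy) ?xy; do !case: eqP; lia.
Qed.

Lemma msym_high_sum_adj p :
  msym s (high_sum x p) = 'X_x * dunkl_quo x y (msym s p) + high_sum y (msym s p).
Proof.
rewrite msym_high_sum [LHS](bigD1 y) /=; last by rewrite xy.
rewrite tpermL tpermR; apply: (congr1 (+%R _)).
rewrite /high_sum [RHS](reindex_inj (@perm_inj _ s)) /=; apply: eq_bigl => i.
by rewrite -val_eqE /= !(tperm_adjE _ xy) ?xy; do !case: eqP; lia.
Qed.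

Lemma cherednik_msym_adj_r a p :
  cherednik a y (msym s p) = msym s (cherednik a x p) - p.
Proof.
rewrite msym_cherednik cherednikE low_sum_msym_adj msym_high_sum_adj tpermL xy mulrSr.
have xNy : x != y by apply: ltn_ord_neq; rewrite xy.
have := mul_dunkl_quo (msym s p) xNy; rewrite msym_tpermK.
move: (msym s (low_sum x p)) (high_sum y _) (a *: _) => S T e.
move: (msym s p) (dunkl_quo _ _ _) => g d dE.
have -> : p = g - d * ('X_y - 'X_x) by rewrite dE; ring.
ring.
Qed.

Lemma cherednik_msym_adj_l a p :
  cherednik a x (msym s p) = msym s (cherednik a y p) + p.
Proof.
by have := cherednik_msym_adj_r a (msym s p); rewrite msym_tpermK => ->;
   rewrite msymB !msym_tpermK subrK.
Qed.

End SimpleTransposition.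

End Intertwining.

Section AffineRaising.
Variables (R : idomainType) (n : nat).
Implicit Types (a : R) (p g : {mpoly R[n.+1]}) (i j : 'I_n.+1).

Definition cycle_perm : 'S_n.+1 := perm (@ord_pred_inj n.+1).
Local Notation c := cycle_perm.

Lemma cycle_permE i : c i = (if i == 0%N :> nat then n else i.-1) :> nat.
Proof.
rewrite permE /=; case: i => [[|i] ilt] /=; first by rewrite modn_small.
by rewrite modnDr modn_small // ltnW.
Qed.

Lemma cycle_perm0 : c ord0 = ord_max.
Proof. by apply/val_inj; rewrite /= cycle_permE. Qed.

Lemma ltn_cycle_perm i j : j != ord0 -> (c i < c j)%N = (i != ord0) && (i < j)%N.
Proof.
have := ltn_ord i; have := ltn_ord j.
by rewrite -!val_eqE /= !cycle_permE; case: eqP; case: eqP; lia.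
Qed.

Lemma gtn_cycle_perm i j : j != ord0 -> (c j < c i)%N = (i == ord0) || (j < i)%N.
Proof.
have := ltn_ord i; have := ltn_ord j.
by rewrite -!val_eqE /= !cycle_permE; case: eqP; case: eqP; lia.
Qed.

#[local] Opaque cycle_perm.

Lemma cycle_perm_eq_max i : (c i == ord_max) = (i == ord0).
Proof. by rewrite -cycle_perm0 (inj_eq perm_inj). Qed.

(* The affine intertwiner of Knop and Sahi. *)
Definition raise p : {mpoly R[n.+1]} := 'X_ord_max * msym c p.

Section NonzeroIndex.
Variable j : 'I_n.+1.
Hypothesis j0 : j != ord0.

Let cjNmax : c j != ord_max. Proof. by rewrite cycle_perm_eq_max. Qed.

Lemma msym_cycle_low_sum p : msym c (low_sum j p) =
  'X_(c j) * dunkl_quo ord_max (c j) (msym c p) + low_sum (c j) (msym c p).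
Proof.
rewrite msym_low_sum [LHS](bigD1 ord0) /=; last by rewrite lt0n.
rewrite cycle_perm0; apply: (congr1 (+%R _)).
rewrite /low_sum [RHS](reindex_inj (@perm_inj _ c)) /=; apply: eq_bigl => i.
by rewrite ltn_cycle_perm // andbC.
Qed.

Lemma low_sum_raise p : low_sum (c j) (raise p) = 'X_ord_max * low_sum (c j) (msym c p).
Proof.
rewrite /low_sum mulr_sumr; apply: eq_bigr => i ij; rewrite dunkl_quo_mulX; first exact: mulrCA.
- exact: ltn_ord_neq.
- by rewrite -val_eqE /= neq_ltn orbC (leq_trans ij) // -ltnS ltn_ord.
- by rewrite eq_sym.
Qed.

Lemma high_sum_raise p : high_sum (c j) (raise p) =
  'X_ord_max * ('X_(c j) * dunkl_quo ord_max (c j) (msym c p) - msym c p)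
  + 'X_ord_max * msym c (high_sum j p).
Proof.
have cj_lt_max : (c j < n)%N by have := ltn_ord (c j); move: cjNmax; rewrite -val_eqE /=; lia.
rewrite [high_sum (c j) _]/high_sum [LHS](bigD1 ord_max) /=; last by [].
rewrite dunkl_quo_mulXl; last by rewrite eq_sym.
apply: (congr1 (+%R _)).
rewrite msym_high_sum mulr_sumr [LHS](reindex_inj (@perm_inj _ c)) /=.
have rangeE i : (c j < c i)%N && (c i != ord_max) = (j < i)%N.
  by rewrite gtn_cycle_perm // cycle_perm_eq_max; case: eqVneq => [->|]; rewrite /= ?andbT ?ltn0.
rewrite (eq_bigl _ _ rangeE); apply: eq_bigr => i; rewrite -rangeE => /andP[ji iNmax].
rewrite dunkl_quo_mulX; first exact: mulrCA.
- exact: gtn_ord_neq.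
- by rewrite eq_sym.
- by rewrite eq_sym.
Qed.

Lemma cherednik_raise a p : cherednik a (c j) (raise p) = raise (cherednik a j p).
Proof.
have jE : j = (c j).+1 :> nat by rewrite cycle_permE (ifN _ _ j0) prednK // lt0n.
rewrite /raise msym_cherednik cherednikE Xderiv_mulX (negPf cjNmax) scale0r addr0.
rewrite -/(raise p) low_sum_raise high_sum_raise msym_cycle_low_sum jE mulrSr -!mul_mpolyC /raise.
move: (low_sum _ _) (msym c (high_sum _ _)) (_%:MP) => S T e.
by move: (msym c p) (dunkl_quo _ _ _) (_^`M(_)) => g d g'; ring.
Qed.

End NonzeroIndex.

Lemma low_sum_raise_max p :
  low_sum ord_max (raise p) = 'X_ord_max * (msym c (high_sum ord0 p) + msym c p *+ n).
Proof.
have -> : msym c p *+ n = \sum_(i < n.+1 | (i < @ord_max n)%N) msym c p.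
  by rewrite -(big_ord_widen _ (fun=> _)) //= sumr_const card_ord.
have -> : msym c (high_sum ord0 p) =
    \sum_(i < n.+1 | (i < @ord_max n)%N) 'X_i * dunkl_quo i ord_max (msym c p).
  rewrite msym_high_sum [RHS](reindex_inj (@perm_inj _ c)) /= cycle_perm0; apply: eq_bigl => i.
  by have := ltn_ord i; rewrite cycle_permE; case: (nat_of_ord i) => [|b] /=; lia.
rewrite -big_split mulr_sumr; apply: eq_bigr => i ij /=.
by rewrite dunkl_quo_mulXr ?ltn_ord_neq.
Qed.

Lemma cherednik_raise_max a p :
  cherednik a ord_max (raise p) = raise (cherednik a ord0 p + a *: p).
Proof.
rewrite {2}/raise msymD msymZ msym_cherednik cycle_perm0 cherednikE Xderiv_mulX eqxx scale1r.
have -> : low_sum ord0 p = 0 by rewrite /low_sum big_pred0.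
have -> : high_sum ord_max (raise p) = 0.
  by rewrite /high_sum big_pred0 // => i /=; have := ltn_ord i; lia.
rewrite low_sum_raise_max /raise msym0 /= mulr0n -!mul_mpolyC.
move: (msym c (high_sum _ _)) (_%:MP) => S e.
by move: (msym c p) (_^`M(_)) => g g'; ring.
Qed.

End AffineRaising.

(** * Dominance order and triangularity *)

Section Dominance.
Local Open Scope nat_scope.
Implicit Types (s t : seq nat) (c k v : nat).

(* Dominance of sorted sequences of equal sums amounts to the pointwise
   comparison of their excesses. *)
Definition excess s c := \sum_(x <- s) (x - c).

Lemma geq_trans : transitive geq.
Proof. exact: rev_trans leq_trans. Qed.

Lemma decr_rearr_sorted s : sorted geq (decr_rearr s).
Proof. by apply: sort_sorted => x y; apply: leq_total. Qed.

Lemma eq_decr_rearrP s t : reflect (decr_rearr s = decr_rearr t) (perm_eq s t).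
Proof.
apply: perm_sortP; [by move=> x y; apply: leq_total | exact: geq_trans |].
by move=> x y /andP[/= yx xy]; apply/eqP; rewrite eqn_leq yx xy.
Qed.

Lemma nth_decr_rearr_noninc s x y : x <= y -> nth 0 (decr_rearr s) y <= nth 0 (decr_rearr s) x.
Proof.
move=> xy; have [yN|yN] := ltnP y (size (decr_rearr s)); last by rewrite (nth_default _ yN).
have xN := leq_ltn_trans xy yN.
apply: (sorted_leq_nth (leT := geq)) (decr_rearr_sorted s) _ _ _ _ xy => //.
- exact: geq_trans.
- by move=> u; apply: leqnn.
Qed.

Lemma perm_excess s t c : perm_eq s t -> excess s c = excess t c.
Proof. exact: perm_big. Qed.

Lemma excess_decr_rearr s c : excess (decr_rearr s) c = excess s c.
Proof. by apply: perm_excess; rewrite perm_sort. Qed.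

Lemma sumn_take_le_excess s c k : sumn (take k s) <= excess s c + k * c.
Proof.
elim: s k => [|x s IH] [|k] //=; rewrite /excess big_cons.
by have := IH k; rewrite /excess mulSn; lia.
Qed.

Lemma sumn_take_sorted s k : sorted geq s ->
  sumn (take k s) = excess s (nth 0 s k) + k * nth 0 s k.
Proof.
rewrite /excess; elim: s k => [|x s IH] k /= s_sorted; first by rewrite big_nil nth_nil muln0.
have xs : all (geq x) s by apply: order_path_min s_sorted; apply: geq_trans.
rewrite big_cons; case: k => [|k] /=.
  rewrite subnn addn0 !add0n big_seq big1 // => y /(allP xs) /=; lia.
rewrite (IH k (path_sorted s_sorted)) mulSn.
suff : nth 0 s k <= x by lia.
have [ks|ks] := ltnP k (size s); last by rewrite nth_default.
exact: (allP xs) (mem_nth 0 ks).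
Qed.

Lemma dom_ge_decr_rearr s t : sumn s = sumn t -> (forall c, excess t c <= excess s c) ->
  dom_ge (decr_rearr s) (decr_rearr t).
Proof.
move=> sum_st excess_ts.
have sumn_decr u : sumn (decr_rearr u) = sumn u by apply: perm_sumn; rewrite perm_sort.
rewrite /dom_ge !sumn_decr sum_st eqxx /=; apply/allP => k _.
rewrite (sumn_take_sorted k (decr_rearr_sorted s)); set c := nth _ _ _.
by apply: leq_trans (sumn_take_le_excess _ c k) _; rewrite leq_add2r !excess_decr_rearr.
Qed.

Lemma excess_count s c : excess s c = excess s c.+1 + count (fun x => c < x) s.
Proof. by rewrite /excess; elim: s => [|x s IH]; rewrite ?big_nil ?big_cons //=; lia. Qed.

Lemma excess_perm s t : size s = size t -> excess s =1 excess t -> perm_eq s t.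
Proof.
move=> size_st excess_st.
have count_gt c : count (fun x => c < x) s = count (fun x => c < x) t.
  by have := excess_count s c; rewrite !excess_st excess_count => /addnI.
have count_ge c : count (fun x => c <= x) s = count (fun x => c <= x) t.
  by case: c => [|c]; [rewrite !(eq_count (a2 := predT)) ?count_predT | apply: count_gt].
have count_eq u v : count (fun x => v <= x) u = count (fun x => v < x) u + count_mem v u.
  by elim: u => //= x u ->; case: (ltngtP v x) => //=; lia.
apply/allP => v _ /=; apply/eqP.
by have := count_ge v; rewrite (count_eq s v) (count_eq t v) count_gt => /addnI.
Qed.

End Dominance.

Section CompositionOrder.
Variable N : nat.
Local Open Scope nat_scope.
Implicit Types (m k h : 'X_{1..N}) (i j l : 'I_N).

Lemma size_parts m : size (parts m) = N.
Proof. by rewrite size_map size_enum_ord. Qed.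

Lemma size_sp_star m : size (sp_star m) = N.
Proof. by rewrite size_sort size_parts. Qed.

Lemma size_sp_circ M m : size (sp_circ M m) = N.
Proof. by rewrite size_sort size_map size_enum_ord. Qed.

Lemma sumn_parts m : sumn (parts m) = mdeg m.
Proof. by rewrite sumnE big_map big_enum mdegE. Qed.

Lemma nth_parts m i : nth 0 (parts m) i = m i.
Proof. by rewrite (nth_map i) ?size_enum_ord // nth_ord_enum. Qed.

Lemma excess_parts m c : excess (parts m) c = \sum_(i < N) (m i - c).
Proof. by rewrite /excess big_map big_enum. Qed.

Lemma sp_star_excess m k : excess (parts m) =1 excess (parts k) <-> sp_star m = sp_star k.
Proof.
split=> [excess_eq|/eq_decr_rearrP excess_eq c]; last exact: perm_excess.
by apply/eq_decr_rearrP/excess_perm; rewrite ?size_parts.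
Qed.

Definition prefix_count m p v := \sum_(i < N | i < p) (v <= m i).

(* Compositions are compared by dominance of their sorted parts and, among
   rearrangements of the same parts, by their prefix counts. *)
Definition comp_le k m : Prop :=
  [/\ mdeg k = mdeg m, forall c, excess (parts k) c <= excess (parts m) c
    & excess (parts k) =1 excess (parts m) ->
      forall p v, prefix_count k p v <= prefix_count m p v].

Lemma comp_le_refl m : comp_le m m. Proof. by split. Qed.

Lemma comp_le_trans k m h : comp_le m k -> comp_le h m -> comp_le h k.
Proof.
move=> [deg_mk ex_mk cnt_mk] [deg_hm ex_hm cnt_hm]; split; first by rewrite deg_hm.
  by move=> c; apply: leq_trans (ex_hm c) (ex_mk c).
move=> ex_hk.
have ex_mk_eq c : excess (parts m) c = excess (parts k) c.
  by apply/eqP; rewrite eqn_leq ex_mk -ex_hk ex_hm.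
have ex_hm_eq c : excess (parts h) c = excess (parts m) c by rewrite ex_hk ex_mk_eq.
by move=> p v; apply: leq_trans (cnt_hm ex_hm_eq p v) (cnt_mk ex_mk_eq p v).
Qed.

Lemma prefix_countS m i v : prefix_count m i.+1 v = prefix_count m i v + (v <= m i).
Proof.
rewrite /prefix_count (bigD1 i) //= addnC; congr (_ + _); apply: eq_bigl => l.
by rewrite -val_eqE /=; lia.
Qed.

Lemma prefix_count_inj m k : (forall p v, prefix_count m p v = prefix_count k p v) -> m = k.
Proof.
move=> cnt_mk; apply/mnmP => i.
have le_mk v : (v <= m i) = (v <= k i).
  have := cnt_mk i.+1 v; rewrite !prefix_countS cnt_mk => /addnI.
  by case: (v <= m i); case: (v <= k i).
by apply/eqP; rewrite eqn_leq -le_mk leqnn le_mk leqnn.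
Qed.

Lemma comp_le_anti m k : comp_le m k -> comp_le k m -> m = k.
Proof.
move=> [_ ex_mk cnt_mk] [_ ex_km cnt_km].
have excess_eq c : excess (parts m) c = excess (parts k) c.
  by apply/eqP; rewrite eqn_leq ex_mk ex_km.
apply: prefix_count_inj => p v; apply/eqP.
by rewrite eqn_leq cnt_mk // cnt_km // => c; rewrite excess_eq.
Qed.

Lemma sum_exchanged (F : nat -> nat) i j m k (P : pred 'I_N) : i != j -> exchanged i j m k ->
  \sum_(l < N | P l) F (k l) + (P i * F (m i) + P j * F (m j)) =
  \sum_(l < N | P l) F (m l) + (P i * F (k i) + P j * F (k j)).
Proof.
move=> ij ex; rewrite !(big_mkcond P) (bigD1 i) //= (bigD1 j) 1?eq_sym //=.
rewrite [X in _ = X + _](bigD1 i) //= [X in _ = _ + X + _](bigD1 j) 1?eq_sym //=.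
rewrite (eq_bigr (fun l => if P l then F (m l) else 0)); last first.
  by move=> l /andP[li lj]; rewrite (exchanged_off ex).
by case: (P i); case: (P j); rewrite ?mul1n ?mul0n; lia.
Qed.

Lemma comp_le_exchanged i j m k : i < j -> exchanged i j m k ->
  k i <= maxn (m i) (m j) -> k j <= maxn (m i) (m j) ->
  ~~ ((m i < m j) && (k i == m j)) -> comp_le k m.
Proof.
move=> lt_ij ex ki kj no_ascent; have ij := ltn_ord_neq lt_ij.
have sum_ij := exchanged_sum ex.
have exE c : excess (parts k) c + ((m i - c) + (m j - c)) =
             excess (parts m) c + ((k i - c) + (k j - c)).
  by have := sum_exchanged (subn^~ c) predT ij ex; rewrite !mul1n !excess_parts.
have excess0 h : excess (parts h) 0 = mdeg h.
  by rewrite excess_parts mdegE; apply: eq_bigr => l _; rewrite subn0.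
split.
- by have := exE 0; rewrite !excess0; lia.
- by move=> c; have := exE c; lia.
move=> ex_eq p v.
have swap : (k i == m i) && (k j == m j) || [&& k i == m j, k j == m i & m j <= m i].
  by have := exE (maxn (k i) (k j)); rewrite ex_eq; lia.
have := sum_exchanged (fun x => (v <= x) : nat) (fun l => l < p) ij ex.
rewrite -/(prefix_count k p v) -/(prefix_count m p v).
case/orP: swap => [/andP[/eqP-> /eqP->]|/and3P[/eqP-> /eqP-> le_mji]]; first lia.
by have [ip|ip] := ltnP i p; have [jp|jp] := ltnP j p; rewrite ?mul1n ?mul0n; lia.
Qed.

Lemma sumn_take_parts m p : p <= N -> sumn (take p (parts m)) = \sum_(i < N | i < p) m i.
Proof.
move=> pN; rewrite sumnE (big_nth 0) size_take size_parts.
have -> : (if p < N then p else N) = p by case: ltnP pN => //; lia.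
rewrite big_mkord (big_ord_widen _ (fun i : nat => nth 0 (take p (parts m)) i) pN).
by apply: eq_bigr => i ip; rewrite nth_take // nth_parts.
Qed.

Lemma sum_prefix_count m p :
  \sum_(i < N | i < p) m i = \sum_(1 <= v < (mdeg m).+1) prefix_count m p v.
Proof.
rewrite exchange_big /=; apply: eq_bigr => i ip.
have mi : m i <= mdeg m by rewrite mdegE (bigD1 i) //= leq_addr.
suff -> d : \sum_(1 <= v < d.+1) (v <= m i) = minn (m i) d by rewrite (minn_idPl mi).
elim: d => [|d IH]; first by rewrite big_geq ?minn0.
by rewrite big_nat_recr //= IH; lia.
Qed.

Lemma comp_le_dom_ge m k : comp_le k m -> dom_ge (sp_star m) (sp_star k).
Proof. by move=> [deg_km ex_km _]; apply: dom_ge_decr_rearr; rewrite ?sumn_parts. Qed.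

Lemma comp_le_comp_gt m k : comp_le k m -> m != k -> comp_gt m k.
Proof.
move=> km neq; rewrite /comp_gt neq /=.
have [parts_eq|parts_eq] := eqVneq (decr_rearr (parts m)) (decr_rearr (parts k)); last first.
  by rewrite /dom_gt parts_eq (comp_le_dom_ge km).
apply/orP; right; apply/allP => p _; have [deg_km _ cnt_km] := km.
have ex_eq : excess (parts k) =1 excess (parts m).
  by apply/sp_star_excess; rewrite /sp_star parts_eq.
have [pN|pN] := leqP p N; last first.
  by rewrite !take_oversize ?size_parts ?(ltnW pN) // !sumn_parts deg_km.
by rewrite !sumn_take_parts // !sum_prefix_count deg_km; apply: leq_sum => v _; apply: cnt_km.
Qed.

Lemma excess_circ M m c :
  excess [seq m i + (i < M) | i <- enum 'I_N] c = excess (parts m) c + prefix_count m M c.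
Proof.
rewrite excess_parts /excess big_map big_enum /= /prefix_count [X in _ + X]big_mkcond -big_split /=.
by apply: eq_bigr => i _; case: (i < M) => /=; lia.
Qed.

Lemma comp_le_dom_ge_circ M m k : comp_le k m -> sp_star m = sp_star k ->
  dom_ge (sp_circ M m) (sp_circ M k).
Proof.
move=> [deg_km ex_km cnt_km] /sp_star_excess ex_eq; apply: dom_ge_decr_rearr => [|c].
  have sumE h : sumn [seq h i + (i < M) | i <- enum 'I_N] = mdeg h + \sum_(i < N) (i < M).
    by rewrite sumnE big_map big_enum /= big_split /= -mdegE.
  by rewrite !sumE deg_km.
by rewrite !excess_circ leq_add // cnt_km.
Qed.

End CompositionOrder.

Lemma seq_has_maximal (T : eqType) (le : T -> T -> Prop) (s : seq T) x :
  (forall y z w, le z y -> le w z -> le w y) ->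
  (forall y z, le y z -> le z y -> y = z) -> (forall y, le y y) ->
  x \in s -> exists y, [/\ y \in s, le x y & forall z, z \in s -> le y z -> z = y].
Proof.
move=> tr anti refl; have [n] := ubnP (size s); elim: n s x => // n IH s x sn xs.
have [[z [zs xz /eqP zx]]|x_max] := boolp.EM (exists z, [/\ z \in s, le x z & z <> x]);
  last first.
  exists x; split => // z zs xz; have [//|/eqP zx] := eqVneq z x.
  by case: x_max; exists z.
have mem_rem_x w : (w \in s) = (w == x) || (w \in rem x s).
  by rewrite (perm_mem (perm_to_rem xs)) inE.
have [||y [ys zy y_max]] := IH (rem x s) z.
- by rewrite size_rem //; case: s sn xs {zs mem_rem_x} => //= a s; rewrite ltnS.
- by move: zs; rewrite mem_rem_x (negPf zx).
have xy : le x y by apply: tr zy xz.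
exists y; split => // [|w ws yw]; first exact: mem_rem ys.
have [wx|wx] := eqVneq w x; first by apply: anti => //; rewrite wx.
by apply: y_max => //; move: ws; rewrite mem_rem_x (negPf wx).
Qed.

Section Rank.
Variable N : nat.
Implicit Types (m k : 'X_{1..N}) (i j l : 'I_N) (s : 'S_N).

Definition before m i j : bool := (m j < m i)%N || ((m i == m j) && (i < j)%N).

Lemma before_irr m i : before m i i = false.
Proof. by rewrite /before !ltnn andbF. Qed.

Lemma before_trans m i j l : before m i j -> before m j l -> before m i l.
Proof. by rewrite /before; lia. Qed.

Lemma before_total m i j : i != j -> before m i j || before m j i.
Proof. by rewrite /before -val_eqE /=; lia. Qed.

(* The row, counted from 0, that position [j] occupies in the sorted composition. *)
Definition comp_rank m j : nat := #|[set i | before m i j]|.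

Lemma comp_rank_sum m j : comp_rank m j = (\sum_(i < N) before m i j)%N.
Proof.
by rewrite /comp_rank -sum1_card big_mkcond; apply: eq_bigr => i _; rewrite inE; case: before.
Qed.

Lemma ltn_comp_rank m i j : (comp_rank m i < comp_rank m j)%N = before m i j.
Proof.
have before_lt x y : before m x y -> (comp_rank m x < comp_rank m y)%N.
  move=> xy; apply: proper_card; apply/properP; split.
    by apply/subsetP => z; rewrite !inE => zx; apply: before_trans xy.
  by exists x; rewrite !inE ?before_irr.
apply/idP/idP; last exact: before_lt.
apply: contraTT => nij; have [->|ij] := eqVneq i j; first by rewrite ltnn.
by have := before_total m ij; rewrite (negPf nij) /= => /before_lt; lia.
Qed.

Lemma comp_rank_ltn m j : (comp_rank m j < N)%N.
Proof.
rewrite -[X in (_ < X)%N](card_ord N) -cardsT; apply: proper_card.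
by apply/properP; split; [apply: subsetT | exists j; rewrite !inE ?before_irr].
Qed.

Lemma comp_rank_inj m : injective (comp_rank m).
Proof.
move=> i j rank_eq; apply/eqP; apply: contraTT isT => ij.
by have := before_total m ij; rewrite -!ltn_comp_rank rank_eq ltnn.
Qed.

Definition rank_ord m j : 'I_N := Ordinal (comp_rank_ltn m j).

Lemma rank_ord_inj m : injective (rank_ord m).
Proof. by move=> i j /(congr1 val) /comp_rank_inj. Qed.

Definition rank_perm m : 'S_N := perm (@rank_ord_inj m).

Lemma rank_permE m j : rank_perm m j = comp_rank m j :> nat.
Proof. by rewrite permE. Qed.

Lemma comp_rank_onto m x : (x < N)%N -> exists i, comp_rank m i = x.
Proof. by move=> xN; exists ((rank_perm m)^-1 (Ordinal xN))%g; rewrite -rank_permE permKV. Qed.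

Lemma comp_rank_transport m k s :
  (forall i j, before k (s i) (s j) = before m i j) ->
  forall j, comp_rank k (s j) = comp_rank m j.
Proof.
move=> before_s j; rewrite !comp_rank_sum (reindex_inj (@perm_inj _ s)) /=.
by apply: eq_bigr => i _; rewrite before_s.
Qed.

Lemma nth_decr_rearr m (v : 'I_N -> nat) j :
  (forall i j, before m i j -> v j <= v i)%N ->
  nth 0%N (decr_rearr [seq v i | i <- enum 'I_N]) (comp_rank m j) = v j.
Proof.
move=> v_mono; pose w := rank_perm m.
pose sorted_v := [seq v ((w^-1)%g i) | i <- enum 'I_N].
have nth_sorted_v l : nth 0%N sorted_v l = v ((w^-1)%g l).
  by rewrite (nth_map l) ?size_enum_ord // nth_ord_enum.
suff -> : decr_rearr [seq v i | i <- enum 'I_N] = sorted_v.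
  by rewrite -rank_permE nth_sorted_v permK.
apply: (sorted_eq geq_trans) => [x y /andP[/= yx xy]|||].
- by apply/eqP; rewrite eqn_leq yx xy.
- exact: decr_rearr_sorted.
- apply/(sortedP 0%N) => i; rewrite size_map size_enum_ord => iN; have iN' := ltnW iN.
  rewrite (nth_sorted_v (Ordinal iN)) (nth_sorted_v (Ordinal iN')) /=.
  by apply: v_mono; rewrite -ltn_comp_rank -!rank_permE !permKV.
- rewrite perm_sort /sorted_v (map_comp v (w^-1)%g); apply: perm_map.
  apply: uniq_perm; rewrite ?enum_uniq ?(map_inj_uniq perm_inj) ?enum_uniq // => i.
  by rewrite mem_enum inE; apply/esym/mapP; exists (w i); rewrite ?mem_enum // permK.
Qed.

Lemma nth_sp_star m j : nth 0%N (sp_star m) (comp_rank m j) = m j.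
Proof. by apply: nth_decr_rearr => i l; rewrite /before; lia. Qed.

Lemma nth_sp_circ M m j : nth 0%N (sp_circ M m) (comp_rank m j) = (m j + (j < M))%N.
Proof. by apply: nth_decr_rearr => i l; rewrite /before; lia. Qed.

End Rank.

Section Triangularity.
Variables (R : idomainType) (N : nat).
Implicit Types (p q : {mpoly R[N]}) (m k : 'X_{1..N}) (i j : 'I_N) (a : R).

Lemma barE a m j : bar a m j = a *+ m j - (comp_rank m j)%:R.
Proof.
rewrite /bar -addrA -opprD -natrD; congr (_ - _%:R).
have card_sum (P : pred 'I_N) : #|[set i | P i]| = (\sum_(i < N) P i)%N.
  by rewrite -sum1_card big_mkcond; apply: eq_bigr => i _; rewrite inE; case: (P i).
rewrite comp_rank_sum !card_sum -big_split; apply: eq_bigr => i _.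
by rewrite /before; have [->|] := eqVneq i j; rewrite ?ltnn ?eqxx // -val_eqE /=; lia.
Qed.

Lemma cherednik_int_diag j m : cherednik_int j m m = - (comp_rank m j)%:Z.
Proof.
have jE : (j = \sum_(i < N | (i < j)%N) 1 :> nat)%N.
  by rewrite -(big_ord_widen _ (fun=> 1%N)) 1?ltnW // sum_nat_const card_ord muln1.
rewrite /cherednik_int eqxx muln1 {3}jE comp_rank_sum -!natz !natr_sum -!sumrN addrAC -big_split /=.
rewrite !(big_mkcond (fun i : 'I_N => _ < _)%N) -big_split /=; apply: eq_bigr => i _.
rewrite /low_coef /high_coef /before exchanged_refl.
by have [ij|ji|ij] := ltngtP i j; rewrite ?(val_inj ij); lia.
Qed.

Lemma mcoeff_cherednikX_diag a j m : (cherednik a j 'X_[m])@_m = bar a m j.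
Proof. by rewrite mcoeff_cherednikX eqxx mul1n cherednik_int_diag intrN barE -pmulrn. Qed.

Lemma comp_le_low_coef i j m k : (i < j)%N -> low_coef i j m k != 0 -> comp_le k m.
Proof.
move=> ij; rewrite /low_coef; case ex: (exchanged _ _ _ _); last by [].
by have sumE := exchanged_sum ex => ?; apply: (comp_le_exchanged ij ex); lia.
Qed.

Lemma comp_le_high_coef i j m k : (j < i)%N -> high_coef i j m k != 0 -> comp_le k m.
Proof.
move=> ji; rewrite /high_coef; case ex: (exchanged _ _ _ _); last by [].
have sumE := exchanged_sum ex; rewrite (exchangedC _ _ (gtn_ord_neq ji)) in ex => ?.
by apply: (comp_le_exchanged ji ex); lia.
Qed.

Lemma comp_le_cherednikX a j m k : (cherednik a j 'X_[m])@_k != 0 -> comp_le k m.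
Proof.
rewrite mcoeff_cherednikX /cherednik_int; have [->|mk] := eqVneq m k.
  by move=> _; apply: comp_le_refl.
have [i /andP[ij low] _|low0] := pickP [pred i : 'I_N | (i < j)%N && (low_coef i j m k != 0)].
  exact: comp_le_low_coef low.
have [i /andP[ji high] _|high0] := pickP [pred i : 'I_N | (j < i)%N && (high_coef i j m k != 0)].
  exact: comp_le_high_coef high.
rewrite mul0n mulr0n muln0 !big1 ?subrr ?addr0 ?eqxx // => i ij.
  by have := high0 i; rewrite /= ij => /negbFE/eqP.
by have := low0 i; rewrite /= ij => /negbFE/eqP.
Qed.

Definition maximal_at k p := forall m, comp_le k m -> m != k -> p@_m = 0.

Lemma maximal_at_mcoeff_cherednik a j k p m : maximal_at k p -> comp_le k m ->
  (cherednik a j p)@_m = bar a k j * p@_k *+ (m == k).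
Proof.
move=> p_max km; rewrite (@mcoeff_cherednik _ _ _ _ _ _ (undup (k :: msupp p))) ?undup_uniq //;
  last by move=> h; rewrite mem_undup inE orbC => ->.
rewrite (bigD1_seq k) ?undup_uniq ?mem_undup ?mem_head //= big1 ?addr0 => [|h hk].
  have [->|mk] := eqVneq m k; first by rewrite mcoeff_cherednikX_diag mulrC.
  have [->|/comp_le_cherednikX mk'] := eqVneq (cherednik a j 'X_[k])@_m 0; first by rewrite mulr0.
  by rewrite (comp_le_anti mk' km) eqxx in mk.
have [->|/comp_le_cherednikX mh] := eqVneq (cherednik a j 'X_[h])@_m 0; first by rewrite mulr0.
by rewrite p_max ?mul0r //; apply: comp_le_trans mh km.
Qed.

Lemma maximal_at_cherednik a j k p : maximal_at k p -> maximal_at k (cherednik a j p).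
Proof.
by move=> p_max m km mk; rewrite (maximal_at_mcoeff_cherednik _ _ p_max km) (negPf mk).
Qed.

Lemma exists_maximal_at p m : m \in msupp p ->
  exists k, [/\ k \in msupp p, comp_le m k & maximal_at k p].
Proof.
move=> mp; have [k [kp mk k_max]] :=
  seq_has_maximal (@comp_le_trans N) (@comp_le_anti N) (@comp_le_refl N) mp.
exists k; split => // h kh hk; apply: memN_msupp_eq0.
by apply: contraNN hk => hp; rewrite (k_max h).
Qed.

Definition joint_eigen a (t : 'I_N -> R) p := forall j, cherednik a j p = t j *: p.

Lemma joint_eigenD a t p q : joint_eigen a t p -> joint_eigen a t q -> joint_eigen a t (p + q).
Proof. by move=> p_eigen q_eigen j; rewrite linearD /= p_eigen q_eigen scalerDr. Qed.

Lemma joint_eigenZ a t c p : joint_eigen a t p -> joint_eigen a t (c *: p).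
Proof. by move=> p_eigen j; rewrite linearZ /= p_eigen !scalerA mulrC. Qed.

Lemma joint_eigenB a t p q : joint_eigen a t p -> joint_eigen a t q -> joint_eigen a t (p - q).
Proof.
by move=> p_eigen q_eigen; rewrite -scaleN1r; apply: joint_eigenD => //; apply: joint_eigenZ.
Qed.

Lemma joint_eigen_bar a t p m : joint_eigen a t p -> m \in msupp p ->
  exists k, [/\ k \in msupp p, comp_le m k & forall j, t j = bar a k j].
Proof.
move=> p_eigen /exists_maximal_at[k [kp mk k_max]]; exists k; split => // j.
have := maximal_at_mcoeff_cherednik a j k_max (comp_le_refl k).
by rewrite p_eigen mcoeffZ eqxx mulr1n => /(mulIf _); apply; rewrite -mcoeff_msupp.
Qed.

End Triangularity.

Section SekiguchiOperators.
Variables (R : idomainType) (N M : nat).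
Implicit Types (p q : {mpoly R[N]}) (m k : 'X_{1..N}) (i j : 'I_N) (a u : R).

Lemma eps_sp_star a u m : eps N (sp_star m) a u = \prod_(j < N) (u + bar a m j).
Proof.
rewrite /eps (reindex_inj (@perm_inj _ (rank_perm m))); apply: eq_bigr => j _.
by rewrite rank_permE nth_sp_star barE addrA.
Qed.

Lemma eps_sp_circ a u m :
  eps N (sp_circ M m) a u = \prod_(j < N) (u + a *+ (j < M)%N + bar a m j).
Proof.
rewrite /eps (reindex_inj (@perm_inj _ (rank_perm m))); apply: eq_bigr => j _.
by rewrite rank_permE nth_sp_circ barE mulrnDr; ring.
Qed.

Definition sekiguchi (w : 'I_N -> R) a p : {mpoly R[N]} :=
  foldr (fun i q => w i *: q + cherednik a i q) p (enum 'I_N).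

Lemma sekiguchi_starE a u p : sekiguchi_star a u p = sekiguchi (fun=> u) a p.
Proof. by []. Qed.

Lemma sekiguchi_circE a u p :
  sekiguchi_circ M a u u p = sekiguchi (fun j => u + a *+ (j < M)%N) a p.
Proof.
rewrite /sekiguchi_circ /sekiguchi; elim: (enum _) => //= i s ->.
by case: ltnP; rewrite ?mulr1n ?mulr0n ?addr0.
Qed.

Lemma sekiguchi_joint_eigen w a t p : joint_eigen a t p ->
  sekiguchi w a p = (\prod_(j < N) (w j + t j)) *: p.
Proof.
move=> p_eigen; rewrite /sekiguchi -big_enum /=; elim: (enum _) => [|i s IH] /=.
  by rewrite big_nil scale1r.
by rewrite big_cons IH (joint_eigenZ _ p_eigen) !scalerA -scalerDl; congr (_ *: _); ring.
Qed.

Lemma maximal_at_mcoeff_sekiguchi w a k p : maximal_at k p ->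
  (sekiguchi w a p)@_k = \prod_(j < N) (w j + bar a k j) * p@_k.
Proof.
move=> p_max; rewrite /sekiguchi -big_enum /=; set op := fun i q => _.
suff [] : maximal_at k (foldr op p (enum 'I_N)) /\
  (foldr op p (enum 'I_N))@_k = \prod_(j <- enum 'I_N) (w j + bar a k j) * p@_k by [].
elim: (enum _) => [|i s [q_max IH]] /=; first by rewrite big_nil mul1r.
split=> [m km mk|].
  by rewrite mcoeffD mcoeffZ q_max // (maximal_at_cherednik a i q_max) // mulr0 addr0.
rewrite big_cons mcoeffD mcoeffZ (maximal_at_mcoeff_cherednik _ _ q_max (comp_le_refl k)).
by rewrite eqxx mulr1n IH; ring.
Qed.

Lemma sekiguchi_linear w a : linear (sekiguchi w a).
Proof.
move=> c p q; rewrite /sekiguchi; elim: (enum _) => //= i s ->.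
by rewrite cherednik_linear !scalerDr !scalerA (mulrC (w i) c) addrACA.
Qed.

HB.instance Definition _ w a :=
  GRing.isLinear.Build R {mpoly R[N]} {mpoly R[N]} _ (sekiguchi w a) (sekiguchi_linear w a).

End SekiguchiOperators.

(* Morphisms, evaluation at a point where only some elements are defined, and
   membership in a subring are all instances of such relations. *)
Record ring_relation (R S : pzRingType) (rl : R -> S -> Prop) : Prop := RingRelation {
  rel0 : rl 0 0;
  rel1 : rl 1 1;
  relD : forall x x' y y', rl x y -> rl x' y' -> rl (x + x') (y + y');
  relM : forall x x' y y', rl x y -> rl x' y' -> rl (x * x') (y * y');
  relN : forall x y, rl x y -> rl (- x) (- y)
}.

Section RingRelationTheory.
Variables (R S : pzRingType) (rl : R -> S -> Prop).
Hypothesis rl_ring : ring_relation rl.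

Lemma rel_muln x y n : rl x y -> rl (x *+ n) (y *+ n).
Proof.
move=> xy; elim: n => [|n IH]; first by rewrite !mulr0n; apply: rel0 rl_ring.
by rewrite !mulrS; apply: (relD rl_ring).
Qed.

Lemma rel_nat n : rl n%:R n%:R. Proof. exact/rel_muln/(rel1 rl_ring). Qed.

Lemma rel_int (z : int) : rl z%:~R z%:~R.
Proof. by case: z => n; [apply: rel_nat | apply/(relN rl_ring)/rel_nat]. Qed.

Lemma relB x x' y y' : rl x y -> rl x' y' -> rl (x - x') (y - y').
Proof. by move=> xy /(relN rl_ring); apply: (relD rl_ring). Qed.

Lemma rel_sum (I : Type) (s : seq I) (P : pred I) f g :
  (forall i, P i -> rl (f i) (g i)) -> rl (\sum_(i <- s | P i) f i) (\sum_(i <- s | P i) g i).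
Proof.
move=> fg; elim/big_rec2: _ => [|i x y Pi]; first exact: rel0 rl_ring.
by apply: (relD rl_ring); apply: fg.
Qed.

Lemma rel_prod (I : Type) (s : seq I) (P : pred I) f g :
  (forall i, P i -> rl (f i) (g i)) -> rl (\prod_(i <- s | P i) f i) (\prod_(i <- s | P i) g i).
Proof.
move=> fg; elim/big_rec2: _ => [|i x y Pi]; first exact: rel1 rl_ring.
by apply: (relM rl_ring); apply: fg.
Qed.

Definition poly_rel (f : seq R) (g : seq S) := forall i, rl f`_i g`_i.

End RingRelationTheory.

Lemma ring_relation_poly (R S : nzRingType) (rl : R -> S -> Prop) : ring_relation rl ->
  ring_relation (fun (f : {poly R}) (g : {poly S}) => poly_rel rl f g).
Proof.
move=> rl_ring; split=> [i|i|f f' g g' fg fg' i|f f' g g' fg fg' i|f g fg i].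
- by rewrite !coef0; apply: rel0 rl_ring.
- by rewrite !coef1; apply: rel_nat.
- by rewrite !coefD; apply: (relD rl_ring).
- by rewrite !coefM; apply: (rel_sum rl_ring) => j _; apply: (relM rl_ring).
- by rewrite !coefN; apply: (relN rl_ring).
Qed.

Section BaseChange.
Variables (R S : idomainType) (rl : R -> S -> Prop) (N : nat).
Hypothesis rl_ring : ring_relation rl.
Implicit Types (p : {mpoly R[N]}) (q : {mpoly S[N]}).

Lemma rel_eps lam a b u v : rl a b -> rl u v -> rl (eps N lam a u) (eps N lam b v).
Proof.
move=> ab uv; apply: (rel_prod rl_ring) => i _; apply: (relB rl_ring); last exact: rel_nat.
by apply: (relD rl_ring) => //; apply: rel_muln.
Qed.

Definition mpoly_rel p q := forall m, rl p@_m q@_m.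

Lemma mpoly_rel_cherednik a b j p q :
  rl a b -> mpoly_rel p q -> mpoly_rel (cherednik a j p) (cherednik b j q).
Proof.
move=> ab pq k; pose s := undup (msupp p ++ msupp q).
rewrite !(@mcoeff_cherednik _ _ _ _ _ _ s) ?undup_uniq //; last 2 first.
- by move=> m mq; rewrite mem_undup mem_cat mq orbT.
- by move=> m mp; rewrite mem_undup mem_cat mp.
apply: (rel_sum rl_ring) => m _; apply: (relM rl_ring) => //; rewrite !mcoeff_cherednikX.
by apply: (relD rl_ring); [apply: rel_muln | apply: rel_int].
Qed.

Lemma mpoly_relZ c d p q : rl c d -> mpoly_rel p q -> mpoly_rel (c *: p) (d *: q).
Proof. by move=> cd pq m; rewrite !mcoeffZ; apply: (relM rl_ring). Qed.

Lemma mpoly_rel_sekiguchi w w' a b p q : (forall j, rl (w j) (w' j)) -> rl a b ->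
  mpoly_rel p q -> mpoly_rel (sekiguchi w a p) (sekiguchi w' b q).
Proof.
move=> ww ab pq; rewrite /sekiguchi; elim: (enum _) => [|i s IH] //= m.
rewrite [X in rl X _]mcoeffD [X in rl _ X]mcoeffD.
exact: (relD rl_ring) (mpoly_relZ (ww i) IH m) (mpoly_rel_cherednik i ab IH m).
Qed.

End BaseChange.

Lemma map_cherednik (R S : idomainType) (f : {rmorphism R -> S}) N a j (p : {mpoly R[N]}) :
  map_mpoly f (cherednik a j p) = cherednik (f a) j (map_mpoly f p).
Proof.
have graph_ring : ring_relation (fun x y => f x = y).
  by split=> [||? ? ? ? <- <-|? ? ? ? <- <-|? ? <-];
     rewrite ?rmorph0 ?rmorph1 ?rmorphD ?rmorphM ?rmorphN.
apply/mpolyP => m; rewrite mcoeff_map_mpoly /=.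
apply: (mpoly_rel_cherednik graph_ring) => // k.
by rewrite mcoeff_map_mpoly.
Qed.

(** * Generic non-symmetric Jack polynomials *)

Section ExponentPermutation.
Variable N : nat.
Implicit Types (m k : 'X_{1..N}) (x y i j : 'I_N) (s t : 'S_N).

Definition mperm s m : 'X_{1..N} := [multinom m (s i) | i < N].

Lemma mpermE s m i : mperm s m i = m (s i). Proof. exact: mnmE. Qed.

Lemma mperm_id m : mperm 1%g m = m. Proof. exact: mperm1. Qed.

Lemma mperm_mul s t m : mperm s (mperm t m) = mperm (s * t)%g m.
Proof. by apply/mnmP => i; rewrite !mpermE permM. Qed.

Lemma mperm_tpermK x y : involutive (mperm (tperm x y)).
Proof. by move=> m; rewrite mperm_mul tperm2 mperm_id. Qed.

Lemma mperm_tperm_tie x y m : m x = m y -> mperm (tperm x y) m = m.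
Proof. by move=> mxy; apply/mnmP => i; rewrite mpermE; case: tpermP => [->|->|]. Qed.

Lemma mcoeff_msym (R : nzRingType) s (p : {mpoly R[N]}) m : (msym s p)@_m = p@_(mperm s m).
Proof. exact: mcoeff_sym. Qed.

Lemma perm_parts_mperm s m : perm_eq (parts (mperm s m)) (parts m).
Proof.
apply: excess_perm => [|c]; first by rewrite !size_parts.
rewrite !excess_parts [RHS](reindex_inj (@perm_inj _ s)) /=.
by apply: eq_bigr => i _; rewrite mpermE.
Qed.

Lemma sp_star_mperm s m : sp_star (mperm s m) = sp_star m.
Proof. exact/eq_decr_rearrP/perm_parts_mperm. Qed.

Lemma before_mperm_adj x y m i j : y = x.+1 :> nat -> m x != m y ->
  before (mperm (tperm x y) m) (tperm x y i) (tperm x y j) = before m i j.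
Proof.
move=> xy mxy; rewrite /before !mpermE !tpermK; case: eqP => //= mij; congr (_ || _).
by apply: ltn_tperm_adj => //; apply: contraNneq mxy => -[ix jy]; rewrite -ix -jy mij.
Qed.

Lemma comp_rank_mperm_adj x y m j : y = x.+1 :> nat -> m x != m y ->
  comp_rank (mperm (tperm x y) m) (tperm x y j) = comp_rank m j.
Proof.
by move=> xy mxy; apply: (comp_rank_transport (s := tperm x y)) => i l; apply: before_mperm_adj.
Qed.

Lemma bar_mperm_adj (R : idomainType) (a : R) x y m j : y = x.+1 :> nat -> m x != m y ->
  bar a (mperm (tperm x y) m) j = bar a m (tperm x y j).
Proof.
move=> xy mxy; rewrite !barE mpermE -[in LHS](tpermK x y j).
by rewrite comp_rank_mperm_adj ?tpermK.
Qed.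

Lemma adjacent_transitive (r : rel 'I_N) :
  transitive r -> (forall x y, y = x.+1 :> nat -> r x y) -> forall x y, (x < y)%N -> r x y.
Proof.
move=> r_trans r_adj x y xy; have [d dE] : {d | (y - x = d.+1)%N} by exists (y - x).-1; lia.
elim: d y xy dE => [|d IH] y xy dE; first by apply: r_adj; lia.
have zN : (y.-1 < N)%N by have := ltn_ord y; lia.
apply: (r_trans (Ordinal zN)); last by apply: r_adj => /=; lia.
by apply: IH => /=; lia.
Qed.

Lemma sum_index_swap_ltn x y (f : 'I_N -> nat) : y = x.+1 :> nat -> (f x < f y)%N ->
  (\sum_(i < N) f (tperm x y i) * i < \sum_(i < N) f i * i)%N.
Proof.
move=> xy lt_f; have yNx : y != x by rewrite -val_eqE /=; lia.
rewrite (bigD1 x) //= (bigD1 y) //= [X in (_ < X)%N](bigD1 x) //= [X in (_ < _ + X)%N](bigD1 y) //=.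
rewrite tpermL tpermR !addnA (eq_bigr (fun i : 'I_N => f i * i)%N); last first.
  by move=> i /andP[ix iy]; rewrite tpermD // eq_sym.
by rewrite ltn_add2r xy; lia.
Qed.

(* Bubble sort: each allowed swap of an ascent of [f] lowers [\sum_i f i * i]. *)
Lemma adjacent_swap_ind (allowed : rel 'I_N) (f : 'X_{1..N} -> 'I_N -> nat)
    (P : 'X_{1..N} -> Prop) :
  (forall m x y i, y = x.+1 :> nat -> (f m x < f m y)%N ->
     f (mperm (tperm x y) m) i = f m (tperm x y i)) ->
  (forall m, (forall x y, y = x.+1 :> nat -> allowed x y -> (f m y <= f m x)%N) -> P m) ->
  (forall m x y, y = x.+1 :> nat -> allowed x y -> (f m x < f m y)%N ->
     P (mperm (tperm x y) m) -> P m) ->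
  forall m, P m.
Proof.
move=> f_perm P_sorted P_swap m.
have [w] := ubnP (\sum_(i < N) f m i * i)%N; elim: w m => // w IH m.
have [/existsP[x /existsP[y /and3P[/eqP xy al lt_f]]] mw|/existsPn sorted _] :=
  boolP [exists x : 'I_N, exists y : 'I_N, [&& y == x.+1 :> nat, allowed x y & (f m x < f m y)%N]].
  apply: (P_swap m x y xy al lt_f); apply: IH.
  rewrite (eq_bigr (fun i : 'I_N => f m (tperm x y i) * i)%N); last by move=> i _; rewrite f_perm.
  exact: leq_trans (sum_index_swap_ltn xy lt_f) (ltnSE mw).
apply: P_sorted => x y xy al; have /existsPn/(_ y) := sorted x.
by rewrite xy eqxx al /= -leqNgt.
Qed.

End ExponentPermutation.

Section EvaluationAtOnes.
Variables (R : comNzRingType) (N : nat).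
Implicit Types (p : {mpoly R[N]}).

Definition eval1 p : R := p.@[fun=> 1].

Lemma eval1E p : eval1 p = \sum_(m <- msupp p) p@_m.
Proof.
rewrite /eval1 mevalE; apply: eq_bigr => m _; rewrite big1 ?mulr1 // => i _.
by rewrite expr1n.
Qed.

Lemma eval1X m : eval1 'X_[m] = 1.
Proof. by rewrite /eval1 mevalX big1 // => i _; rewrite expr1n. Qed.

Lemma eval1_msym s p : eval1 (msym s p) = eval1 p.
Proof.
rewrite [p]mpolyE raddf_sum /= /eval1 !raddf_sum /=; apply: eq_bigr => m _.
by rewrite msymZ msymX !mevalZ -!/(eval1 _) !eval1X.
Qed.

End EvaluationAtOnes.

Definition generic_param (K : pzRingType) (a : K) : Prop :=
  forall x y n1 n2 : nat, a *+ x + n1%:R = a *+ y + n2%:R -> x = y /\ n1 = n2.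

Section GenericParameter.
Variables (K : fieldType) (a : K).
Hypothesis a_gen : generic_param a.

Lemma generic_natr_neq0 d : (0 < d)%N -> d%:R != 0 :> K.
Proof.
move=> d_gt0; apply/eqP => dE.
by have [] := @a_gen 0 0 d 0; rewrite ?mulr0n ?add0r //; lia.
Qed.

Lemma generic_linear_neq0 d n : (0 < d)%N -> a *+ d + n%:R != 0.
Proof.
move=> d_gt0; apply/eqP => linear_eq0.
by have [] := @a_gen d 0 n 0; rewrite ?mulr0n ?addr0 //; lia.
Qed.

Lemma generic_subr x y n1 n2 : a *+ x - n1%:R = a *+ y - n2%:R -> x = y /\ n1 = n2.
Proof.
move=> linear_eq; have [] := @a_gen x y n2 n1; last by move=> -> ->.
by rewrite -[a *+ x](subrK n1%:R) linear_eq; ring.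
Qed.

Section Composition.
Variable N : nat.
Implicit Types (m k h : 'X_{1..N}) (x y i j : 'I_N) (p : {mpoly K[N]}).

Lemma bar_eqP m i k j : bar a m i = bar a k j -> m i = k j /\ comp_rank m i = comp_rank k j.
Proof. by rewrite !barE => /generic_subr. Qed.

Lemma bar_inj m k : (forall j, bar a m j = bar a k j) -> m = k.
Proof. by move=> bar_eq; apply/mnmP => j; have [] := bar_eqP (bar_eq j). Qed.

Lemma joint_eigen_supp h p m : joint_eigen a (bar a h) p -> m \in msupp p ->
  comp_le m h /\ h \in msupp p.
Proof.
move=> p_eigen mp; have [k [kp mk kE]] := joint_eigen_bar p_eigen mp.
by have -> : h = k by apply: bar_inj.
Qed.

Lemma joint_eigen_eq0 h p : joint_eigen a (bar a h) p -> p@_h = 0 -> p = 0.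
Proof.
move=> p_eigen ph; apply/eqP; apply: contra_eqT ph => /mlead_supp/(joint_eigen_supp p_eigen)[_].
by rewrite mcoeff_msupp.
Qed.

Definition exchange_coef x y m : K := (bar a m y - bar a m x)^-1.

Lemma joint_eigen_adj (t : 'I_N -> K) x y p : y = x.+1 :> nat ->
  joint_eigen a t p -> t y != t x ->
  joint_eigen a (fun j => t (tperm x y j)) (msym (tperm x y) p + (t y - t x)^-1 *: p).
Proof.
move=> xy p_eigen tyx j; set s := tperm x y; set c := (_ - _)^-1.
have c_inv : c * (t y - t x) = 1 by rewrite mulVf // subr_eq0.
rewrite linearD linearZ /= p_eigen; have [->|jx] := eqVneq j x.
  rewrite (cherednik_msym_adj_l xy) p_eigen msymZ tpermL scalerDr -addrA; congr (_ + _).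
  rewrite !scalerA -[X in X + _]scale1r -scalerDl; congr (_ *: _).
  by rewrite -c_inv; ring.
have [->|jy] := eqVneq j y.
  rewrite (cherednik_msym_adj_r xy) p_eigen msymZ tpermR scalerDr -addrA; congr (_ + _).
  rewrite !scalerA -[X in X + _]scaleN1r -scalerDl; congr (_ *: _).
  by rewrite -c_inv; ring.
rewrite (cherednik_msym_adj_off xy) // p_eigen msymZ tpermD 1?eq_sym //.
by rewrite scalerDr !scalerA mulrC.
Qed.

(* The factors of the value at (1,...,1) of a non-symmetric Jack polynomial. *)
Definition spec_factor (D d : nat) : K :=
  \prod_(1 <= s < D.+1) ((a *+ s + d.+1%:R) / (a *+ s + d%:R)).

Definition pair_spec m i j : K :=
  spec_factor (m i - m j - (j < i)) (comp_rank m j - comp_rank m i).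

Definition principal_spec m : K :=
  \prod_(p : 'I_N * 'I_N | before m p.1 p.2) pair_spec m p.1 p.2.

Lemma pair_perm_inj (s : 'S_N) : injective (fun p : 'I_N * 'I_N => (s p.1, s p.2)).
Proof. by move=> [i j] [i' j'] /= [/perm_inj-> /perm_inj->]. Qed.

Lemma pair_spec_mperm_adj x y m : y = x.+1 :> nat -> (m x < m y)%N ->
  pair_spec (mperm (tperm x y) m) x y = (1 + exchange_coef x y m) * pair_spec m y x.
Proof.
move=> xy mxy; have mNxy : m x != m y by rewrite neq_ltn mxy.
have rank_yx : (comp_rank m y < comp_rank m x)%N by rewrite ltn_comp_rank /before mxy.
rewrite /pair_spec !mpermE tpermL tpermR xy ltnSn ltnNge leqnSn /=.
have := comp_rank_mperm_adj y xy mNxy; rewrite tpermR => ->.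
have := comp_rank_mperm_adj x xy mNxy; rewrite tpermL => ->.
have [D DE] : {D | (m y - m x = D.+1)%N} by exists (m y - m x).-1; lia.
rewrite DE subn0 subn1 /= /spec_factor big_nat_recr //= mulrC; congr (_ * _).
set d := (comp_rank m x - comp_rank m y)%N.
have -> : exchange_coef x y m = (a *+ D.+1 + d%:R)^-1.
  congr (_^-1); rewrite !barE -DE /d mulrnBr 1?ltnW // natrB 1?ltnW //; ring.
have nz : a *+ D.+1 + d%:R != 0 by apply: generic_linear_neq0.
by rewrite -natr1 addrA mulrDl divff // mul1r.
Qed.

Lemma principal_spec_mperm_adj x y m : y = x.+1 :> nat -> (m x < m y)%N ->
  principal_spec (mperm (tperm x y) m) = (1 + exchange_coef x y m) * principal_spec m.
Proof.
move=> xy mxy; set s := tperm x y; have mNxy : m x != m y by rewrite neq_ltn mxy.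
rewrite /principal_spec (reindex_inj (@pair_perm_inj s)) /=.
rewrite (eq_bigl (fun q => before m q.1 q.2)); last by move=> q; rewrite before_mperm_adj.
rewrite (bigD1 (y, x)) /=; last by rewrite /before mxy.
rewrite [X in _ = _ * X](bigD1 (y, x)) /=; last by rewrite /before mxy.
rewrite /s tpermL tpermR pair_spec_mperm_adj // mulrA; congr (_ * _).
apply: eq_bigr => [[i j]] /= /andP[bij ne].
rewrite /pair_spec !mpermE !tpermK !comp_rank_mperm_adj // ltn_tperm_adj //.
  by apply: contraNneq ne => -[-> ->].
by apply: contraTneq bij => -[-> ->]; rewrite /before; lia.
Qed.

End Composition.

Section RaisingOperator.
Variable n : nat.
Implicit Types (m : 'X_{1..n.+1}) (i j : 'I_n.+1) (p : {mpoly K[n.+1]}).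

Definition raise_mnm m : 'X_{1..n.+1} :=
  [multinom (m ((cycle_perm n)^-1 i)%g + (i == ord_max))%N | i < n.+1].

Lemma raise_mnmE m j : raise_mnm m (cycle_perm n j) = (m j + (j == ord0))%N.
Proof. by rewrite mnmE permK cycle_perm_eq_max. Qed.

Lemma before_raise_mnm m i j :
  before (raise_mnm m) (cycle_perm n i) (cycle_perm n j) = before m i j.
Proof.
rewrite /before !raise_mnmE -!val_eqE /= !cycle_permE.
by have := ltn_ord i; have := ltn_ord j; do !case: eqP => //=; lia.
Qed.

Lemma comp_rank_raise_mnm m j : comp_rank (raise_mnm m) (cycle_perm n j) = comp_rank m j.
Proof. by apply: comp_rank_transport => i l; apply: before_raise_mnm. Qed.

Lemma joint_eigen_raise m p : joint_eigen a (bar a m) p ->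
  joint_eigen a (bar a (raise_mnm m)) (raise p).
Proof.
move=> p_eigen j; rewrite -[j](permKV (cycle_perm n)); set i := ((cycle_perm n)^-1 j)%g.
have [->|i0] := eqVneq i ord0; last first.
  rewrite cherednik_raise // p_eigen /raise msymZ -scalerAr; congr (_ *: _).
  by rewrite !barE raise_mnmE comp_rank_raise_mnm (negPf i0) addn0.
rewrite cycle_perm0 cherednik_raise_max p_eigen -scalerDl /raise msymZ -scalerAr; congr (_ *: _).
rewrite -(cycle_perm0 n) !barE raise_mnmE comp_rank_raise_mnm eqxx mulrnDr /=; ring.
Qed.

Lemma principal_spec_raise_mnm m : principal_spec (raise_mnm m) = principal_spec m.
Proof.
rewrite /principal_spec (reindex_inj (@pair_perm_inj _ (cycle_perm n))) /=.
rewrite (eq_bigl (fun q => before m q.1 q.2)); last by move=> q; rewrite before_raise_mnm.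
apply: eq_bigr => [[i j]] /= bij; rewrite /pair_spec !comp_rank_raise_mnm.
congr (spec_factor _ _); move: bij; rewrite /before !raise_mnmE -!val_eqE /= !cycle_permE.
by have := ltn_ord i; have := ltn_ord j; do !case: eqP => //=; lia.
Qed.

Lemma mcoeff_raise m p : (raise p)@_(raise_mnm m) = p@_m.
Proof.
have -> : raise_mnm m = (U_(ord_max) + mperm (cycle_perm n)^-1 m)%MM.
  by apply/mnmP => i; rewrite mnmDE mnm1E mpermE mnmE addnC eq_sym.
by rewrite /raise mulrC mcoeffMX mcoeff_msym mperm_mul mulgV mperm_id.
Qed.

Lemma eval1_raise p : eval1 (raise p) = eval1 p.
Proof. by rewrite /raise /eval1 mevalM -!/(eval1 _) eval1X mul1r eval1_msym. Qed.

Lemma mdeg_raise_mnm m : mdeg (raise_mnm m) = (mdeg m).+1.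
Proof.
rewrite !mdegE (reindex_inj (@perm_inj _ (cycle_perm n))) /=.
rewrite (eq_bigr (fun j => m j + (j == ord0))%N); last by move=> j _; rewrite raise_mnmE.
rewrite big_split /= -[RHS]addn1; congr (_ + _)%N.
by rewrite (bigD1 ord0) //= big1 // => i /negPf->.
Qed.

Lemma raise_mnm_surj m : (0 < m ord_max)%N -> exists k, m = raise_mnm k.
Proof.
move=> m_max; exists [multinom (m (cycle_perm n i) - (i == ord0))%N | i < n.+1].
apply/mnmP => j; rewrite -[j](permKV (cycle_perm n)) raise_mnmE mnmE.
case: eqP => [->|_]; last by rewrite subn0 addn0.
by rewrite cycle_perm0 subnK.
Qed.

Definition evaluated_nsJack m p : Prop :=
  [/\ joint_eigen a (bar a m) p, p@_m = 1 & eval1 p = principal_spec m].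

Lemma evaluated_nsJack0 : evaluated_nsJack 0%MM 1.
Proof.
rewrite -mpolyX0; split; last 1 first.
- rewrite eval1X /principal_spec big1 // => [[i j]] _ /=.
  by rewrite /pair_spec !mnm0E /spec_factor big_geq.
- move=> j; apply/mpolyP => k; rewrite mcoeffZ mcoeffX.
  have [<-|k0] := eqVneq 0%MM k; first by rewrite mcoeff_cherednikX_diag mulr1.
  rewrite mulr0; apply/eqP; apply: contraNT k0 => /comp_le_cherednikX[k_deg _ _].
  by rewrite eq_sym -mdeg_eq0 k_deg mdeg0.
- by rewrite mcoeffX eqxx.
Qed.

Lemma evaluated_nsJack_raise m p :
  evaluated_nsJack m p -> evaluated_nsJack (raise_mnm m) (raise p).
Proof.
move=> [p_eigen p_lead p_eval]; split; [exact: joint_eigen_raise|by rewrite mcoeff_raise|].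
by rewrite eval1_raise principal_spec_raise_mnm.
Qed.

Lemma mperm_ascent_nle (x y : 'I_n.+1) m : y = x.+1 :> nat -> (m x < m y)%N ->
  ~ comp_le (mperm (tperm x y) m) m.
Proof.
move=> xy mxy [_ _ cnt_le].
have /cnt_le/(_ x.+1 (m y)) : excess (parts (mperm (tperm x y) m)) =1 excess (parts m).
  by move=> c; apply/perm_excess/perm_parts_mperm.
rewrite !prefix_countS mpermE tpermL leqnn (leqNgt (m y) (m x)) mxy addn0 addn1.
rewrite (_ : prefix_count (mperm _ _) x _ = prefix_count m x (m y)) ?ltnn //.
by apply: eq_bigr => i ix; rewrite mpermE tpermD // -val_eqE /=; lia.
Qed.

Lemma evaluated_nsJack_ascent m p (x y : 'I_n.+1) : y = x.+1 :> nat -> (m x < m y)%N ->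
  evaluated_nsJack m p ->
  evaluated_nsJack (mperm (tperm x y) m) (msym (tperm x y) p + exchange_coef x y m *: p).
Proof.
move=> xy mxy [p_eigen p_lead p_eval]; have mNxy : m x != m y by rewrite neq_ltn mxy.
have bar_neq : bar a m y != bar a m x.
  by apply/eqP => /bar_eqP[m_eq _]; rewrite m_eq eqxx in mNxy.
split.
- by move=> j; rewrite (joint_eigen_adj xy p_eigen bar_neq) bar_mperm_adj.
- rewrite mcoeffD mcoeffZ mcoeff_msym mperm_tpermK p_lead.
  rewrite (_ : p@_ _ = 0) ?mulr0 ?addr0 //; apply: memN_msupp_eq0; apply/negP => mp.
  by have [/(mperm_ascent_nle xy mxy)] := joint_eigen_supp p_eigen mp.
- rewrite /eval1 mevalD mevalZ -!/(eval1 _) eval1_msym p_eval.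
  by rewrite principal_spec_mperm_adj // mulrDl mul1r.
Qed.

(* Sort [m] increasingly by adjacent swaps, then strip off one box from its last
   part. *)
Lemma exists_evaluated_nsJack m : exists p, evaluated_nsJack m p.
Proof.
have [d] := ubnP (mdeg m); elim: d m => // d IHd; pose f m i := (mdeg m - m i)%N.
apply: (@adjacent_swap_ind _ (fun _ _ => true) f) =>
  [m x y i _ _|m sorted md|m x y xy _ lt_f IH md].
- by rewrite /f mpermE (mdeg_mperm m).
- have le_deg i : (m i <= mdeg m)%N by rewrite mdegE (bigD1 i) //= leq_addr.
  have [m_max|/raise_mnm_surj[k mE]] := posnP (m ord_max); last first.
    have [|p kp] := IHd k; first by move: md; rewrite mE mdeg_raise_mnm.
    by exists (raise p); rewrite mE; apply: evaluated_nsJack_raise.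
  suff -> : m = 0%MM by exists 1; apply: evaluated_nsJack0.
  apply/mnmP => i; rewrite mnm0E; apply/eqP; rewrite -leqn0 -m_max.
  have [->//|iNmax] := eqVneq i ord_max.
  apply: (@adjacent_transitive _ (fun i j => m i <= m j)%N) => [j k l|x y xy|].
  + exact: leq_trans.
  + by have := sorted x y xy isT; rewrite /f; have := le_deg x; have := le_deg y; lia.
  + by move: iNmax; have := ltn_ord i; rewrite -val_eqE /=; lia.
- have [p mp] : exists p, evaluated_nsJack (mperm (tperm x y) m) p.
    by apply: IH; rewrite (mdeg_mperm m).
  have lt_swap : (mperm (tperm x y) m x < mperm (tperm x y) m y)%N.
    by rewrite !mpermE tpermL tpermR; move: lt_f; rewrite /f; lia.
  by have := evaluated_nsJack_ascent xy lt_swap mp; rewrite mperm_tpermK; eexists; eassumption.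
Qed.

Lemma eval1_joint_eigen m p : joint_eigen a (bar a m) p -> eval1 p = p@_m * principal_spec m.
Proof.
move=> p_eigen; have [q [q_eigen q_lead q_eval]] := exists_evaluated_nsJack m.
have /eqP : p - p@_m *: q = 0.
  apply: (@joint_eigen_eq0 _ m); last by rewrite mcoeffB mcoeffZ q_lead mulr1 subrr.
  by apply: joint_eigenB => //; apply: joint_eigenZ.
by rewrite subr_eq0 => /eqP->; rewrite /eval1 mevalZ -/(eval1 q) q_eval mcoeffZ q_lead mulr1.
Qed.

End RaisingOperator.

Section ExchangeRelations.
Variable n : nat.
Local Notation N := n.+1.
Implicit Types (x y : 'I_N) (v : 'X_{1..N}) (p : {mpoly K[N]}).
Variable E : 'X_{1..N} -> {mpoly K[N]}.
Hypothesis E_eigen : forall v, joint_eigen a (bar a v) (E v).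
Hypothesis E_lead : forall v, (E v)@_v = 1.

Lemma joint_eigen_scale v p : joint_eigen a (bar a v) p -> p = p@_v *: E v.
Proof.
move=> p_eigen; apply/eqP; rewrite -subr_eq0; apply/eqP/(@joint_eigen_eq0 _ v).
  by apply: joint_eigenB => //; apply: joint_eigenZ.
by rewrite mcoeffB mcoeffZ E_lead mulr1 subrr.
Qed.

Lemma nsJack_ascent x y v : y = x.+1 :> nat -> (v x < v y)%N ->
  E (mperm (tperm x y) v) = msym (tperm x y) (E v) + exchange_coef x y v *: E v.
Proof.
move=> xy lt_v; have evE : evaluated_nsJack v (E v).
  by split => //; rewrite (eval1_joint_eigen (E_eigen v)) E_lead mul1r.
have [ej lead _] := evaluated_nsJack_ascent xy lt_v evE.
by rewrite [RHS](joint_eigen_scale ej) lead scale1r.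
Qed.

Lemma exchange_coef_mperm x y v : y = x.+1 :> nat -> v x != v y ->
  exchange_coef x y (mperm (tperm x y) v) = - exchange_coef x y v.
Proof.
move=> xy ne; rewrite /exchange_coef !bar_mperm_adj // tpermL tpermR.
by rewrite -[X in X^-1]opprB invrN.
Qed.

Lemma comp_rank_adj_tie x y v : y = x.+1 :> nat -> v x = v y ->
  comp_rank v y = (comp_rank v x).+1.
Proof.
move=> xy tie; rewrite /comp_rank.
have -> : [set i | before v i y] = x |: [set i | before v i x].
  apply/setP => i; rewrite !inE /before; have [->|ix] := eqVneq i x.
    by rewrite tie ltnn eqxx xy ltnSn.
  by move: ix; rewrite -val_eqE /=; lia.
by rewrite cardsU1 inE before_irr.
Qed.

Lemma exchange_coef_tie x y v : y = x.+1 :> nat -> v x = v y -> exchange_coef x y v = -1.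
Proof.
move=> xy tie; rewrite /exchange_coef !barE tie (comp_rank_adj_tie xy tie) -natr1.
have -> : a *+ v y - ((comp_rank v x)%:R + 1) - (a *+ v y - (comp_rank v x)%:R) = -1 by ring.
by rewrite invrN1.
Qed.

Lemma msym_nsJack_tie x y v : y = x.+1 :> nat -> v x = v y -> msym (tperm x y) (E v) = E v.
Proof.
move=> xy tie; have coefE := exchange_coef_tie xy tie.
have bar_neq : bar a v y != bar a v x.
  by rewrite -subr_eq0 -invr_eq0 -/(exchange_coef x y v) coefE oppr_eq0 oner_eq0.
have := joint_eigen_adj xy (E_eigen v) bar_neq.
rewrite -/(exchange_coef x y v) coefE scaleN1r => ej.
apply/eqP; rewrite -subr_eq0; apply: contraT => /mlead_supp/(joint_eigen_bar ej)[k [_ _ kE]].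
have kv : v = k.
  apply/mnmP => j; have [<- _] := bar_eqP (kE j).
  by case: tpermP => [->|->|].
have [_] := bar_eqP (kE x); rewrite -kv tpermL (comp_rank_adj_tie xy tie); lia.
Qed.

Definition msym_coef x y v : K := if (v x < v y)%N then 1 else 1 - exchange_coef x y v ^+ 2.

Lemma msym_nsJack_adj x y v : y = x.+1 :> nat -> msym (tperm x y) (E v) =
  msym_coef x y v *: E (mperm (tperm x y) v) - exchange_coef x y v *: E v.
Proof.
move=> xy; rewrite /msym_coef; have [lt|gt|tie] := ltngtP (v x) (v y).
- by rewrite scale1r nsJack_ascent // addrK.
- set w := mperm (tperm x y) v; have wlt : (w x < w y)%N by rewrite !mpermE tpermL tpermR.
  have := nsJack_ascent xy wlt; rewrite mperm_tpermK => Ev.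
  have coefE : exchange_coef x y w = - exchange_coef x y v.
    by rewrite exchange_coef_mperm // neq_ltn gt orbT.
  have Ew : msym (tperm x y) (E w) = E v + exchange_coef x y v *: E w.
    by rewrite Ev coefE scaleNr subrK.
  rewrite {1}Ev msymD msymZ msym_tpermK Ew coefE scaleNr scalerDr scalerA -expr2.
  by rewrite scalerBl scale1r opprD addrA addrAC.
rewrite msym_nsJack_tie // mperm_tperm_tie // exchange_coef_tie //.
by rewrite sqrrN expr1n subrr scale0r add0r scaleN1r opprK.
Qed.

End ExchangeRelations.

End GenericParameter.

(** * Symmetrization *)

Section Separation.
Variables (K : fieldType) (a : K) (N : nat).
Variables (V : {mpoly K[N]} -> Prop) (U : K -> Prop).
Hypotheses (V_add : forall p q, V p -> V q -> V (p + q))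
  (V_scale : forall c p, U c -> V p -> V (c *: p))
  (V_cherednik : forall j p, V p -> V (cherednik a j p))
  (U_opp : forall c, U c -> U (- c)).

(* Applying [xi_j - t_w] kills the component [f w]; induct on the components. *)
Lemma joint_eigen_separation (T : eqType) (O : seq T) (f : T -> {mpoly K[N]})
    (t : T -> 'I_N -> K) :
  uniq O -> (forall v, v \in O -> joint_eigen a (t v) (f v)) ->
  (forall v j, v \in O -> U (t v j)) ->
  (forall v w, v \in O -> w \in O -> v != w ->
     exists j, t v j != t w j /\ U (t v j - t w j)^-1) ->
  V (\sum_(v <- O) f v) -> forall v, v \in O -> V (f v).
Proof.
have [n] := ubnP (size O); elim: n O f => // n IH O f On uO f_eigen Ut sep Vsum v vO.
have [/hasP[w wO wv]|/hasPn others] := boolP (has (predC1 v) O); last first.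
  suff OE : O = [:: v] by move: Vsum; rewrite OE big_seq1.
  apply: perm_small_eq => //; apply: uniq_perm => // x; rewrite inE.
  by apply/idP/eqP => [/others/negPn/eqP|->].
have [|j [t_neq Uinv]] := sep v w vO wO; first by rewrite eq_sym.
pose u x := (t v j - t w j)^-1 * (t x j - t w j).
have -> : f v = u v *: f v by rewrite /u mulVf ?scale1r // subr_eq0.
apply: (IH (rem w O) (fun x => u x *: f x)).
- by rewrite size_rem //; case: O On wO {uO f_eigen Ut sep Vsum vO} => //= x O; rewrite ltnS.
- exact: rem_uniq.
- by move=> x /mem_rem xO; apply: joint_eigenZ; apply: f_eigen.
- by move=> x i /mem_rem xO; apply: Ut.
- by move=> x y /mem_rem xO /mem_rem yO; apply: sep.
- have -> : \sum_(x <- rem w O) u x *: f x =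
    (t v j - t w j)^-1 *: (cherednik a j (\sum_(x <- O) f x) + (- t w j) *: \sum_(x <- O) f x).
    rewrite linear_sum scaler_sumr -big_split scaler_sumr /=.
    rewrite [RHS](perm_big _ (perm_to_rem wO)) big_cons /= f_eigen // -scalerDl subrr scale0r.
    rewrite scaler0 add0r big_seq [RHS]big_seq; apply: eq_bigr => x /mem_rem xO.
    by rewrite f_eigen // -scalerDl scalerA.
  by apply: V_scale => //; apply: V_add; [apply: V_cherednik | apply/V_scale/Vsum/U_opp/Ut].
- by rewrite mem_rem_uniq // inE vO andbT eq_sym.
Qed.

End Separation.

Section PermutationInduction.

Lemma perm_on_tperm (T : finType) (K : {set T}) x y : x \in K -> y \in K -> perm_on K (tperm x y).
Proof.
by move=> xK yK; apply: subset_trans (tperm_on x y) _; apply/subsetP => z /set2P[]->.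
Qed.

Lemma perm_on_tperm_ind (T : finType) (K : {set T}) (P : {perm T} -> Prop) :
  P 1%g -> (forall s t, P s -> P t -> P (s * t)%g) ->
  (forall x y, x \in K -> y \in K -> P (tperm x y)) -> forall s, perm_on K s -> P s.
Proof.
move=> P1 PM Ptperm s; have [n] := ubnP #|[set x | s x != x]|.
elim: n s => // n IH s sn sK; have [->//|s1] := eqVneq s 1%g.
have [x sx] : exists x, s x != x.
  apply/existsP; apply: contraNT s1 => /existsPn fixed; apply/eqP/permP => x.
  by rewrite perm1; apply/eqP; rewrite -[_ == _]negbK.
have xK : x \in K by apply: (subsetP sK); rewrite inE.
have sxK : s x \in K by rewrite perm_closed.
rewrite -[s]mul1g -(tperm2 x (s x)) -mulgA; apply: PM; first exact: Ptperm.
apply: IH; last by apply: perm_onM => //; apply: perm_on_tperm.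
apply: leq_trans _ (ltnSE sn); apply: proper_card; apply/properP; split.
  by apply/subsetP => y; rewrite !inE permM; case: tpermP => [->|->|//]; rewrite ?eqxx.
by exists (s x); rewrite !inE ?(inj_eq perm_inj) // permM tpermR eqxx.
Qed.

Definition ord_itv (N lo hi : nat) : {set 'I_N} := [set i : 'I_N | (lo <= i < hi)%N].

Lemma perm_on_adj_ind (N lo hi : nat) (P : 'S_N -> Prop) :
  P 1%g -> (forall s t, P s -> P t -> P (s * t)%g) ->
  (forall x y : 'I_N, y = x.+1 :> nat -> (lo <= x)%N -> (y < hi)%N -> P (tperm x y)) ->
  forall s, perm_on (ord_itv N lo hi) s -> P s.
Proof.
move=> P1 PM Padj; apply: perm_on_tperm_ind => // x y; rewrite !inE => /andP[lx xh] /andP[ly yh].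
wlog xy : x y lx xh ly yh / (x < y)%N => [wlog_lt|].
  have [lt|lt|/val_inj->] := ltngtP x y; [exact: wlog_lt | | by rewrite tperm1].
  by rewrite tpermC; apply: wlog_lt.
have [d dE] : {d | (y - x = d.+1)%N} by exists (y - x).-1; lia.
elim: d y xy ly yh dE => [|d IH] y xy ly yh dE; first by apply: Padj => //; lia.
have zN : (y.-1 < N)%N by have := ltn_ord y; lia.
pose z := Ordinal zN.
have -> : tperm x y = (tperm z y * tperm x z * tperm z y)%g.
  rewrite -mulgA -{1}(tpermV z y) -conjgE tpermJ tpermL.
  by rewrite tpermD // -val_eqE /=; lia.
have Pzy : P (tperm z y) by apply: Padj => //=; lia.
by apply: (PM) => //; apply: PM => //; apply: IH => /=; lia.
Qed.

End PermutationInduction.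

Definition antisymI (T : symtype) : bool := match T with AS | AA => true | _ => false end.
Definition antisymJ (T : symtype) : bool := match T with AA | SA => true | _ => false end.

Definition antisym_at (N M : nat) (T : symtype) (x : 'I_N) : bool :=
  if (x < M)%N then antisymI T else antisymJ T.

Section BlockSymmetrizer.
Variables (R : idomainType) (N : nat).
Implicit Types (p q : {mpoly R[N]}) (s u : 'S_N) (K : {set 'I_N}) (b : bool).

Definition block_sign b s : R := (-1) ^+ (b && odd_perm s).

Lemma block_signM b s u : block_sign b (s * u)%g = block_sign b s * block_sign b u.
Proof. by rewrite /block_sign; case: b; rewrite /= ?mulr1 // odd_permM signr_addb. Qed.

Lemma block_sign_neq0 b s : block_sign b s != 0. Proof. by rewrite signr_eq0. Qed.

Definition block_sym b K p : {mpoly R[N]} :=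
  \sum_(s | perm_on K s) block_sign b s *: msym s p.

Lemma symmetrizerE M T p :
  symmetrizer M T p = block_sym (antisymI T) (setI_ N M) (block_sym (antisymJ T) (setJ_ N M) p).
Proof.
have symE K q : Sym_on K q = block_sym false K q.
  by apply: eq_bigr => s _; rewrite scale1r.
by case: T; rewrite /symmetrizer ?symE.
Qed.

Lemma mcoeff_block_sym b K p m :
  (block_sym b K p)@_m = \sum_(s | perm_on K s) block_sign b s * p@_(mperm s m).
Proof. by rewrite raddf_sum /=; apply: eq_bigr => s _; rewrite mcoeffZ mcoeff_msym. Qed.

Lemma block_symZ b K c p : block_sym b K (c *: p) = c *: block_sym b K p.
Proof.
by rewrite scaler_sumr; apply: eq_bigr => s _; rewrite msymZ !scalerA mulrC.
Qed.

Lemma msym_block_sym b K u p : perm_on K u ->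
  msym u (block_sym b K p) = block_sign b u *: block_sym b K p.
Proof.
move=> uK; rewrite raddf_sum /= scaler_sumr [RHS](reindex_inj (mulIg u)) /=.
apply: eq_big => [s|s _]; last first.
  by rewrite msymZ msymMm scalerA block_signM mulrCA -expr2 sqrr_sign mulr1.
apply/idP/idP => sK; first exact: perm_onM.
by rewrite -[s](mulgK u); apply: perm_onM => //; apply: perm_onV.
Qed.

Lemma msym_block_sym_disjoint b K K' u p : perm_on K' u -> [disjoint K & K'] ->
  msym u (block_sym b K p) = block_sym b K (msym u p).
Proof.
move=> uK' KK'; rewrite raddf_sum /=; apply: eq_bigr => s sK.
by rewrite msymZ -!msymMm (perm_onC sK uK' KK').
Qed.

Lemma disjoint_setIJ M : [disjoint (setI_ N M) & (setJ_ N M)].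
Proof. by rewrite disjoint_subset; apply/subsetP => i; rewrite !inE; lia. Qed.

Lemma mem_setJ M i : (i \in setJ_ N M) = (i \notin setI_ N M).
Proof. by rewrite !inE -leqNgt. Qed.

Lemma setI_ord_itv M : setI_ N M = ord_itv N 0 M.
Proof. by apply/setP => i; rewrite !inE. Qed.

Lemma setJ_ord_itv M : setJ_ N M = ord_itv N M N.
Proof. by apply/setP => i; rewrite !inE ltn_ord andbT. Qed.

Definition block_adjacent M (x y : 'I_N) : bool :=
  (y == x.+1 :> nat) && ((x < M)%N == (y < M)%N).

Lemma block_adjacentP M x y : block_adjacent M x y ->
  [/\ y = x.+1 :> nat, x != y & (y < M)%N = (x < M)%N].
Proof. by move=> /andP[/eqP xy /eqP ->]; split=> //; rewrite -val_eqE /=; lia. Qed.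

Definition block_symmetric M T p : Prop := forall x y, block_adjacent M x y ->
  msym (tperm x y) p = (-1) ^+ antisym_at M T x *: p.

Lemma block_symmetricD M T p q :
  block_symmetric M T p -> block_symmetric M T q -> block_symmetric M T (p + q).
Proof. by move=> sym_p sym_q x y adj; rewrite msymD sym_p // sym_q // scalerDr. Qed.

Lemma block_symmetricZ M T c p : block_symmetric M T p -> block_symmetric M T (c *: p).
Proof. by move=> sym_p x y adj; rewrite msymZ sym_p // !scalerA mulrC. Qed.

Lemma mcoeff_block_symmetric M T p x y m : block_symmetric M T p -> block_adjacent M x y ->
  p@_(mperm (tperm x y) m) = (-1) ^+ antisym_at M T x * p@_m.
Proof. by move=> sym_p adj; rewrite -mcoeff_msym sym_p // mcoeffZ. Qed.

Lemma block_symmetric_symmetrizer M T p : block_symmetric M T (symmetrizer M T p).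
Proof.
move=> x y /block_adjacentP[_ xNy blk].
have signE b : block_sign b (tperm x y) = (-1) ^+ b by rewrite /block_sign odd_tperm xNy andbT.
rewrite symmetrizerE /antisym_at; have [xM|xM] := ltnP x M.
  by rewrite msym_block_sym ?signE //; apply: perm_on_tperm; rewrite inE ?blk.
have sJ : perm_on (setJ_ N M) (tperm x y).
  by apply: perm_on_tperm; rewrite inE // leqNgt blk -leqNgt.
by rewrite (msym_block_sym_disjoint _ _ sJ) ?disjoint_setIJ // msym_block_sym // block_symZ signE.
Qed.

End BlockSymmetrizer.

Section BlockOrbit.
Variables (N M : nat).
Implicit Types (m k e L : 'X_{1..N}) (s : 'S_N) (x y i j : 'I_N).

Definition preserves_blocks s : bool := [forall i : 'I_N, (s i < M)%N == (i < M)%N].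

Lemma preserves_blocksP s :
  reflect (forall i : 'I_N, (s i < M)%N = (i < M)%N) (preserves_blocks s).
Proof. exact: 'forall_eqP. Qed.

Lemma preserves_blocksM s t :
  preserves_blocks s -> preserves_blocks t -> preserves_blocks (s * t)%g.
Proof.
move=> /preserves_blocksP bs /preserves_blocksP bt.
by apply/preserves_blocksP => i; rewrite permM bt bs.
Qed.

Lemma preserves_blocks_adj x y : block_adjacent M x y -> preserves_blocks (tperm x y).
Proof.
by case/block_adjacentP=> _ _ blk; apply/preserves_blocksP => i; case: tpermP => [->|->|].
Qed.

Lemma preserves_blocks_onI s : perm_on (setI_ N M) s -> preserves_blocks s.
Proof. by move=> sI; apply/preserves_blocksP => i; have := perm_closed i sI; rewrite !inE. Qed.

Lemma preserves_blocks_onJ s : perm_on (setJ_ N M) s -> preserves_blocks s.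
Proof.
move=> sJ; apply/preserves_blocksP => i.
by have := perm_closed i sJ; rewrite !inE !ltnNge => ->.
Qed.

Definition block_orbit L : seq 'X_{1..N} :=
  undup [seq mperm s L | s <- enum 'S_N & preserves_blocks s].

Lemma block_orbitP L m :
  reflect (exists2 s, preserves_blocks s & m = mperm s L) (m \in block_orbit L).
Proof.
rewrite mem_undup; apply: (iffP mapP) => [[s]|[s bs ->]].
  by rewrite mem_filter => /andP[bs _] ->; exists s.
by exists s => //; rewrite mem_filter bs /= mem_enum.
Qed.

Lemma block_orbit_uniq L : uniq (block_orbit L). Proof. exact: undup_uniq. Qed.

Lemma mem_block_orbit L s : preserves_blocks s -> mperm s L \in block_orbit L.
Proof. by move=> bs; apply/block_orbitP; exists s. Qed.

Lemma block_orbit_refl L : L \in block_orbit L.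
Proof. by rewrite -{1}[L]mperm_id; apply/mem_block_orbit/preserves_blocksP => i; rewrite perm1. Qed.

Lemma block_orbit_mperm L m s :
  preserves_blocks s -> m \in block_orbit L -> mperm s m \in block_orbit L.
Proof.
by move=> bs /block_orbitP[u bu ->]; rewrite mperm_mul mem_block_orbit ?preserves_blocksM.
Qed.

Lemma block_orbit_adj L m x y :
  block_adjacent M x y -> m \in block_orbit L -> mperm (tperm x y) m \in block_orbit L.
Proof. by move=> /preserves_blocks_adj; apply: block_orbit_mperm. Qed.

Lemma perm_block_orbit_adj L x y : block_adjacent M x y ->
  perm_eq (map (mperm (tperm x y)) (block_orbit L)) (block_orbit L).
Proof.
move=> adj; apply: uniq_perm; rewrite ?block_orbit_uniq //.
  by rewrite map_inj_uniq ?block_orbit_uniq //; apply: can_inj (@mperm_tpermK _ x y).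
move=> m; apply/mapP/idP => [[k kO ->]|mO]; first exact: block_orbit_adj.
by exists (mperm (tperm x y) m); rewrite ?mperm_tpermK ?block_orbit_adj.
Qed.

Lemma block_orbit_sp_star L m : m \in block_orbit L -> sp_star m = sp_star L.
Proof. by case/block_orbitP => s _ ->; apply: sp_star_mperm. Qed.

Lemma block_orbit_sp_circ L m : m \in block_orbit L -> sp_circ M m = sp_circ M L.
Proof.
case/block_orbitP => s /preserves_blocksP bs ->.
apply/eq_decr_rearrP/excess_perm => [|c]; first by rewrite !size_map.
rewrite /excess 2!big_map 2!big_enum /= [RHS](reindex_inj (@perm_inj _ s)).
by apply: eq_bigr => i _; rewrite mpermE bs.
Qed.

Lemma block_orbit_mdeg L m : m \in block_orbit L -> mdeg m = mdeg L.
Proof. by case/block_orbitP => s _ ->; apply: mdeg_mperm. Qed.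

Definition block_count (b : bool) m p v : nat :=
  (\sum_(i < N | (i < p)%N && ((i < M)%N == b)) (v <= m i))%N.

Lemma prefix_count_blocks m p v :
  prefix_count m p v = (block_count true m p v + block_count false m p v)%N.
Proof.
rewrite /prefix_count (bigID (fun i : 'I_N => (i < M)%N)) /=.
by congr (_ + _)%N; apply: eq_bigl => i; case: (i < M)%N.
Qed.

Lemma block_count_suffix b m p v : (block_count b m N v =
  block_count b m p v + \sum_(i < N | (p <= i)%N && ((i < M)%N == b)) (v <= m i))%N.
Proof.
rewrite /block_count (bigID (fun i : 'I_N => (i < p)%N)) /=.
by congr (_ + _)%N; apply: eq_bigl => i; rewrite ltn_ord /= -?leqNgt andbC.
Qed.

Lemma block_orbit_count L m b v :
  m \in block_orbit L -> block_count b m N v = block_count b L N v.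
Proof.
case/block_orbitP => s /preserves_blocksP bs ->.
rewrite /block_count [RHS](reindex_inj (@perm_inj _ s)) /=.
by apply: eq_big => [i|i _]; rewrite ?mpermE // !ltn_ord bs.
Qed.

Lemma leq_sum_upset (I : finType) (A B f g : pred I) :
  (forall i j : I, A i -> B j -> f j -> f i) ->
  (\sum_(i | A i) g i + \sum_(i | B i) g i = \sum_(i | A i) f i + \sum_(i | B i) f i)%N ->
  (\sum_(i | A i) g i <= \sum_(i | A i) f i)%N.
Proof.
move=> upset; have [/existsP[j /andP[Bj fj]] _|/existsPn fB] := boolP [exists j, B j && f j].
  by apply: leq_sum => i Ai; rewrite (upset i j) // leq_b1.
rewrite [X in _ = (_ + X)%N -> _]big1 => [|i Bi]; first by lia.
by have := fB i; rewrite Bi /= => /negPf->.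
Qed.

Lemma superpartition_noninc m i j : superpartition M m ->
  (i < M)%N = (j < M)%N -> (i < j)%N -> (m j <= m i)%N.
Proof.
move=> /andP[/forall_inP mI /forall_inP mJ] blk ij; have [iM|iM] := ltnP i M.
  have [iI jI] : i \in setI_ N M /\ j \in setI_ N M by rewrite !inE -blk iM.
  by have /forall_inP/(_ j jI) := mI i iI; rewrite ij.
have [iJ jJ] : i \in setJ_ N M /\ j \in setJ_ N M by rewrite !mem_setJ !inE -blk ltnNge iM.
by have /forall_inP/(_ j jJ) := mJ i iJ; rewrite ij.
Qed.

Lemma block_adjacent_transitive (e : rel 'I_N) (b : bool) : transitive e ->
  (forall x y, block_adjacent M x y -> (x < M)%N = b -> e x y) ->
  forall x y, (x < M)%N = b -> (y < M)%N = b -> (x < y)%N -> e x y.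
Proof.
move=> e_trans e_adj; pose r x y := (x < y)%N && (((x < M)%N == b) && ((y < M)%N == b) ==> e x y).
suff r_lt x y : (x < y)%N -> r x y.
  by move=> x y xb yb /r_lt/andP[_ /implyP]; apply; rewrite xb yb eqxx.
apply: adjacent_transitive => {x y} [y x z /andP[xy /implyP exy] /andP[yz /implyP eyz]|x y xy].
  rewrite /r (ltn_trans xy yz); apply/implyP => /andP[/eqP xb /eqP zb].
  have yb : (y < M)%N = b by rewrite -xb; apply/idP/idP; lia.
  by apply: (e_trans y); [apply: exy | apply: eyz]; rewrite ?xb ?yb ?zb eqxx.
rewrite /r xy ltnSn; apply/implyP => /andP[/eqP xb /eqP yb].
by apply: e_adj; rewrite // /block_adjacent xy xb yb !eqxx.
Qed.

Lemma superpartition_adj m :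
  (forall x y, block_adjacent M x y -> (m y <= m x)%N) -> superpartition M m.
Proof.
move=> m_adj; have m_lt b x y : (x < M)%N = b -> (y < M)%N = b -> (x < y)%N -> (m y <= m x)%N.
  apply: (block_adjacent_transitive (e := fun x y => m y <= m x)%N) =>
    [v u w le_vu le_wv|u v adj _].
    exact: leq_trans le_vu.
  exact: m_adj.
apply/andP; split; apply/forall_inP => i iK; apply/forall_inP => j jK; apply/implyP.
  by apply: (m_lt true); [move: iK | move: jK]; rewrite inE.
by apply: (m_lt false); [move: iK | move: jK]; rewrite inE leqNgt => /negPf.
Qed.

Lemma superpartition_count_max L m p v : superpartition M L ->
  (forall b, block_count b m N v = block_count b L N v) ->
  (prefix_count m p v <= prefix_count L p v)%N.
Proof.
move=> sL countE; rewrite !prefix_count_blocks.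
have le_block b : (block_count b m p v <= block_count b L p v)%N.
  apply: (@leq_sum_upset _ _ (fun i : 'I_N => (p <= i)%N && ((i < M)%N == b))
            (fun i => (v <= L i)%N) (fun i => (v <= m i)%N)); last first.
    by rewrite -!/(block_count b _ p v) -!block_count_suffix.
  move=> i j /andP[ip /eqP iM] /andP[pj /eqP jM] vj; apply: leq_trans vj _.
  by apply: (superpartition_noninc sL); [rewrite iM jM | apply: leq_trans pj].
exact: leq_add.
Qed.

Definition blockwise_increasing m : Prop :=
  forall i j, (i < M)%N = (j < M)%N -> (i < j)%N -> (m i <= m j)%N.

Lemma increasing_count_min e m p v : blockwise_increasing e ->
  (forall b, block_count b m N v = block_count b e N v) ->
  (prefix_count e p v <= prefix_count m p v)%N.
Proof.
move=> inc countE; rewrite !prefix_count_blocks.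
have le_block b : (block_count b e p v <= block_count b m p v)%N.
  have countE_p := countE b; rewrite !(block_count_suffix b _ p) in countE_p.
  rewrite -(leq_add2r (\sum_(i < N | (p <= i)%N && ((i < M)%N == b)) (v <= m i))) countE_p.
  rewrite leq_add2l; apply: (@leq_sum_upset _ _ (fun i : 'I_N => (i < p)%N && ((i < M)%N == b))
      (fun i => (v <= e i)%N) (fun i => (v <= m i)%N)); last by rewrite addnC countE_p addnC.
  move=> i j /andP[pi /eqP iM] /andP[jp /eqP jM] vj; apply: leq_trans vj _.
  by apply: inc; [rewrite iM jM | apply: leq_trans pi].
exact: leq_add.
Qed.

Lemma superpartition_eq L G : superpartition M L -> superpartition M G ->
  sp_star L = sp_star G -> sp_circ M L = sp_circ M G -> G = L.
Proof.
move=> sL sG star_eq circ_eq.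
have countI v : block_count true L N v = block_count true G N v.
  have countI_prefix m : block_count true m N v = prefix_count m M v.
    by apply: eq_bigl => i; rewrite ltn_ord eqb_id.
  move/eq_decr_rearrP/(@perm_excess _ _ v): circ_eq; rewrite !excess_circ -!countI_prefix.
  by rewrite (proj2 (sp_star_excess L G) star_eq) => /addnI.
have countE b v : block_count b L N v = block_count b G N v.
  case: b => //; have : prefix_count L N v = prefix_count G N v.
    have countE m : prefix_count m N v = (\sum_(x <- parts m) (v <= x))%N.
      by rewrite /prefix_count big_map big_enum; apply: eq_bigl => i; rewrite ltn_ord.
    by rewrite !countE; apply/perm_big/eq_decr_rearrP.
  by rewrite !prefix_count_blocks countI => /addnI.
apply/prefix_count_inj => p v; apply/eqP.
by rewrite eqn_leq !superpartition_count_max.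
Qed.

Lemma block_orbit_superpartition L m : superpartition M L -> superpartition M m ->
  m \in block_orbit L -> m = L.
Proof.
move=> sL sm mO; apply: superpartition_eq => //.
  by rewrite (block_orbit_sp_star mO).
by rewrite (block_orbit_sp_circ mO).
Qed.

Lemma superpartition_comp_le L m :
  superpartition M L -> m \in block_orbit L -> comp_le L m -> m = L.
Proof.
move=> sL mO [_ _ /(_ _) cnt_le]; apply: prefix_count_inj => p v; apply/eqP.
rewrite eqn_leq cnt_le ?andbT; last by apply/sp_star_excess; rewrite (block_orbit_sp_star mO).
by apply: superpartition_count_max => // b; apply: block_orbit_count.
Qed.

Lemma increasing_comp_le L m e : blockwise_increasing e ->
  e \in block_orbit L -> m \in block_orbit L -> comp_le m e -> m = e.
Proof.
move=> inc eO mO [_ _ cnt_le]; apply: prefix_count_inj => p v; apply/eqP.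
rewrite eqn_leq cnt_le /=; last first.
  by apply/sp_star_excess; rewrite (block_orbit_sp_star mO) (block_orbit_sp_star eO).
apply: increasing_count_min => // b.
by rewrite (block_orbit_count _ _ eO) (block_orbit_count _ _ mO).
Qed.

End BlockOrbit.

Section OrbitSpan.
Variables (K : fieldType) (a : K) (n : nat).
Hypothesis a_gen : generic_param a.
Local Notation N := n.+1.
Implicit Types (v w e : 'X_{1..N}) (x y : 'I_N) (p f g : {mpoly K[N]}) (q r : 'X_{1..N} -> K).
Variable E : 'X_{1..N} -> {mpoly K[N]}.
Hypothesis E_eigen : forall v, joint_eigen a (bar a v) (E v).
Hypothesis E_lead : forall v, (E v)@_v = 1.
Variables (M : nat) (L : 'X_{1..N}).
Local Notation O := (block_orbit M L).

Definition orbit_span f : Prop := exists q, f = \sum_(v <- O) q v *: E v.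

Lemma orbit_span_nsJack e : e \in O -> orbit_span (E e).
Proof.
move=> eO; exists (fun v => (v == e)%:R).
rewrite (bigD1_seq e) ?block_orbit_uniq //= eqxx scale1r big1 ?addr0 // => v /negPf->.
by rewrite scale0r.
Qed.

Lemma orbit_spanZ c f : orbit_span f -> orbit_span (c *: f).
Proof.
move=> [q ->]; exists (fun v => c * q v).
by rewrite scaler_sumr; apply: eq_bigr => v _; rewrite scalerA.
Qed.

Lemma orbit_span_sum (I : finType) (P : pred I) F :
  (forall i, P i -> orbit_span (F i)) -> orbit_span (\sum_(i | P i) F i).
Proof.
move=> spanF; elim/big_ind: _ => // [|f g [q ->] [r ->]].
  by exists (fun=> 0); rewrite big1 // => v _; rewrite scale0r.
exists (fun v => q v + r v).
by rewrite -big_split /=; apply: eq_bigr => v _; rewrite scalerDl.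
Qed.

Lemma msym_orbit_sum x y q : block_adjacent M x y ->
  msym (tperm x y) (\sum_(v <- O) q v *: E v) =
  \sum_(v <- O) (q (mperm (tperm x y) v) * msym_coef a x y (mperm (tperm x y) v)
                 - exchange_coef a x y v * q v) *: E v.
Proof.
move=> adj; have [xy _ _] := block_adjacentP adj.
rewrite (raddf_sum (msym (tperm x y))) /=.
under eq_bigr => v _ do rewrite msymZ (msym_nsJack_adj a_gen E_eigen E_lead) // scalerBr !scalerA.
rewrite sumrB; under [RHS]eq_bigr => v _ do rewrite scalerBl.
rewrite sumrB; congr (_ - _); last by apply: eq_bigr => v _; rewrite mulrC.
rewrite -(perm_big _ (perm_block_orbit_adj L adj)) big_map /=.
by apply: eq_bigr => v _; rewrite mperm_tpermK.
Qed.

Lemma orbit_span_block_sym b lo hi f : (hi <= M)%N || (M <= lo)%N ->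
  orbit_span f -> orbit_span (block_sym b (ord_itv N lo hi) f).
Proof.
move=> blk spanf; apply: orbit_span_sum => s sS; apply: orbit_spanZ; move: s sS f spanf.
apply: perm_on_adj_ind => [f|s t IHs IHt f /IHs/IHt|x y xy lox yhi f [q ->]].
- by rewrite msym1m.
- by rewrite msymMm.
by rewrite msym_orbit_sum; [eexists | rewrite /block_adjacent xy eqxx /=; lia].
Qed.

Lemma orbit_span_symmetrizer T f : orbit_span f -> orbit_span (symmetrizer M T f).
Proof.
move=> spanf; rewrite symmetrizerE setI_ord_itv setJ_ord_itv.
by do 2![apply: orbit_span_block_sym; rewrite ?leqnn ?orbT //].
Qed.

Lemma orbit_sum_inj q r :
  \sum_(v <- O) q v *: E v = \sum_(v <- O) r v *: E v -> {in O, q =1 r}.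
Proof.
move=> sum_eq v vO; apply/eqP; rewrite -subr_eq0; apply/eqP.
suff /(congr1 (mcoeff v)) : (q v - r v) *: E v = 0 by rewrite mcoeffZ E_lead mulr1 mcoeff0.
apply: (@joint_eigen_separation K a N (fun p => p = 0) (fun=> True) _ _ _ _ _ O
  (fun w => (q w - r w) *: E w) (bar a)) => //.
- by move=> p0 q0 -> ->; rewrite addr0.
- by move=> c p0 _ ->; rewrite scaler0.
- by move=> j p0 ->; rewrite linear0.
- exact: block_orbit_uniq.
- by move=> w _; apply: joint_eigenZ.
- move=> w w' _ _ ww'.
  have /existsP[j jE] : [exists j, bar a w j != bar a w' j]; last by exists j.
  apply: contraNT ww' => /existsPn bar_eq; apply/eqP/(bar_inj a_gen) => j.
  exact/eqP/negPn/bar_eq.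
- by under eq_bigr => w _ do rewrite scalerBl; rewrite sumrB sum_eq subrr.
Qed.

Lemma orbit_sum_recursion q eps x y v :
  msym (tperm x y) (\sum_(v <- O) q v *: E v) = eps *: \sum_(v <- O) q v *: E v ->
  block_adjacent M x y -> v \in O -> (v x < v y)%N ->
  q v = (eps - exchange_coef a x y v) * q (mperm (tperm x y) v).
Proof.
move=> sym adj vO lt_v; have [xy _ _] := block_adjacentP adj.
move: sym; rewrite msym_orbit_sum // scaler_sumr.
under [RHS]eq_bigr => w _ do rewrite scalerA.
move/orbit_sum_inj/(_ _ (block_orbit_adj adj vO)); rewrite mperm_tpermK.
rewrite exchange_coef_mperm ?neq_ltn ?lt_v // /msym_coef lt_v mulr1 => coef_eq.
by rewrite mulrBl -coef_eq; ring.
Qed.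

Lemma mcoeff_orbit_sum q : superpartition M L -> (\sum_(v <- O) q v *: E v)@_L = q L.
Proof.
move=> sL; rewrite raddf_sum /= (bigD1_seq L) ?block_orbit_uniq ?block_orbit_refl //=.
rewrite mcoeffZ E_lead mulr1 big_seq_cond big1 ?addr0 // => v /andP[vO vL].
rewrite mcoeffZ (_ : (E v)@_L = 0) ?mulr0 //; apply: memN_msupp_eq0.
apply: contraNN vL => /(joint_eigen_supp a_gen (E_eigen v))[Lv _].
exact/eqP/(superpartition_comp_le sL vO Lv).
Qed.

Lemma joint_eigen_polyC v :
  joint_eigen a%:P (bar a%:P v) (map_mpoly polyC (E v)).
Proof.
have bar_polyC j : (bar a v j)%:P = bar a%:P v j by rewrite !barE rmorphB rmorphMn rmorph_nat.
by move=> j; rewrite -map_cherednik /= E_eigen map_mpolyZ /= bar_polyC.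
Qed.

Lemma orbit_span_sekiguchi_eigen f : orbit_span f -> sekiguchi_eigen a M L f.
Proof.
move=> [q ->]; rewrite /sekiguchi_eigen /=.
have -> : map_mpoly polyC (\sum_(v <- O) q v *: E v) =
   \sum_(v <- O) (q v)%:P *: map_mpoly polyC (E v).
  by rewrite (raddf_sum (map_mpoly polyC)) /=; apply: eq_bigr => v _; rewrite map_mpolyZ.
have eigen v := joint_eigenZ (q v)%:P (joint_eigen_polyC v).
rewrite sekiguchi_starE sekiguchi_circE !linear_sum /=.
split; rewrite big_seq [RHS]big_seq; apply: eq_bigr => v vO.
  by rewrite -(block_orbit_sp_star vO) (sekiguchi_joint_eigen _ (eigen v)) -eps_sp_star.
by rewrite -(block_orbit_sp_circ vO) (sekiguchi_joint_eigen _ (eigen v)) -eps_sp_circ.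
Qed.

End OrbitSpan.

Section SymmetrizerLeadingCoefficient.
Variables (K : fieldType) (a : K) (N M : nat).
Hypothesis a_gen : generic_param a.
Implicit Types (L e : 'X_{1..N}) (s t : 'S_N).
Local Notation I := (setI_ N M).
Local Notation J := (setJ_ N M).

Lemma block_sign_inj (b : bool) (S : {set 'I_N}) L s t : perm_on S s -> perm_on S t ->
  (b -> {in S &, injective L}) -> {in S, forall i, L (s i) = L (t i)} ->
  block_sign K b s = block_sign K b t.
Proof.
rewrite /block_sign; case: b => //= sS tS /(_ isT) injL L_st; congr ((-1) ^+ odd_perm _).
apply/permP => i; have [iS|iS] := boolP (i \in S).
  by apply: injL; rewrite ?perm_closed // L_st.
by rewrite (out_perm sS) // (out_perm tS).
Qed.

Lemma mperm_blocks_eq L s t s' t' : perm_on I s -> perm_on J t -> perm_on I s' -> perm_on J t' ->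
  mperm t (mperm s L) = mperm t' (mperm s' L) ->
  {in I, forall i, L (s i) = L (s' i)} /\ {in J, forall i, L (t i) = L (t' i)}.
Proof.
move=> sI tJ s'I t'J mperm_eq; have Ei i : L (s (t i)) = L (s' (t' i)) by rewrite -!mpermE mperm_eq.
split=> i iK; have := Ei i.
  have iJ : i \notin J by rewrite mem_setJ negbK.
  by rewrite (out_perm tJ) // (out_perm t'J).
have tI u : perm_on J u -> u i \notin I by move=> uJ; rewrite -mem_setJ perm_closed.
by rewrite (out_perm sI) ?tI // (out_perm s'I) ?tI.
Qed.

(* [x^e] occurs in no [E_e] but in those terms of the symmetrization that map
   it to [x^L], all of which have the same sign. *)
Lemma mcoeff_symmetrizer_neq0 T L e (E : {mpoly K[N]}) s0 t0 :
  joint_eigen a (bar a e) E -> E@_e = 1 -> blockwise_increasing M e ->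
  perm_on I s0 -> perm_on J t0 -> e = mperm t0 (mperm s0 L) ->
  (antisymI T -> {in I &, injective L}) -> (antisymJ T -> {in J &, injective L}) ->
  (symmetrizer M T E)@_L != 0.
Proof.
move=> E_eigen E_lead inc s0I t0J eE injI injJ.
have orbit s t : perm_on I s -> perm_on J t -> mperm t (mperm s L) \in block_orbit M L.
  move=> sI tJ; apply: block_orbit_mperm (preserves_blocks_onJ tJ) _.
  exact/mem_block_orbit/preserves_blocks_onI.
pose c := block_sign K (antisymI T) s0 * block_sign K (antisymJ T) t0.
have termE s t : perm_on I s -> perm_on J t ->
    block_sign K (antisymI T) s * (block_sign K (antisymJ T) t * E@_(mperm t (mperm s L)))
    = c * (mperm t (mperm s L) == e)%:R.
  move=> sI tJ; have [st_eq|st_neq] := eqVneq (mperm t (mperm s L)) e.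
    have [L_s L_t] := mperm_blocks_eq sI tJ s0I t0J (etrans st_eq eE).
    rewrite st_eq E_lead !mulr1 /c (block_sign_inj sI s0I injI L_s).
    by rewrite (block_sign_inj tJ t0J injJ L_t).
  rewrite (_ : E@_ _ = 0) ?mulr0 //; apply: memN_msupp_eq0.
  apply: contraNN st_neq => /(joint_eigen_supp a_gen E_eigen)[le_e _]; apply/eqP.
  by apply: (increasing_comp_le inc) le_e; rewrite ?eE; apply: orbit.
rewrite symmetrizerE mcoeff_block_sym.
under eq_bigr => s sI.
  rewrite mcoeff_block_sym mulr_sumr; under eq_bigr => t tJ do rewrite (termE s t sI tJ).
  rewrite -mulr_sumr -natr_sum; over.
rewrite -mulr_sumr -natr_sum !mulf_neq0 ?block_sign_neq0 //.
by apply: (generic_natr_neq0 a_gen); rewrite (bigD1 s0) //= (bigD1 t0) //= -eE eqxx.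
Qed.

End SymmetrizerLeadingCoefficient.

(** * Restriction to a window of variables *)

Section Boundary.
Variable N : nat.
Implicit Types (m k v : 'X_{1..N}) (i j l : 'I_N) (B c : nat).

Definition separated v B c : Prop :=
  [/\ (B <= N)%N, forall i, (i < B)%N -> (c <= v i)%N & forall i, (B <= i)%N -> (v i <= c)%N].

Lemma card_ord_ltn B : (B <= N)%N -> #|[set i : 'I_N | (i < B)%N]| = B.
Proof.
move=> BN; rewrite -sum1_card (eq_bigl (fun i : 'I_N => (i < B)%N)); last by move=> i; rewrite inE.
by rewrite -(big_ord_widen _ (fun=> 1%N)) // sum_nat_const card_ord muln1.
Qed.

Lemma sum_le_separated m v B c (S : {set 'I_N}) : comp_le m v -> separated v B c -> #|S| = B ->
  (\sum_(i in S) m i <= \sum_(i < N | (i < B)%N) v i)%N.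
Proof.
move=> [_ ex_mv _] [BN v_hi v_lo] cardS.
have -> : (\sum_(i < N | (i < B)%N) v i = excess (parts v) c + B * c)%N.
  rewrite excess_parts [X in _ = (X + _)%N](bigID (fun i : 'I_N => (i < B)%N)) /=.
  rewrite [X in (_ + X + _)%N]big1 ?addn0; last by move=> i; rewrite -leqNgt => /v_lo; lia.
  have -> : (B * c = \sum_(i < N | (i < B)%N) c)%N.
    by rewrite -(big_ord_widen _ (fun=> c)) // sum_nat_const card_ord.
  by rewrite -big_split; apply: eq_bigr => i /v_hi; rewrite /=; lia.
apply: leq_trans (_ : \sum_(i in S) ((m i - c) + c) <= _)%N.
  by apply: leq_sum => i _; lia.
rewrite big_split sum_nat_const cardS leq_add2r; apply: leq_trans (ex_mv c).
by rewrite excess_parts [X in (_ <= X)%N](bigID (mem S)) leq_addr.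
Qed.

(* Otherwise [m], or [m] with its parts [i] and [j] swapped, would exceed [v] in
   dominance order. *)
Lemma exchanged_boundary m k v B c i j : comp_le m v -> separated v B c ->
  (i < B)%N -> (B <= j)%N -> exchanged i j m k ->
  (\sum_(l < N | (l < B)%N) k l = \sum_(l < N | (l < B)%N) v l)%N ->
  (m i <= k i)%N && (m j <= k i)%N.
Proof.
move=> mv sep iB Bj ex kv; have [BN _ _] := sep.
have ij : i != j by rewrite ltn_ord_neq // (leq_trans iB).
have := sum_exchanged id (fun l : 'I_N => (l < B)%N) ij ex.
rewrite iB ltnNge Bj !mul1n !mul0n !addn0 kv => sum_mk.
pose S := [set l : 'I_N | (l < B)%N].
have le_S : (\sum_(l in S) m l <= \sum_(l < N | (l < B)%N) v l)%N.
  exact: sum_le_separated mv sep (card_ord_ltn BN).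
have le_swap : (\sum_(l in j |: S :\ i) m l <= \sum_(l < N | (l < B)%N) v l)%N.
  apply: sum_le_separated mv sep _; rewrite cardsU1 !inE ltnNge Bj andbF /=.
  by have := cardsD1 i S; rewrite card_ord_ltn // inE iB.
have sumSE : (\sum_(l in S) m l = \sum_(l < N | (l < B)%N) m l)%N.
  by apply: eq_bigl => l; rewrite inE.
have sumSD : (\sum_(l in S) m l = m i + \sum_(l in S :\ i) m l)%N.
  by rewrite (big_setD1 i) // inE.
have sumSU : (\sum_(l in j |: S :\ i) m l = m j + \sum_(l in S :\ i) m l)%N.
  by rewrite big_setU1 //= !inE ltnNge Bj andbF.
by lia.
Qed.

End Boundary.

Section Window.
Variables (N A w : nat).
Hypothesis AwN : (A + w <= N)%N.
Implicit Types (m : 'X_{1..N}) (b : 'X_{1..w}) (i l : 'I_N) (g h j : 'I_w).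

Lemma emb_subproof j : (A + j < N)%N.
Proof. by have := ltn_ord j; lia. Qed.

Definition emb j : 'I_N := Ordinal (emb_subproof j).
Definition in_window i : bool := (A <= i < A + w)%N.

Lemma emb_inj : injective emb.
Proof. by move=> i j /(congr1 val) /= /addnI; apply: val_inj. Qed.

Lemma in_windowP i : reflect (exists j, i = emb j) (in_window i).
Proof.
apply: (iffP idP) => [iw|[j ->]]; last by rewrite /in_window /=; have := ltn_ord j; lia.
have jw : (i - A < w)%N by move: iw; rewrite /in_window; lia.
by exists (Ordinal jw); apply/val_inj => /=; move: iw; rewrite /in_window; lia.
Qed.

Lemma in_window_emb j : in_window (emb j).
Proof. by apply/in_windowP; exists j. Qed.

Lemma big_window (T : Type) (idx : T) (op : Monoid.com_law idx) (P : pred 'I_N) F :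
  (forall i, P i -> ~~ in_window i -> F i = idx) ->
  \big[op/idx]_(i < N | P i) F i = \big[op/idx]_(j < w | P (emb j)) F (emb j).
Proof.
move=> F_out; rewrite (bigID in_window) /= [X in op _ X]big1 ?Monoid.mulm1 => [|i /andP[]];
  last exact: F_out.
have insub_emb j : insub (emb j - A)%N = Some j by rewrite /= addKn valK.
rewrite (reindex_omap emb (fun i => insub (i - A)%N)); last first.
  by move=> i /andP[_ /in_windowP[j ->]]; rewrite insub_emb.
by apply: eq_bigl => j; rewrite insub_emb eqxx in_window_emb !andbT.
Qed.

Variable v : 'X_{1..N}.

Definition glue b : 'X_{1..N} :=
  [multinom (if in_window i then oapp b (v i) (insub (i - A)%N) else v i) | i < N].
Definition window m : 'X_{1..w} := [multinom m (emb j) | j < w].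

Lemma glue_emb b j : glue b (emb j) = b j.
Proof. by rewrite mnmE in_window_emb /= addKn valK. Qed.

Lemma glue_out b i : ~~ in_window i -> glue b i = v i.
Proof. by move=> /negPf iw; rewrite mnmE iw. Qed.

Lemma windowE m j : window m j = m (emb j). Proof. by rewrite mnmE. Qed.

Lemma glueK b : window (glue b) = b.
Proof. by apply/mnmP => j; rewrite windowE glue_emb. Qed.

Lemma eq_glue_window m : (forall i, ~~ in_window i -> m i = v i) -> m = glue (window m).
Proof.
move=> m_out; apply/mnmP => i; have [/in_windowP[j ->]|iw] := boolP (in_window i).
  by rewrite glue_emb windowE.
by rewrite glue_out // m_out.
Qed.

Lemma glue_eq m b : (m == glue b) = (m == glue (window m)) && (window m == b).
Proof. by apply/eqP/andP => [->|[/eqP mE /eqP <-]] //; rewrite glueK !eqxx. Qed.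

Lemma mdeg_glue b : mdeg (glue b) = (mdeg b + \sum_(i < N | ~~ in_window i) v i)%N.
Proof.
rewrite mdegE (bigID in_window) /=; congr (_ + _)%N; last first.
  by apply: eq_bigr => i iw; rewrite glue_out.
rewrite big_window => [|i ->] //; rewrite mdegE; apply: eq_big => [j|j _].
  by rewrite in_window_emb.
by rewrite glue_emb.
Qed.

Lemma sum_prefix_glue b B : (B <= A)%N || (A + w <= B)%N -> mdeg (glue b) = mdeg v ->
  (\sum_(l < N | (l < B)%N) glue b l = \sum_(l < N | (l < B)%N) v l)%N.
Proof.
have outside i : ~~ in_window i -> glue b i = v i by apply: glue_out.
case/orP => [BA _|AB]; first by apply: eq_bigr => l lB; rewrite outside // /in_window; lia.
rewrite !mdegE (bigID (fun l : 'I_N => (l < B)%N)) /=.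
rewrite [X in _ = X -> _](bigID (fun l : 'I_N => (l < B)%N)) /=.
rewrite [X in (_ + X)%N = _](eq_bigr (fun l => v l)); last first.
  by move=> l lB; rewrite outside // /in_window; lia.
by move/addIn.
Qed.

Lemma exchanged_emb h j m b : h != j -> exchanged (emb h) (emb j) m (glue b) =
  (m == glue (window m)) && exchanged h j (window m) b.
Proof.
move=> ij; apply/idP/andP => [ex|[/eqP mE /andP[/eqP bE sumE]]].
  have off l : l != emb h -> l != emb j -> glue b l = m l by apply: exchanged_off ex.
  split.
    apply/eqP/eq_glue_window => l lw; rewrite -off ?glue_out //.
      by apply: contraNneq lw => ->; apply: in_window_emb.
    by apply: contraNneq lw => ->; apply: in_window_emb.
  apply/andP; split; last by rewrite !windowE -!glue_emb (exchanged_sum ex).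
  apply/eqP/mnmP => g; rewrite set_pairE windowE.
  case: eqP => [->//|/eqP gh]; case: eqP => [->//|/eqP gj].
  by rewrite -off ?glue_emb // (inj_eq emb_inj).
apply/andP; split; last by rewrite mE !glue_emb.
apply/eqP/mnmP => l; rewrite set_pairE.
case: eqP => [->//|/eqP lh]; case: eqP => [->//|/eqP lj].
have [/in_windowP[g lE]|lw] := boolP (in_window l); last by rewrite mE !glue_out.
rewrite lE glue_emb bE set_pairE windowE.
by move: lh lj; rewrite lE !(inj_eq emb_inj) => /negPf-> /negPf->.
Qed.

Lemma low_coef_emb h j m b : h != j -> low_coef (emb h) (emb j) m (glue b) =
  (m == glue (window m))%:R * low_coef h j (window m) b.
Proof.
move=> ij; rewrite /low_coef exchanged_emb // !windowE !glue_emb.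
by case: (m == _); rewrite ?mul1r ?mul0r.
Qed.

Lemma high_coef_emb h j m b : h != j -> high_coef (emb h) (emb j) m (glue b) =
  (m == glue (window m))%:R * high_coef h j (window m) b.
Proof.
move=> ij; rewrite /high_coef exchanged_emb // !windowE !glue_emb.
by case: (m == _); rewrite ?mul1r ?mul0r.
Qed.

Variables ctop cbot : nat.
Hypotheses (v_top : separated v A ctop) (v_bot : separated v (A + w) cbot).

Section NoInteraction.
Variables (m : 'X_{1..N}) (b : 'X_{1..w}).
Hypotheses (mv : comp_le m v) (deg_b : mdeg (glue b) = mdeg v).

Lemma low_coef_outside i j : ~~ in_window i -> (i < emb j)%N ->
  low_coef i (emb j) m (glue b) = 0.
Proof.
rewrite /low_coef => iw ij; case ex: (exchanged _ _ _ _) => //=.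
have iA : (i < A)%N by have := ltn_ord j; move: iw ij; rewrite /in_window /=; lia.
have Aj : (A <= emb j)%N := leq_addr _ _.
have := exchanged_boundary mv v_top iA Aj ex.
rewrite sum_prefix_glue ?leqnn // => /(_ erefl) /andP[le_i le_j].
by have := exchanged_sum ex; lia.
Qed.

Lemma high_coef_outside i j : ~~ in_window i -> (emb j < i)%N ->
  high_coef i (emb j) m (glue b) = 0.
Proof.
rewrite /high_coef => iw ij; case ex: (exchanged _ _ _ _) => //=.
have Bi : (A + w <= i)%N by have := ltn_ord j; move: iw ij; rewrite /in_window /=; lia.
have jB : (emb j < A + w)%N by rewrite /= ltn_add2l.
rewrite exchangedC ?gtn_ord_neq // in ex.
have := exchanged_boundary mv v_bot jB Bi ex.
by rewrite sum_prefix_glue ?leqnn ?orbT // => /(_ erefl) /andP[le_j le_i]; lia.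
Qed.

Lemma cherednik_int_emb j : cherednik_int (emb j) m (glue b) =
  (m == glue (window m))%:R * (cherednik_int j (window m) b - (A * (window m == b))%N%:Z).
Proof.
rewrite /cherednik_int glue_eq [(m == _) in RHS]lock.
rewrite big_window /= => [|i ij iw]; last exact: low_coef_outside.
rewrite [X in _ + X - _]big_window /= => [|i ij iw]; last exact: high_coef_outside.
rewrite (eq_bigl (fun i : 'I_w => (i < j)%N)); last by move=> i; rewrite /= ltn_add2l.
rewrite [X in _ + X - _](eq_bigl (fun i : 'I_w => (j < i)%N)); last first.
  by move=> i; rewrite /= ltn_add2l.
under eq_bigr => i ij do rewrite low_coef_emb ?ltn_ord_neq //.
under [X in _ + X - _]eq_bigr => i ij do rewrite high_coef_emb ?gtn_ord_neq //.
rewrite -!mulr_sumr -lock; move: (\sum_(i < w | _) _) (\sum_(i < w | _) _) => S T.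
by case: (m == _); case: (_ == b); rewrite /= ?mul1r ?mul0r; lia.
Qed.

End NoInteraction.

Lemma mcoeff_cherednikX_emb (R : idomainType) (a : R) j m b : comp_le m v ->
  (cherednik a (emb j) 'X_[m])@_(glue b) = (m == glue (window m))%:R *
    ((cherednik a j 'X_[window m])@_b - (window m == b)%:R * A%:R).
Proof.
move=> mv; have [deg_b|deg_b] := eqVneq (mdeg (glue b)) (mdeg v).
  rewrite !mcoeff_cherednikX cherednik_int_emb // glue_eq windowE.
  case: (m == _); rewrite /= ?mul0r ?mul1r ?mul0n ?addr0 //.
  by rewrite intrB addrA -pmulrn natrM [A%:R * _]mulrC.
have -> : (cherednik a (emb j) 'X_[m])@_(glue b) = 0.
  apply/eqP; apply: contraNT deg_b => /comp_le_cherednikX[-> _ _].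
  by case: mv => ->.
case: eqP => [mE|_]; last by rewrite mul0r.
have deg_window : mdeg b != mdeg (window m).
  by apply: contraNneq deg_b => deg_eq; case: mv => <- _ _; rewrite {1}mE !mdeg_glue deg_eq.
have -> : (cherednik a j 'X_[window m])@_b = 0.
  by apply/eqP; apply: contraNT deg_window => /comp_le_cherednikX[-> _ _].
rewrite (_ : window m == b = false) ?mul0r ?subr0 ?mulr0 //.
by apply: contraNF deg_window => /eqP->.
Qed.

Section Extract.
Variable R : idomainType.
Implicit Types (a : R) (f : {mpoly R[N]}).

(* The coefficient of [x^v] off the window, as a polynomial in its variables. *)
Definition extract f : {mpoly R[w]} :=
  \sum_(m <- msupp f) (f@_m * (m == glue (window m))%:R) *: 'X_[window m].

Lemma mcoeff_extract f b : (extract f)@_b = f@_(glue b).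
Proof.
rewrite /extract raddf_sum /=.
under eq_bigr => m _ do rewrite mcoeffZ mcoeffX -mulrA -natrM mulnb -glue_eq.
have [fb|fb] := boolP (glue b \in msupp f); last first.
  rewrite (memN_msupp_eq0 fb) big_seq big1 // => m mf.
  by case: eqP => [mE|_]; rewrite ?mulr0 // -mE mf in fb *.
rewrite (bigD1_seq (glue b)) ?msupp_uniq //= eqxx mulr1 big1 ?addr0 // => m /negPf->.
by rewrite mulr0.
Qed.

Lemma joint_eigen_extract a t f : joint_eigen a t f -> (forall m, m \in msupp f -> comp_le m v) ->
  joint_eigen a (fun j => t (emb j) + A%:R) (extract f).
Proof.
move=> f_eigen f_supp j; apply/mpolyP => b.
rewrite mcoeffZ mcoeff_extract mulrDl -mcoeffZ -f_eigen.
rewrite (mcoeff_cherednik a (emb j) (glue b) (msupp_uniq f)) // -mcoeff_extract.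
rewrite /extract linear_sum !raddf_sum /= mulr_sumr -big_split big_seq [RHS]big_seq.
apply: eq_bigr => m mf; rewrite linearZ /= !mcoeffZ mcoeffX.
rewrite (mcoeff_cherednikX_emb _ _ _ (f_supp m mf)).
by move: (_ %:R) (_ %:R) (_ %:R) => *; ring.
Qed.

End Extract.

End Window.

(** * Eigenvalue collisions *)

Section PermutationCrossing.
Local Open Scope nat_scope.
Variable N : nat.
Implicit Types (s S : 'S_N) (i j : 'I_N).

Lemma perm_leq_eq s S : (forall i, S i <= s i) -> S =1 s.
Proof.
move=> S_le; have [_] := leqif_sum (fun i (_ : xpredT i) => leqif_eq (S_le i)).
have sum_perm (t : 'S_N) : \sum_(i < N) t i = \sum_(i < N) i :> nat.
  by rewrite [RHS](reindex_inj (@perm_inj _ t)).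
by rewrite !sum_perm eqxx => /esym/forallP S_eq i; apply/val_inj/eqP/S_eq.
Qed.

Lemma perm_descent s : s != 1%g -> exists i, s i < i.
Proof.
move=> s1; apply/existsP; apply: contraNT s1 => /existsPn s_ge.
apply/eqP/permP => i; rewrite -(@perm_leq_eq s 1%g) // => j.
by rewrite perm1 leqNgt s_ge.
Qed.

Lemma perm_excedance_gap s : s != 1%g -> exists c d : 'I_N,
  [/\ c < d, c < s c, s d < d & forall i, c < i < d -> s i = i].
Proof.
move=> /perm_descent[b sb].
have [d sd d_min] := @arg_minnP _ b (fun i => s i < i) val sb.
have below i : i < d -> i <= s i.
  by move=> lt_id; rewrite leqNgt; apply: contraL lt_id => /d_min; rewrite -leqNgt.
have [c0 /andP[c0d c0s]] : exists c : 'I_N, (c < d) && (c < s c).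
  apply/existsP; apply: contraTT sd => /existsPn no_excedance; rewrite -leqNgt.
  have [//|lt_sd] := leqP d (s d).
  have fixed : s (s d) = s d.
    apply/val_inj/eqP; rewrite eq_sym eqn_leq below //= leqNgt.
    by have := no_excedance (s d); rewrite lt_sd.
  by rewrite (perm_inj fixed) ltnn in lt_sd.
have c0P : (fun i => (i < d) && (i < s i)) c0 by rewrite c0d.
have [c /andP[cd cs] c_max] := @arg_maxnP _ c0 (fun i => (i < d) && (i < s i)) val c0P.
exists c, d; split=> // i /andP[ci lt_id]; apply/val_inj/eqP; rewrite eq_sym eqn_leq below //=.
by rewrite leqNgt; apply: contraL ci => si; rewrite -leqNgt; apply: c_max; rewrite lt_id.
Qed.

Lemma eqn_mod_ltn d x y : x < y -> x = y %[mod d] -> exists q, y = x + d * q.+1.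
Proof.
move=> xy /esym/eqP; rewrite eqn_mod_dvd 1?ltnW // => /dvdnP[q qE].
case: q qE => [|q] qE; first by lia.
by exists q; rewrite mulnC -qE subnKC // ltnW.
Qed.

(* [i1] follows the last position of the gap of [perm_excedance_gap] and [i2]
   is the first one. *)
Lemma perm_crossing (P : 'I_N -> Prop) k s :
  (forall i, s i = i %[mod k.+1]) ->
  (forall i j, i = j.+1 :> nat -> s j < s i \/ s j = s i + k :> nat /\ P i) ->
  s != 1%g ->
  exists i1 i2, [/\ P i1, P i2, i1 = (s i1 + k).+1 :> nat, s i2 = i2
    & (s i1 < i2 <= s i1 + k) && (i2 + k < N)].
Proof.
move=> s_mod s_step /perm_excedance_gap[c [d [cd cs sd fixed]]].
have [u du] : exists u : 'I_N, d = u.+1 :> nat.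
  by exists (Ordinal (leq_ltn_trans (leq_pred d) (ltn_ord d))) => /=; lia.
have su_ge : u <= s u.
  have [cu|uc] := ltnP c u; first by rewrite fixed // du cu ltnSn.
  by rewrite (_ : u = c) 1?ltnW //; apply: ord_inj; lia.
have [|[suE Pd]] := s_step d u du; first by lia.
have [q dE] := eqn_mod_ltn sd (s_mod d).
have kq : k.+1 <= k.+1 * q.+1 by rewrite leq_pmulr.
have suE' : s u = u by apply: ord_inj; lia.
have sdE : d = (s d + k).+1 :> nat by rewrite suE' in suE; lia.
have cu : c < u.
  have : c != u by apply: contraTneq cs => ->; rewrite suE' ltnn.
  by rewrite -val_eqE /=; lia.
have wN : c.+1 < N by have := ltn_ord u; lia.
pose w := Ordinal wN; have sw : s w = w by apply: fixed; rewrite /= ltnSn; lia.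
have [|[scE Pw]] := s_step w c erefl; first by rewrite sw /=; lia.
exists d, w; split=> //; apply/andP; split; last by rewrite -sw -scE ltn_ord.
apply/andP; split; last by rewrite /=; lia.
rewrite ltnNge; apply/negP => wsd.
have : s (s d) = s d by apply: fixed; rewrite sd andbT.
by move/perm_inj => fixed_eq; rewrite fixed_eq ltnn in sd.
Qed.

End PermutationCrossing.

Section Contents.
Local Open Scope nat_scope.
Variables (N k p : nat).
Hypothesis cop : coprime k.+1 p.
Implicit Types (f g F G : nat -> nat) (s S : 'S_N).

(* At [alpha = -(k+1)/p], the eigenvalue of row [x] is [- content f x / p]. *)
Definition content f x := k.+1 * f x + p * x.

Definition has_gap d c f := forall x, x + d < N -> f (x + d) + c <= f x.

Lemma has_gap_iter d c f x q : has_gap d c f -> x + d * q < N -> f (x + d * q) + c * q <= f x.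
Proof.
move=> gap_f; elim: q => [|q IH] xN; first by rewrite !muln0 !addn0.
have /IH : x + d * q < N by rewrite mulnSr in xN; lia.
by have := gap_f (x + d * q); rewrite -addnA -mulnSr => /(_ xN); rewrite (mulnS c); lia.
Qed.

Lemma content_mod f g x y z : content f x = content g y + k.+1 * z -> x = y %[mod k.+1].
Proof.
rewrite /content => content_eq; apply/eqP.
have : p * x == p * y %[mod k.+1].
  apply/eqP; rewrite -(modnMDl (f x)) -[RHS](modnMDl (g y + z)) !(mulnC _ k.+1) content_eq.
  by congr (_ %% _); lia.
have [xy|/ltnW xy] := leqP x y.
  rewrite eq_sym eqn_mod_dvd ?leq_mul2l ?xy ?orbT // -mulnBr Gauss_dvdr //.
  by rewrite -eqn_mod_dvd // eq_sym.
by rewrite !eqn_mod_dvd ?leq_mul2l ?xy ?orbT // -mulnBr Gauss_dvdr.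
Qed.

Lemma eq_content_mod f g x y : content f x = content g y -> x = y %[mod k.+1].
Proof. by move=> content_eq; apply: (@content_mod f g _ _ 0); rewrite content_eq muln0 addn0. Qed.

Lemma content_gap f x q : has_gap k.+1 p.+1 f -> x + k.+1 * q < N ->
  content f (x + k.+1 * q) + k.+1 * q <= content f x.
Proof.
move=> gap_f xN; have := has_gap_iter gap_f xN; rewrite /content.
by rewrite -(leq_pmul2l (ltn0Sn k)); lia.
Qed.

Lemma content_inj f x y : has_gap k.+1 p.+1 f -> x < N -> y < N ->
  content f x = content f y -> x = y.
Proof.
move=> gap_f; wlog xy : x y / x <= y.
  by move=> wlog_le xN yN content_eq; have [/wlog_le->|/ltnW/wlog_le->] := leqP x y.
move=> xN yN content_eq; apply/eqP; rewrite eqn_leq xy leqNgt; apply/negP => lt_xy.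
have [q qE] := eqn_mod_ltn lt_xy (eq_content_mod content_eq).
have := @content_gap f x q.+1 gap_f; rewrite -qE => /(_ yN); rewrite content_eq.
by rewrite mulSn; lia.
Qed.

Lemma content_adjacent f x y : has_gap k.+1 p.+1 f -> {homo f : u v / u <= v >-> v <= u} ->
  y < x < N -> content f x = content f y + p -> f x = f y.
Proof.
move=> gap_f f_noninc /andP[yx xN] content_eq.
have succE : content (fun=> f y) y.+1 = content f x by rewrite content_eq /content; lia.
have [|lt_yx|xE] := ltngtP x y.+1; first by lia.
  have [q qE] := eqn_mod_ltn lt_yx (eq_content_mod succE).
  have yN : y + k.+1 * q.+1 < N by lia.
  have := has_gap_iter gap_f yN; have : f x <= f (y + k.+1 * q.+1) by apply: f_noninc; lia.
  move: content_eq; rewrite /content qE; set u := f _; set t := f (y + _) => content_eq u_le t_le.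
  have : k.+1 * (u + p.+1 * q.+1) <= k.+1 * f y by rewrite leq_pmul2l //; lia.
  by move: content_eq; rewrite !mulnDr !(mulSn p) mulnDr; nia.
move: content_eq; rewrite /content xE => content_eq.
by apply/eqP; rewrite -(eqn_pmul2l (ltn0Sn k)); apply/eqP; lia.
Qed.

Lemma content_tight f x y z : has_gap k.+1 p.+1 f -> has_gap k p f -> y < x < N ->
  content f x + p = content f y + k.+1 * z -> [/\ x = y + k, f y = f x + p & z = 0].
Proof.
move=> gap_f gap_k /andP[yx xN] content_eq.
have succE : content (fun=> f x) x.+1 = content f y + k.+1 * z by rewrite -content_eq /content; lia.
have [|q qE] := @eqn_mod_ltn k.+1 y x.+1 _ (esym (content_mod succE)); first by lia.
have xE : x = y + k + k.+1 * q by rewrite mulnSr in qE; lia.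
have := @has_gap_iter k.+1 p.+1 f (y + k) q gap_f; rewrite -xE => /(_ xN) le_yk.
have le_y : f (y + k) + p <= f y by apply: gap_k; lia.
have sumE : f x + p * q.+1 = f y + z.
  apply/eqP; rewrite -(eqn_pmul2l (ltn0Sn k)) !mulnDr; apply/eqP.
  by move: succE; rewrite /content qE mulnDr (mulnCA p); lia.
have q0 : q = 0 by move: le_yk sumE; rewrite mulnS mulSn; lia.
by move: xE sumE le_yk; rewrite q0 muln0 muln1 => *; split; lia.
Qed.

Lemma content_interlace f F x : f x <= F x <= (f x).+1 ->
  F x = f x /\ content F x = content f x \/
  F x = (f x).+1 /\ content F x = content f x + k.+1.
Proof.
rewrite /content => fF; have [->|->] : F x = f x \/ F x = (f x).+1 by lia.
  by left.
by right; split=> //; lia.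
Qed.

Section Interlacing.
Variables (f F g G : nat -> nat) (s S : 'S_N).
Hypotheses (gap_f : has_gap k.+1 p.+1 f) (gap_F : has_gap k.+1 p.+1 F).
Hypotheses (fF : forall x, x < N -> f x <= F x <= (f x).+1)
  (gG : forall x, x < N -> g x <= G x <= (g x).+1).
Hypotheses (gs : forall i : 'I_N, content g i = content f (s i))
  (GS : forall i : 'I_N, content G i = content F (S i)).

(* Within a residue class modulo k+1 the contents are separated by k+1, and
   passing from lower to upper case shifts them by at most that. *)
Lemma interlacing_shift (i : 'I_N) :
  [\/ S i = s i, F (s i) = (f (s i)).+1 /\ S i = s i + k.+1 :> nat
    | F (S i) = f (S i) /\ s i = S i + k.+1 :> nat].
Proof.
have cg := content_interlace (gG (ltn_ord i)); rewrite GS gs in cg.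
have S_mod : S i = s i %[mod k.+1].
  case: cg => -[_ content_eq]; first exact: eq_content_mod content_eq.
  by apply: (@content_mod F f _ _ 1); rewrite muln1.
have cs := content_interlace (fF (ltn_ord (s i))).
have cS := content_interlace (fF (ltn_ord (S i))).
have mul_le1 q : k.+1 * q.+1 <= k.+1 -> q = 0 by rewrite -[X in _ <= X]muln1 leq_pmul2l //; lia.
have [lt|lt|/val_inj->] := ltngtP (S i) (s i); last by constructor 1.
  constructor 3; have [q qE] := eqn_mod_ltn lt S_mod.
  have := @content_gap F (S i) q.+1 gap_F; rewrite -qE => /(_ (ltn_ord _)) le_F.
  have := @content_gap f (S i) q.+1 gap_f; rewrite -qE => /(_ (ltn_ord _)) le_f.
  have q0 : q = 0 by apply: mul_le1; lia.
  by rewrite q0 muln1 in qE le_F le_f; split => //; lia.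
constructor 2; have [q qE] := eqn_mod_ltn lt (esym S_mod).
have := @content_gap F (s i) q.+1 gap_F; rewrite -qE => /(_ (ltn_ord _)) le_F.
have q0 : q = 0 by apply: mul_le1; lia.
by rewrite q0 muln1 in qE le_F; split; lia.
Qed.

Lemma interlacing_perm_leq (i : 'I_N) : S i <= s i.
Proof.
have [x] := ubnP (s i : nat); elim: x i => // x IH i six.
case: (interlacing_shift i) => [->//|[F_up SE]|[_ ->]]; last by rewrite leq_addr.
pose j := (S^-1)%g (s i); have Sj : S j = s i by rewrite permKV.
case: (interlacing_shift j) => [sj|[_ SjE]|[F_eq _]].
- have ji : j = i by apply: (@perm_inj _ s); rewrite -sj Sj.
  by move: Sj; rewrite ji => ->.
- by rewrite Sj in SjE; have := IH j; rewrite Sj; lia.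
- by move: F_eq F_up; rewrite Sj; lia.
Qed.

Lemma interlacing_perm_eq : S =1 s.
Proof. exact: perm_leq_eq interlacing_perm_leq. Qed.

End Interlacing.

Lemma content_perm_step f g s (i j : 'I_N) : has_gap k.+1 p.+1 f -> has_gap k p f ->
  {homo g : u v / u <= v >-> v <= u} -> (forall i : 'I_N, content g i = content f (s i)) ->
  i = j.+1 :> nat ->
  s j < s i \/ [/\ s j = s i + k :> nat, f (s i) = f (s i + k) + p & g j = g i].
Proof.
move=> gap_f gap_k g_noninc gs ij; have [lt_s|le_s] := ltnP (s j) (s i); [by left|right].
have g_ij : g i <= g j by apply: g_noninc; lia.
have sij : s i < s j < N.
  rewrite ltn_ord andbT ltn_neqAle le_s andbT val_eqE (inj_eq perm_inj) -val_eqE /=; lia.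
have [|<- -> gE] := @content_tight f (s j) (s i) (g j - g i) gap_f gap_k sij; last first.
  by split=> //; lia.
rewrite -!gs /content ij mulnBr; have : k.+1 * g i <= k.+1 * g j by rewrite leq_mul2l g_ij orbT.
by rewrite ij; lia.
Qed.

End Contents.

Section EpsPermutation.
Variables (F : numFieldType) (a0 : F) (k p N : nat).
Hypothesis a0E : a0 *+ p + k.+1%:R = 0.

Lemma eps_prod_XsubC (f : seq nat) : eps N f a0%:P 'X =
  \prod_(t <- [tuple i%:R - a0 *+ nth 0%N f i | i < N]) ('X - t%:P).
Proof.
rewrite /eps big_tuple; apply: eq_bigr => i _; rewrite tnth_mktuple.
by rewrite polyCB !polyCMn polyC1 opprB addrA.
Qed.

Lemma content_eigenvalue (f : nat -> nat) x : (a0 *+ f x - x%:R) *+ p = - (content k p f x)%:R.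
Proof.
rewrite /content natrD !natrM -!(mulr_natr a0) -(mulr_natr (_ - _)).
have -> : k.+1%:R = - (a0 * p%:R) :> F.
  by apply/eqP; rewrite -addr_eq0 addrC mulr_natr a0E.
by ring.
Qed.

Lemma eps_eq_content_perm (f g : seq nat) : eps N f a0%:P 'X = eps N g a0%:P 'X ->
  exists s : 'S_N, forall i : 'I_N, content k p (nth 0%N g) i = content k p (nth 0%N f) (s i).
Proof.
rewrite !eps_prod_XsubC => /prod_XsubC_eq; rewrite perm_sym => /tuple_permP[s sE].
exists s => i; have := congr1 (fun t : seq F => nth 0 t i) sE.
rewrite -!tnth_nth !tnth_mktuple => /(congr1 (fun x => - x *+ p)); rewrite !opprB.
by rewrite !content_eigenvalue => /oppr_inj/eqP; rewrite eqr_nat => /eqP.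
Qed.

End EpsPermutation.

Section Rows.
Local Open Scope nat_scope.
Variables (N M : nat).
Implicit Types (m L : 'X_{1..N}).

Lemma sp_circ_interlace m x : x < N ->
  nth 0 (sp_star m) x <= nth 0 (sp_circ M m) x <= (nth 0 (sp_star m) x).+1.
Proof.
move=> xN; have [i <-] := comp_rank_onto m xN; rewrite nth_sp_star nth_sp_circ.
by case: (i < M); lia.
Qed.

Lemma strict_interlace m x : strict M m -> x.+1 < N ->
  nth 0 (sp_circ M m) x.+1 <= nth 0 (sp_star m) x.
Proof.
move=> /forall_inP strict_m xN.
have [i iE] := comp_rank_onto m (ltnW xN); have [j jE] := comp_rank_onto m xN.
rewrite -jE -iE nth_sp_circ nth_sp_star.
have : before m i j by rewrite -ltn_comp_rank iE jE.
rewrite /before; have [jM|jM] := ltnP j M; last by lia.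
case/orP => [|/andP[/eqP tie ij]]; first by lia.
have [iI jI] : i \in setI_ N M /\ j \in setI_ N M by rewrite !inE; lia.
by have /forall_inP/(_ j jI) := strict_m i iI; rewrite ij tie ltnn.
Qed.

Lemma weakly_admissible_gap k p L : strict M L -> weakly_admissible M k p.+1 L ->
  has_gap N k.+1 p.+1 (nth 0 (sp_star L)) /\ has_gap N k.+1 p.+1 (nth 0 (sp_circ M L)).
Proof.
move=> strict_m weak_L; split=> x xN; have xkN : (x + k).+1 < N by lia.
  have := weak_L x.+1; rewrite addSnnS => /(_ xN).
  by have := @strict_interlace L x strict_m; lia.
have := weak_L x; have := strict_interlace strict_m xkN; rewrite (addnS x k); lia.
Qed.

Lemma weakly_admissible_gap_k k p L : weakly_admissible M k p.+1 L ->
  has_gap N k p (nth 0 (sp_star L)) /\ has_gap N k p (nth 0 (sp_circ M L)).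
Proof.
move=> weak_L; split=> x xN; have := weak_L x xN; have := @sp_circ_interlace L x;
  have := @sp_circ_interlace L (x + k) xN; lia.
Qed.

End Rows.

Section Collision.
Local Open Scope nat_scope.
Variables (N M k p : nat).
Hypothesis cop : coprime k.+1 p.
Variables (L G : 'X_{1..N}) (s S : 'S_N).
Local Notation lam := (nth 0 (sp_star L)).
Local Notation Lam := (nth 0 (sp_circ M L)).
Local Notation gam := (nth 0 (sp_star G)).
Local Notation Gam := (nth 0 (sp_circ M G)).
Hypotheses (star_content : forall i : 'I_N, content k p gam i = content k p lam (s i))
  (circ_content : forall i : 'I_N, content k p Gam i = content k p Lam (S i)).

Lemma content_eq_seq (u v : seq nat) : size u = N -> size v = N ->
  (forall i : 'I_N, content k p (nth 0 v) i = content k p (nth 0 u) i) -> u = v.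
Proof.
move=> size_u size_v content_eq; apply: (@eq_from_nth _ 0); first by rewrite size_u size_v.
move=> i; rewrite size_u => iN; have := content_eq (Ordinal iN); rewrite /content /= => /eqP.
by rewrite eqn_add2r eqn_pmul2l // => /eqP.
Qed.

Lemma content_perm_id : s = 1%g -> S =1 s -> sp_star L = sp_star G /\ sp_circ M L = sp_circ M G.
Proof.
move=> s1 Ss; split; apply: content_eq_seq; rewrite ?size_sp_star ?size_sp_circ // => i.
  by rewrite star_content s1 perm1.
by rewrite circ_content Ss s1 perm1.
Qed.

Lemma strongly_admissible_rigid : strongly_admissible M k p.+1 L ->
  sp_star L = sp_star G /\ sp_circ M L = sp_circ M G.
Proof.
move=> [moderate gap_lam].
have noninc u : {homo nth 0 (decr_rearr u) : x y / x <= y >-> y <= x}.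
  exact: nth_decr_rearr_noninc.
have gap_Lam : has_gap N k.+1 p.+1 Lam.
  move=> x xN; apply: leq_trans (moderate x _); last by lia.
  by rewrite leq_add2r; apply: noninc; lia.
have gap_k : has_gap N k p Lam by move=> x /moderate; lia.
have Ss : S =1 s := interlacing_perm_eq cop gap_lam gap_Lam (@sp_circ_interlace N M L)
  (@sp_circ_interlace N M G) star_content circ_content.
have [s1|s_neq1] := eqVneq s 1%g; first exact: content_perm_id.
have S_neq1 : S != 1%g.
  by apply: contraNneq s_neq1 => S_eq1; apply/eqP/permP => i; rewrite -Ss S_eq1.
case: (@perm_crossing N (fun=> False) k S _ _ S_neq1) => [i|i j ij|? [? []]//].
  by apply/esym; apply: (eq_content_mod cop (circ_content i)).
left.
have [//|[SE tight _]] := content_perm_step cop gap_Lam gap_k (noninc _) circ_content ij.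
by have := moderate (S i); rewrite -SE ltn_ord => /(_ isT); rewrite SE tight; lia.
Qed.

(* [Lam x = (lam x).+1] means that row [x] comes from the block I. *)
Definition collision A B : Prop :=
  [/\ A < B <= A + k, B + k < N &
    forall x, x = A \/ x = B ->
      [/\ lam x = lam (x + k) + p, Lam x = (lam x).+1 & Lam (x + k) = (lam (x + k)).+1]].

Lemma weakly_admissible_collision : strict M L -> weakly_admissible M k p.+1 L ->
  (sp_star L = sp_star G /\ sp_circ M L = sp_circ M G) \/
  (~~ strict M G /\ exists A B, collision A B).
Proof.
move=> strict_m weak_L; have [gap_lam gap_Lam] := weakly_admissible_gap strict_m weak_L.
have [gap_k_lam gap_k_Lam] := weakly_admissible_gap_k weak_L.
have Ss : S =1 s := interlacing_perm_eq cop gap_lam gap_Lam (@sp_circ_interlace N M L)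
  (@sp_circ_interlace N M G) star_content circ_content.
have [s1|s_neq1] := eqVneq s 1%g; [by left; apply: content_perm_id|right].
have noninc u : {homo nth 0 (decr_rearr u) : x y / x <= y >-> y <= x}.
  exact: nth_decr_rearr_noninc.
pose P (i : 'I_N) := [/\ s i + k < N, lam (s i) = lam (s i + k) + p,
  Lam (s i) = Lam (s i + k) + p & gam i.-1 = gam i].
case: (@perm_crossing N P k s _ _ s_neq1) => [i|i j ij|i1 [i2 [P1 P2 i1E si2 /andP[overlap i2N]]]].
- by apply/esym; apply: (eq_content_mod cop (star_content i)).
- have [|[sE tight gamE]] := content_perm_step cop gap_lam gap_k_lam (noninc _) star_content ij.
    by left.
  right; split=> //; split=> //; first by rewrite -sE.
    have [|[_ tightL _]] := content_perm_step cop gap_Lam gap_k_Lam (noninc _) circ_content ij.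
      by rewrite !Ss sE; lia.
    by rewrite -Ss.
  by rewrite {1}ij; exact: gamE.
have fermionic i : P i -> [/\ lam (s i) = lam (s i + k) + p, Lam (s i) = (lam (s i)).+1
    & Lam (s i + k) = (lam (s i + k)).+1].
  move=> [siN tight tightL _]; have := weak_L _ siN; have := @sp_circ_interlace N M L (s i).
  by have := @sp_circ_interlace N M L (s i + k) siN; split; lia.
split; last first.
  by exists (s i1), i2; split=> // x [->|->]; [exact: fermionic | rewrite -si2; exact: fermionic].
apply/negP => strict_G; have [_ _ _ gamE] := P1; have [_ LamE _] := fermionic _ P1.
have i1_gt0 : 0 < i1 by rewrite i1E.
have := @strict_interlace N M G i1.-1 strict_G; rewrite prednK // gamE => /(_ (ltn_ord _)).
have GamE : Gam i1 = (gam i1).+1; last by rewrite GamE ltnn.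
apply/eqP; rewrite -(eqn_pmul2l (ltn0Sn k)); apply/eqP.
by have := star_content i1; have := circ_content i1; rewrite Ss /content LamE; lia.
Qed.

End Collision.

(** * Poles *)

Section RegularFunctions.
Variables (F : numFieldType) (a0 : F).
Local Notation K := (ratfun F).
Local Notation a := (alpha_gen F).
Local Notation val := (ratfun_value a0).
Implicit Types (c u w : K) (y z : F) (q : {poly F}).

Lemma tofrac_natr n : FracField.tofrac n%:R = n%:R :> K.
Proof. by rewrite tofracMn tofrac1. Qed.

Lemma alpha_generic : generic_param a.
Proof.
move=> x y n1 n2.
have linE (i n : nat) : a *+ i + n%:R = FracField.tofrac ('X *+ i + n%:R) :> K.
  by rewrite tofracD tofracMn tofrac_natr.
rewrite !linE => /eqP; rewrite tofrac_eq => /eqP linear_eq.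
have := congr1 (coefp 0) linear_eq; have := congr1 (coefp 1) linear_eq.
rewrite /= -!polyC_natr !coefD !coefMn !coefX !coefC /= !mul0rn !add0r !addr0.
by move=> /eqP + /eqP; rewrite !eqr_nat => /eqP-> /eqP->.
Qed.

Lemma tofrac_horner_neq0 q : q.[a0] != 0 -> FracField.tofrac q != 0 :> K.
Proof. by move=> qa; rewrite tofrac_eq0; apply: contraNneq qa => ->; rewrite horner0. Qed.

Lemma ratfun_value_tofrac q : val (FracField.tofrac q) q.[a0].
Proof. by exists q, 1; rewrite hornerC oner_neq0 tofrac1 !divr1. Qed.

Lemma ratfun_value_alpha : val a a0.
Proof. by have := ratfun_value_tofrac 'X; rewrite hornerX. Qed.

Lemma ratfun_value_ring : ring_relation val.
Proof.
split.
- by have := ratfun_value_tofrac 0; rewrite tofrac0 horner0.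
- by have := ratfun_value_tofrac 1; rewrite tofrac1 hornerC.
- move=> ? ? ? ? [n [d [d0 -> ->]]] [n' [d' [d0' -> ->]]].
  exists (n * d' + n' * d), (d * d'); split; first by rewrite hornerM mulf_neq0.
    by rewrite tofracD !tofracM addf_div ?tofrac_horner_neq0.
  by rewrite hornerD !hornerM addf_div.
- move=> ? ? ? ? [n [d [d0 -> ->]]] [n' [d' [d0' -> ->]]].
  exists (n * n'), (d * d'); split; first by rewrite hornerM mulf_neq0.
    by rewrite !tofracM mulf_div.
  by rewrite !hornerM mulf_div.
- move=> ? ? [n [d [d0 -> ->]]]; exists (- n), d; split=> //; first by rewrite tofracN mulNr.
  by rewrite hornerN mulNr.
Qed.

Lemma ratfun_valueV c y : val c y -> y != 0 -> val c^-1 y^-1.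
Proof.
move=> [n [d [d0 -> ->]]]; rewrite mulf_eq0 invr_eq0 negb_or => /andP[n0 _].
by exists d, n; split=> //; rewrite invf_div.
Qed.

Lemma ratfun_value_eval c y : val c y -> ratfun_eval a0 c = y.
Proof. by move=> [n [d [d0 -> ->]]]; rewrite ratfun_evalE. Qed.

Lemma ratfun_value_uniq c y z : val c y -> val c z -> y = z.
Proof. by move=> /ratfun_value_eval <- /ratfun_value_eval <-. Qed.

Lemma ratfun_value_nat n : val n%:R n%:R.
Proof. exact: rel_nat ratfun_value_ring n. Qed.

Lemma ratfun_value_alphaMn x : val (a *+ x) (a0 *+ x).
Proof. exact/(rel_muln ratfun_value_ring)/ratfun_value_alpha. Qed.

Lemma ratfun_value_sign (b : bool) : val ((-1) ^+ b) ((-1) ^+ b).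
Proof.
case: b; rewrite ?expr0 ?expr1; last exact: rel1 ratfun_value_ring.
exact/(relN ratfun_value_ring)/(rel1 ratfun_value_ring).
Qed.

Lemma ratfun_value_neq0 c y : val c y -> y != 0 -> c != 0.
Proof.
move=> cy; apply: contraNneq => c0; rewrite c0 in cy.
by apply/eqP/(ratfun_value_uniq cy)/(ratfun_value_nat 0).
Qed.

Definition regular c : Prop := exists y, val c y.

Lemma regular_ring : ring_relation (fun c (_ : K) => regular c).
Proof.
split=> [||c c' _ _ [y cy] [y' cy']|c c' _ _ [y cy] [y' cy']|c _ [y cy]].
- by exists 0; apply: rel0 ratfun_value_ring.
- by exists 1; apply: rel1 ratfun_value_ring.
- by exists (y + y'); apply: (relD ratfun_value_ring).
- by exists (y * y'); apply: (relM ratfun_value_ring).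
- by exists (- y); apply: (relN ratfun_value_ring).
Qed.

Lemma regularM c c' : regular c -> regular c' -> regular (c * c').
Proof. exact: (relM regular_ring) 0 0. Qed.

Definition regular_unit c : Prop := exists2 y, val c y & y != 0.

Lemma regular_unit1 : regular_unit 1.
Proof. by exists 1; [exact: (ratfun_value_nat 1) | rewrite oner_neq0]. Qed.

Lemma regular_unitM c c' : regular_unit c -> regular_unit c' -> regular_unit (c * c').
Proof.
move=> [y cy y0] [y' cy' y0']; exists (y * y'); last by rewrite mulf_neq0.
exact: (relM ratfun_value_ring).
Qed.

Lemma regular_unitV c : regular_unit c -> regular_unit c^-1.
Proof. by move=> [y cy y0]; exists y^-1; [apply: ratfun_valueV | rewrite invr_eq0]. Qed.

Definition uniformizer : K := a - FracField.tofrac a0%:P.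
Local Notation pi := uniformizer.

Lemma ratfun_value_uniformizer : val pi 0.
Proof.
rewrite -(subrr a0); apply: (relB ratfun_value_ring); first exact: ratfun_value_alpha.
by have := ratfun_value_tofrac a0%:P; rewrite hornerC.
Qed.

Lemma uniformizer_neq0 : pi != 0.
Proof. by rewrite /pi -tofracN -tofracD tofrac_eq0 -size_poly_eq0 -polyCN size_XaddC. Qed.

(* [c] has order [e1 - e2] at [a0]. *)
Definition has_order c (e1 e2 : nat) : Prop :=
  exists2 u, regular_unit u & c * pi ^+ e2 = pi ^+ e1 * u.

Lemma has_orderM c c' e1 e2 f1 f2 :
  has_order c e1 e2 -> has_order c' f1 f2 -> has_order (c * c') (e1 + f1) (e2 + f2).
Proof.
move=> [u uu cE] [w uw cE']; exists (u * w); first exact: regular_unitM.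
by rewrite !exprD mulrACA cE cE' mulrACA.
Qed.

Lemma has_order_prod (I : Type) (s : seq I) (P : pred I) (G : I -> K) (e1 e2 : I -> nat) :
  (forall i, P i -> has_order (G i) (e1 i) (e2 i)) ->
  has_order (\prod_(i <- s | P i) G i) (\sum_(i <- s | P i) e1 i) (\sum_(i <- s | P i) e2 i).
Proof.
move=> orderG; elim: s => [|i s IH].
  by rewrite !big_nil; exists 1; [exact: regular_unit1 | rewrite !expr0].
by rewrite !big_cons; case: ifP => // Pi; apply: has_orderM => //; apply: orderG.
Qed.

Lemma has_order_pole c e1 e2 : has_order c e1 e2 -> (e1 < e2)%N -> ~ regular c.
Proof.
move=> [u [y uy y0] cE] lt_e c_reg; set d := (e2 - e1).-1.
have uE : u = pi * (c * pi ^+ d).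
  apply: (mulfI (expf_neq0 e1 uniformizer_neq0)); rewrite -cE.
  have -> : e2 = (e1 + d.+1)%N by rewrite /d; lia.
  by rewrite exprD exprS mulrCA; congr (_ * _); rewrite mulrCA.
have [z zE] : regular (c * pi ^+ d).
  apply: regularM => //; elim: d {uE} => [|j IH]; first by exists 1; exact: (ratfun_value_nat 1).
  by rewrite exprS; apply: regularM => //; exists 0; apply: ratfun_value_uniformizer.
have := relM ratfun_value_ring ratfun_value_uniformizer zE; rewrite -uE => u_value.
by move: y0; rewrite (ratfun_value_uniq uy u_value) mul0r eqxx.
Qed.

Lemma linear_uniformizer s d : (0 < s)%N -> exists2 u,
  regular_unit u & a *+ s + d%:R = pi ^+ (a0 *+ s + d%:R == 0) * u.
Proof.
move=> s0; have [linear_eq0|linear_eq0] := eqVneq (a0 *+ s + d%:R) 0; last first.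
  exists (a *+ s + d%:R); last by rewrite expr0 mul1r.
  exists (a0 *+ s + d%:R) => //; apply: (relD ratfun_value_ring) (ratfun_value_nat d).
  exact: ratfun_value_alphaMn.
exists s%:R; first by exists s%:R; [apply: ratfun_value_nat | rewrite pnatr_eq0; lia].
rewrite expr1 mulrBl mulr_natr; congr (_ + _).
have dE : d%:R = - (a0 *+ s) by apply/eqP; rewrite -addr_eq0 addrC linear_eq0.
have -> : d%:R = FracField.tofrac (- (a0 *+ s))%:P :> K by rewrite -dE polyC_natr tofrac_natr.
by rewrite polyCN tofracN polyCMn tofracMn mulr_natr.
Qed.

Lemma has_order_ratio s d : (0 < s)%N ->
  has_order ((a *+ s + d.+1%:R) / (a *+ s + d%:R))
    (a0 *+ s + d.+1%:R == 0) (a0 *+ s + d%:R == 0).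
Proof.
move=> s0; have [u uu uE] := linear_uniformizer d.+1 s0.
have [w [y wy y0] wE] := linear_uniformizer d s0.
exists (u / w); first by apply/regular_unitM/regular_unitV => //; exists y.
rewrite uE wE invfM -!mulrA [w^-1 * _]mulrC mulKf //.
exact: expf_neq0 uniformizer_neq0.
Qed.

End RegularFunctions.

Section RegularPolynomials.
Variables (F : numFieldType) (a0 : F) (N : nat).
Local Notation K := (ratfun F).
Local Notation a := (alpha_gen F).
Implicit Types (p q : {mpoly K[N]}).

Lemma no_pole_atD p q : no_pole_at a0 p -> no_pole_at a0 q -> no_pole_at a0 (p + q).
Proof. by move=> reg_p reg_q m; rewrite mcoeffD; apply: (relD (regular_ring a0)) 0 0 _ _. Qed.

Lemma no_pole_atZ c p : regular a0 c -> no_pole_at a0 p -> no_pole_at a0 (c *: p).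
Proof. by move=> reg_c reg_p m; rewrite mcoeffZ; apply: regularM. Qed.

Lemma no_pole_at_msym s p : no_pole_at a0 p -> no_pole_at a0 (msym s p).
Proof. by move=> reg_p m; rewrite mcoeff_msym. Qed.

Lemma no_pole_at_cherednik j p : no_pole_at a0 p -> no_pole_at a0 (cherednik a j p).
Proof.
move=> reg_p; apply: (mpoly_rel_cherednik (regular_ring a0) j (a := a) (b := a) (q := p)) => //.
by exists a0; apply: ratfun_value_alpha.
Qed.

Lemma regular_eval1 p : no_pole_at a0 p -> regular a0 (eval1 p).
Proof.
move=> reg_p; rewrite eval1E.
by apply: (@rel_sum _ _ _ (regular_ring a0) _ _ _ _ (fun=> 0)) => m _; apply: reg_p.
Qed.

End RegularPolynomials.

Section SpecializationPole.
Variables (F : numFieldType) (a0 : F) (k p : nat).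
Hypotheses (p_gt0 : (0 < p)%N) (cop : coprime k.+1 p) (a0E : a0 *+ p + k.+1%:R = 0).
Local Notation a := (alpha_gen F).

Lemma resonance s d : (0 < s)%N -> (0 < d < k.+1.*2)%N ->
  (a0 *+ s + d%:R == 0) = (s == p) && (d == k.+1).
Proof.
move=> s0 /andP[d0 d2].
have -> : (a0 *+ s + d%:R == 0) = (d * p == k.+1 * s)%N.
  rewrite -(eqr_nat F) !natrM -[LHS](mulrI_eq0 _ (@mulfI F p%:R _)) ?pnatr_eq0 -?lt0n //.
  have -> : p%:R * (a0 *+ s + d%:R) = (a0 *+ p + k.+1%:R) * s%:R + (d%:R * p%:R - k.+1%:R * s%:R).
    by rewrite -!(mulr_natr a0); ring.
  by rewrite a0E mul0r add0r subr_eq0.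
apply/eqP/andP => [dp_eq|[/eqP-> /eqP->]] //.
have : (k.+1 %| d * p)%N by rewrite dp_eq dvdn_mulr.
rewrite Gauss_dvdl // => /dvdnP[q qE].
have q1 : q = 1%N.
  case: q qE => [|[|q]] // qE; first by rewrite qE in d0.
  by move: d2; rewrite qE -muln2 (mulnC q.+2) ltn_pmul2l.
rewrite q1 mul1n in qE; split; last by rewrite qE.
by move: dp_eq; rewrite qE => /eqP; rewrite eqn_pmul2l // eq_sym.
Qed.

Lemma has_order_spec_factor D d : (0 < d < k.*2.+1)%N ->
  has_order a0 (spec_factor a D d) ((d == k) && (p <= D)%N) ((d == k.+1) && (p <= D)%N).
Proof.
move=> dk; have countE (b : bool) : ((b && (p <= D)%N) : nat) =
    (\sum_(1 <= s < D.+1) ((s == p) && b))%N.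
  case: b => /=; last by rewrite big1 // => i _; rewrite andbF.
  rewrite (eq_bigr (fun s => (s == p : nat))); last by move=> s _; rewrite andbT.
  have [pD|Dp] := leqP p D; last first.
    by rewrite big_nat_cond big1 // => i /andP[/andP[_ iD] _]; case: eqP iD => //; lia.
  rewrite (bigD1_seq p) ?iota_uniq ?mem_index_iota //= ?eqxx; last by lia.
  by rewrite big1 // => i /negPf->.
rewrite !countE /spec_factor big_nat_cond.
rewrite [X in has_order _ _ X _]big_nat_cond [X in has_order _ _ _ X]big_nat_cond.
apply: has_order_prod => s /andP[/andP[s0 _] _].
by have := has_order_ratio a0 d s0; rewrite !resonance //; lia.
Qed.

Variable n : nat.
Local Notation N := n.+1.
Implicit Types (b : 'X_{1..N}) (i j : 'I_N).

Definition resonant_pair b r i j : bool :=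
  (comp_rank b j - comp_rank b i == r)%N && (p <= b i - b j - (j < i))%N.

Lemma has_order_principal_spec b : (n <= k.*2)%N ->
  has_order a0 (principal_spec a b)
    (\sum_i \sum_(j | before b i j) resonant_pair b k i j)
    (\sum_i \sum_(j | before b i j) resonant_pair b k.+1 i j).
Proof.
move=> nk; rewrite !(pair_big_dep xpredT (before b)) /=.
apply: has_order_prod => -[i j] /=; rewrite -ltn_comp_rank => lt_ij.
by apply: has_order_spec_factor; have := comp_rank_ltn b j; lia.
Qed.

(* Two inverted tight pairs of rows kill two of the zeros of the numerator of
   the principal specialization but none of its [n - k] poles. *)
Lemma principal_spec_pole b B : (0 < B <= k)%N -> n = (B + k)%N ->
  (forall i j, comp_rank b j = (comp_rank b i + k.+1)%N -> (b j + p < b i)%N) ->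
  (forall i j, comp_rank b i = 0%N \/ comp_rank b i = B -> comp_rank b j = (comp_rank b i + k)%N ->
      (j < i)%N /\ b i = (b j + p)%N) ->
  ~ regular a0 (principal_spec a b).
Proof.
move=> Bk nE gap_b inverted.
have nk : (n <= k.*2)%N by lia.
apply: has_order_pole (has_order_principal_spec b nk) _.
have zeros i : (\sum_(j | before b i j) resonant_pair b k i j <= (0 < comp_rank b i < B))%N.
  have [bi|bi] := boolP (0 < comp_rank b i < B)%N; last first.
    rewrite big1 // => j; rewrite -ltn_comp_rank /resonant_pair => lt_ij; case: eqP => //= dk.
    by have := inverted i j; have := comp_rank_ltn b j; lia.
  have [|j jE] := @comp_rank_onto _ b (comp_rank b i + k); first by lia.
  rewrite (bigD1 j) /=; last by rewrite -ltn_comp_rank; lia.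
  rewrite big1 ?addn0 ?leq_b1 // => l /andP[lt_il lj]; rewrite /resonant_pair.
  case: eqP => //= dk; case/eqP: lj; apply: (@comp_rank_inj _ b).
  by move: lt_il; rewrite -ltn_comp_rank; lia.
have poles i : ((comp_rank b i < B) <= \sum_(j | before b i j) resonant_pair b k.+1 i j)%N.
  have [bi|//] := boolP (comp_rank b i < B)%N.
  have [|j jE] := @comp_rank_onto _ b (comp_rank b i + k.+1); first by lia.
  rewrite (bigD1 j) /=; last by rewrite -ltn_comp_rank; lia.
  by rewrite /resonant_pair jE addKn eqxx; have := gap_b _ _ jE; lia.
have [z zE] := @comp_rank_onto _ b 0 isT.
rewrite (bigD1 z) //= [X in (_ < X)%N](bigD1 z) //= -addSn.
apply: leq_add; last first.
  by apply: leq_sum => i _; apply: leq_trans (zeros i) (leq_trans _ (poles i)); lia.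
by apply: leq_ltn_trans (zeros z) (leq_trans _ (poles z)); rewrite zE; lia.
Qed.

End SpecializationPole.

(** * Regularity of rearranged non-symmetric Jack polynomials *)

Section WindowRank.
Variable N : nat.
Implicit Types (v : 'X_{1..N}) (i j : 'I_N).

Lemma perm_downset (s : 'S_N) A : (A <= N)%N ->
  (forall i j, (i < j)%N -> (s j < A)%N -> (s i < A)%N) -> forall i, (s i < A)%N = (i < A)%N.
Proof.
move=> AN down; pose S := [set i : 'I_N | (s i < A)%N].
have cardS : #|S| = A.
  have -> : S = s @^-1: [set i : 'I_N | (i < A)%N] by apply/setP => i; rewrite !inE.
  by rewrite -[s]invgK preim_permV card_imset ?card_ord_ltn //; apply: perm_inj.
move=> i; apply/idP/idP => [siA|iA]; last apply/negPn/negP => siA.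
  rewrite ltnNge; apply/negP => Ai.
  have : [set j : 'I_N | (j < i.+1)%N] \subset S.
    apply/subsetP => j; rewrite !inE ltnS leq_eqVlt => /orP[/eqP/val_inj->//|ji].
    exact: down ji siA.
  by move/subset_leq_card; rewrite cardS card_ord_ltn //; lia.
have : S \subset [set j : 'I_N | (j < i)%N].
  apply/subsetP => j; rewrite !inE => sj; rewrite ltnNge leq_eqVlt.
  apply/negP => /orP[/eqP/val_inj j_eq_i|ij]; first by rewrite j_eq_i sj in siA.
  by move: siA; rewrite (down _ _ ij).
by move/subset_leq_card; rewrite cardS card_ord_ltn //; have := ltn_ord i; lia.
Qed.

Lemma separated_comp_rank v A : (A <= N)%N ->
  (forall i, (comp_rank v i < A)%N = (i < A)%N) -> separated v A (nth 0%N (sp_star v) A).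
Proof.
move=> AN rankA; split=> // i iA; rewrite -(nth_sp_star v i); apply: nth_decr_rearr_noninc.
  by apply: ltnW; rewrite rankA.
by rewrite leqNgt rankA -leqNgt.
Qed.

Lemma comp_rank_window A w (AwN : (A + w <= N)%N) v (j : 'I_w) :
  (forall i, (comp_rank v i < A)%N = (i < A)%N) ->
  (forall i, (comp_rank v i < A + w)%N = (i < A + w)%N) ->
  comp_rank v (emb AwN j) = (A + comp_rank (window AwN v) j)%N.
Proof.
move=> rankA rankB; rewrite !comp_rank_sum (bigID (fun i : 'I_N => (i < A)%N)) /=.
have Aj : (A <= comp_rank v (emb AwN j))%N by rewrite leqNgt rankA /= -leqNgt leq_addr.
have jB : (comp_rank v (emb AwN j) < A + w)%N by rewrite rankB /= ltn_add2l.
congr (_ + _)%N.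
  rewrite -[RHS](@card_ord_ltn N A) ?(leq_trans (leq_addr _ _) AwN) // -sum1_card.
  apply: eq_big => [i|i iA]; first by rewrite inE.
  by rewrite -ltn_comp_rank (leq_trans _ Aj) // rankA.
rewrite (big_window AwN) /= => [|i Ai iw].
  apply: eq_big => [i|i _]; first by rewrite -leqNgt leq_addr.
  by rewrite /before !windowE /= ltn_add2l.
rewrite -ltn_comp_rank ltnNge ltnW //= (leq_trans jB) // leqNgt rankB.
by move: Ai iw; rewrite /in_window; lia.
Qed.

End WindowRank.

Section Regularity.
Variables (F : numFieldType) (a0 : F) (k p n M : nat) (L : 'X_{1..n.+1}).
Local Notation N := n.+1.
Local Notation K := (ratfun F).
Local Notation a := (alpha_gen F).
Hypotheses (p_gt0 : (0 < p)%N) (cop : coprime k.+1 p) (a0E : a0 *+ p + k.+1%:R = 0).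
Variable E : 'X_{1..N} -> {mpoly K[N]}.
Hypothesis E_eigen : forall v, joint_eigen a (bar a v) (E v).
Hypothesis E_lead : forall v, (E v)@_v = 1.
Local Notation lam := (nth 0%N (sp_star L)).
Hypotheses (gap_L : has_gap N k.+1 p.+1 lam) (weak_L : weakly_admissible M k p.+1 L).
Implicit Types (v w : 'X_{1..N}) (x y i j : 'I_N).

Definition row_eigenvalue r : F := a0 *+ lam r - r%:R.

Lemma row_eigenvalue_sub r t d : row_eigenvalue t - row_eigenvalue r = d%:R ->
  content k p lam r = (content k p lam t + d * p)%N.
Proof.
move=> value_eq; apply/eqP; rewrite -(eqr_nat F) natrD natrM -value_eq mulr_natr mulrnBl.
by rewrite !(content_eigenvalue a0E); apply/eqP; ring.
Qed.

Lemma row_eigenvalue_inj r t : (r < N)%N -> (t < N)%N ->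
  row_eigenvalue r = row_eigenvalue t -> r = t.
Proof.
move=> rN tN value_eq; apply: (content_inj cop gap_L) => //.
by have := @row_eigenvalue_sub r t 0; rewrite value_eq subrr mul0n addn0; apply.
Qed.

Lemma nth_star_comp_rank v j : sp_star v = sp_star L -> lam (comp_rank v j) = v j.
Proof. by move=> <-; rewrite nth_sp_star. Qed.

Lemma bar_value v j : sp_star v = sp_star L ->
  ratfun_value a0 (bar a v j) (row_eigenvalue (comp_rank v j)).
Proof.
move=> star_v; rewrite barE /row_eigenvalue nth_star_comp_rank //.
by apply: (relB (ratfun_value_ring a0)) (ratfun_value_nat a0 _); apply: ratfun_value_alphaMn.
Qed.

Lemma bar_sub_value v w i j : sp_star v = sp_star L -> sp_star w = sp_star L ->
  ratfun_value a0 (bar a v i - bar a w j)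
    (row_eigenvalue (comp_rank v i) - row_eigenvalue (comp_rank w j)).
Proof. by move=> star_v star_w; apply: (relB (ratfun_value_ring a0)); apply: bar_value. Qed.

Lemma row_eigenvalue_sub_neq0 v w i j : comp_rank v i != comp_rank w j ->
  row_eigenvalue (comp_rank v i) - row_eigenvalue (comp_rank w j) != 0.
Proof.
by rewrite subr_eq0; apply: contraNneq => /row_eigenvalue_inj->; rewrite ?comp_rank_ltn.
Qed.

Lemma exchange_coef_value v x y : sp_star v = sp_star L -> x != y ->
  ratfun_value a0 (exchange_coef a x y v)
    (row_eigenvalue (comp_rank v y) - row_eigenvalue (comp_rank v x))^-1.
Proof.
move=> star_v xy; apply: ratfun_valueV; first exact: bar_sub_value.
by apply: row_eigenvalue_sub_neq0; rewrite (inj_eq (@comp_rank_inj _ v)) eq_sym.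
Qed.

Section OrbitCoefficients.
Variables (T : symtype) (q : 'X_{1..N} -> K).
Hypotheses (sL : superpartition M L) (symI : antisymI T = false) (qL : q L = 1).
Local Notation O := (block_orbit M L).
Local Notation Q := (\sum_(v <- O) q v *: E v).
Hypothesis Q_reg : no_pole_at a0 Q.
Hypothesis Q_sym : block_symmetric M T Q.

(* The value vanishes only if the two rows are adjacent, or at distance k with
   parts differing by p; weak admissibility excludes the latter in J. *)
Lemma sign_sub_exchange_coef_unit v x y : v \in O -> block_adjacent M x y -> (v x < v y)%N ->
  regular_unit a0 ((-1) ^+ antisym_at M T x - exchange_coef a x y v).
Proof.
move=> vO adj lt_v; have [xy xNy blk] := block_adjacentP adj; have star_v := block_orbit_sp_star vO.
have rank_yx : (comp_rank v y < comp_rank v x < N)%N.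
  by rewrite comp_rank_ltn ltn_comp_rank /before lt_v.
exists ((-1) ^+ antisym_at M T x
  - (row_eigenvalue (comp_rank v y) - row_eigenvalue (comp_rank v x))^-1).
  by apply: (relB (ratfun_value_ring a0)); [apply: ratfun_value_sign | apply: exchange_coef_value].
rewrite subr_eq0; apply/eqP => /(congr1 GRing.inv); rewrite invrK.
case antisym : (antisym_at M T x); rewrite ?expr1 ?invrN1 ?expr0 ?invr1 => /esym; last first.
  move/(@row_eigenvalue_sub _ _ 1); rewrite mul1n => content_eq.
  have := content_adjacent cop gap_L (@nth_decr_rearr_noninc _) rank_yx content_eq.
  by rewrite !nth_star_comp_rank //; lia.
move/(congr1 -%R); rewrite opprB opprK => /(@row_eigenvalue_sub _ _ 1); rewrite mul1n => content_eq.
have gap_k := proj1 (weakly_admissible_gap_k weak_L).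
have [|rankE tight _] := content_tight (z := 0) cop gap_L gap_k rank_yx.
  by rewrite -content_eq muln0 addn0.
have := weak_L (i := comp_rank v y); rewrite -rankE comp_rank_ltn => /(_ isT).
rewrite -(block_orbit_sp_circ vO) nth_sp_circ nth_star_comp_rank //.
rewrite (_ : (y < M)%N = false) ?addn0; last first.
  by rewrite blk; move: antisym; rewrite /antisym_at symI; case: ifP.
by move: tight; rewrite !nth_star_comp_rank //; lia.
Qed.

Lemma orbit_coef_unit v : v \in O -> regular_unit a0 (q v).
Proof.
move: v; apply: (@adjacent_swap_ind _ (block_adjacent M) (fun v i => v i)).
- by move=> v x y i _ _; rewrite mpermE.
- move=> v sorted vO; rewrite (_ : v = L) ?qL; first exact: regular_unit1.
  apply: block_orbit_superpartition vO => //; apply: superpartition_adj => x y adj.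
  by have [xy _ _] := block_adjacentP adj; apply: sorted.
- move=> v x y _ adj lt_v IH vO.
  rewrite (orbit_sum_recursion (@alpha_generic F) E_eigen E_lead (Q_sym adj) adj vO lt_v).
  apply: regular_unitM; first exact: sign_sub_exchange_coef_unit.
  exact/IH/block_orbit_adj.
Qed.

Lemma no_pole_at_orbit v : v \in O -> no_pole_at a0 (E v).
Proof.
move=> vO; have [y qy y0] := orbit_coef_unit vO.
rewrite -[E v](scalerK (ratfun_value_neq0 qy y0)).
apply: no_pole_atZ; first by exists y^-1; apply: ratfun_valueV.
move: v vO {y qy y0}; apply: (@joint_eigen_separation _ a _ (no_pole_at a0) (regular a0)
  _ _ _ _ _ O (fun v => q v *: E v) (bar a)) => //.
- by move=> *; apply: no_pole_atD.
- by move=> *; apply: no_pole_atZ.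
- by move=> *; apply: no_pole_at_cherednik.
- by move=> c; exact: (@relN _ _ _ (regular_ring a0) c 0).
- exact: block_orbit_uniq.
- by move=> w _; apply: joint_eigenZ.
- by move=> w j wO; eexists; apply/bar_value/(block_orbit_sp_star wO).
- move=> w w' /block_orbit_sp_star star_w /block_orbit_sp_star star_w' ww'.
  have [j jE] : exists j, comp_rank w j != comp_rank w' j.
    apply/existsP; apply: contraNT ww' => /existsPn rank_eq; apply/eqP/mnmP => j.
    by rewrite -!nth_star_comp_rank //; congr nth; apply/eqP/negPn/rank_eq.
  have value := bar_sub_value j j star_w star_w'.
  have nz := row_eigenvalue_sub_neq0 jE.
  exists j; split; last by eexists; apply: ratfun_valueV value nz.
  by rewrite -subr_eq0; apply: ratfun_value_neq0 value nz.
Qed.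

End OrbitCoefficients.

Variables A B : nat.
Hypotheses (AB : (A < B <= A + k)%N) (BkN : (B + k < N)%N).
Hypotheses (tight_A : lam A = (lam (A + k) + p)%N) (tight_B : lam B = (lam (B + k) + p)%N).

Definition inverted v r : Prop :=
  forall i j, comp_rank v i = r -> comp_rank v j = (r + k)%N -> (j < i)%N.

Definition inverted_regular v : Prop :=
  [/\ sp_star v = sp_star L, no_pole_at a0 (E v), inverted v A & inverted v B].

(* Rows before, in and after the window [A..B+k] have side 0, 1 and 2. *)
Definition window_side r : nat := ((A <= r) + (B + k < r))%N.

Lemma inverted_mperm_adj v x y r : y = x.+1 :> nat -> v x != v y ->
  window_side (comp_rank v x) != window_side (comp_rank v y) ->
  window_side r = window_side (r + k) -> inverted v r -> inverted (mperm (tperm x y) v) r.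
Proof.
move=> xy vxy side_xy side_r inv i j.
rewrite -{1}(tpermK x y i) -{1}(tpermK x y j) !comp_rank_mperm_adj // => ir jr.
rewrite -(ltn_tperm_adj xy) ?inv //; apply: contraNneq side_xy => -[jE iE].
  by move: ir jr; rewrite iE jE tpermL tpermR => -> ->; rewrite side_r.
by move: ir jr; rewrite iE jE tpermL tpermR => -> ->; rewrite side_r.
Qed.

Lemma inverted_regular_sorted v : inverted_regular v -> exists2 w, inverted_regular w &
  forall i j, (i < j)%N -> (window_side (comp_rank w i) <= window_side (comp_rank w j))%N.
Proof.
pose f v i := (2 - window_side (comp_rank v i))%N.
have side_le2 r : (window_side r <= 2)%N by rewrite /window_side; lia.
have ascent u x y : y = x.+1 :> nat -> (f u x < f u y)%N -> (u x < u y)%N.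
  move=> xy lt_f; have : (comp_rank u y < comp_rank u x)%N.
    by move: lt_f; rewrite /f /window_side; lia.
  by rewrite ltn_comp_rank /before xy; lia.
move: v; apply: (@adjacent_swap_ind _ (fun _ _ => true) f) => [v x y i xy lt_f|v sorted v_inv|].
- have vxy : v x != v y by rewrite neq_ltn (ascent v x y xy lt_f).
  by rewrite /f -{1}(tpermK x y i) comp_rank_mperm_adj.
- exists v => //; apply: adjacent_transitive => [j i l|x y xy]; first exact: leq_trans.
  by have := sorted x y xy isT; rewrite /f; have := side_le2 (comp_rank v x); lia.
move=> v x y xy _ lt_f IH [star_v reg_v inv_A inv_B]; apply: IH.
have vlt := ascent v x y xy lt_f; have vxy : v x != v y by rewrite neq_ltn vlt.
have side_xy : window_side (comp_rank v x) != window_side (comp_rank v y).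
  by apply: contraTneq lt_f => side_eq; rewrite /f side_eq ltnn.
split; [by rewrite sp_star_mperm | | |];
  try by apply: inverted_mperm_adj => //; rewrite /window_side; lia.
rewrite (nsJack_ascent (@alpha_generic F) E_eigen E_lead xy vlt).
apply: no_pole_atD; first exact: no_pole_at_msym.
apply: no_pole_atZ => //; eexists; apply: exchange_coef_value => //.
by rewrite -val_eqE /=; lia.
Qed.

Section SortedWindow.
Variable v : 'X_{1..N}.
Hypothesis v_inv : inverted_regular v.
Hypothesis v_sorted :
  forall i j, (i < j)%N -> (window_side (comp_rank v i) <= window_side (comp_rank v j))%N.

Local Notation w := (B - A + k).+1.

Let AwN : (A + w <= N)%N. Proof. by lia. Qed.

Let star_v : sp_star v = sp_star L. Proof. by case: v_inv. Qed.

Lemma comp_rank_ltn_window_start i : (comp_rank v i < A)%N = (i < A)%N.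
Proof.
rewrite -rank_permE; apply: perm_downset => [|x y xy]; first by lia.
by rewrite !rank_permE => yA; have := v_sorted xy; rewrite /window_side; lia.
Qed.

Lemma comp_rank_ltn_window_end i : (comp_rank v i < A + w)%N = (i < A + w)%N.
Proof.
rewrite -rank_permE; apply: perm_downset => // x y xy.
by rewrite !rank_permE => yB; have := v_sorted xy; rewrite /window_side in yB *; lia.
Qed.

Lemma comp_rank_window_emb (j : 'I_w) :
  comp_rank v (emb AwN j) = (A + comp_rank (window AwN v) j)%N.
Proof.
by apply: comp_rank_window; [apply: comp_rank_ltn_window_start | apply: comp_rank_ltn_window_end].
Qed.

Lemma joint_eigen_window : joint_eigen a (bar a (window AwN v)) (extract AwN v (E v)).
Proof.
have AN : (A <= N)%N := leq_trans (leq_addr _ _) AwN.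
have sepA := separated_comp_rank AN comp_rank_ltn_window_start.
have sepB := separated_comp_rank AwN comp_rank_ltn_window_end.
have supp m : m \in msupp (E v) -> comp_le m v.
  by case/(joint_eigen_supp (@alpha_generic F) (E_eigen v)).
move=> j; rewrite (joint_eigen_extract AwN sepA sepB (E_eigen v) supp j); congr (_ *: _).
by rewrite !barE windowE comp_rank_window_emb natrD; ring.
Qed.

Lemma window_part (j : 'I_w) : window AwN v j = lam (A + comp_rank (window AwN v) j).
Proof. by rewrite -comp_rank_window_emb nth_star_comp_rank // windowE. Qed.

Lemma sorted_window_absurd : False.
Proof.
have [_ reg_v inv_A inv_B] := v_inv.
have value := eval1_joint_eigen (@alpha_generic F) joint_eigen_window.
have gluev : glue A v (window AwN v) = v by apply/esym/eq_glue_window.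
rewrite mcoeff_extract gluev E_lead mul1r in value.
apply: (@principal_spec_pole _ a0 k p p_gt0 cop a0E (B - A + k) (window AwN v) (B - A)).
- by lia.
- by [].
- move=> i j ij; rewrite !window_part ij.
  have rN : (A + comp_rank (window AwN v) i + k.+1 < N)%N.
    by apply: leq_trans (AwN); rewrite -addnA ltn_add2l -ij comp_rank_ltn.
  by have := gap_L rN; rewrite (addnA A) (addnS _ p).
- have window_inverted r (i j : 'I_w) : inverted v (A + r) -> comp_rank (window AwN v) i = r ->
      comp_rank (window AwN v) j = (r + k)%N -> (j < i)%N.
    move=> inv ir jr; have := inv (emb AwN i) (emb AwN j).
    by rewrite !comp_rank_window_emb ir jr addnA /= ltn_add2l; apply.
  have BE : B = (A + (B - A))%N by rewrite subnKC //; lia.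
  move=> i j [i0|iB] ij; rewrite !window_part ij; split.
  + by apply: (window_inverted 0%N) => //; rewrite ?addn0 ?ij ?i0.
  + by rewrite i0 addn0 add0n tight_A.
  + by apply: (window_inverted (B - A)%N) => //; rewrite -?BE ?ij ?iB.
  + by rewrite iB addnA -BE.
- by rewrite -value; apply: regular_eval1 => m; rewrite mcoeff_extract; apply: reg_v.
Qed.

End SortedWindow.

Lemma inverted_regular_absurd v : ~ inverted_regular v.
Proof.
by case/inverted_regular_sorted => u u_inv u_sorted; apply: sorted_window_absurd u_sorted.
Qed.

End Regularity.

(** * Monomial expansions *)

Section BlockMonomial.
Variables (R : idomainType) (N : nat).
Implicit Types (K : {set 'I_N}) (nu m h : 'X_{1..N}) (s u : 'S_N) (f g : {mpoly R[N]}).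

Definition restrict_mnm K nu : 'X_{1..N} := [multinom if i \in K then nu i else 0%N | i < N].

Lemma restrict_mnmE K nu i : restrict_mnm K nu i = if i \in K then nu i else 0%N.
Proof. exact: mnmE. Qed.

Lemma restrict_mnm_id K nu : restrict_mnm K (restrict_mnm K nu) = restrict_mnm K nu.
Proof. by apply/mnmP => i; rewrite !restrict_mnmE; case: (i \in K). Qed.

Lemma restrict_mperm K s m :
  perm_on K s -> restrict_mnm K (mperm s m) = mperm s (restrict_mnm K m).
Proof. by move=> sK; apply/mnmP => i; rewrite !(restrict_mnmE, mpermE) perm_closed. Qed.

Lemma restrict_mperm_disjoint K K' s m :
  perm_on K' s -> [disjoint K & K'] -> restrict_mnm K (mperm s m) = restrict_mnm K m.
Proof.
move=> sK' KK'; apply/mnmP => i; rewrite !(restrict_mnmE, mpermE); case: ifP => // iK.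
by rewrite (out_perm sK') // (disjointFr KK' iK).
Qed.

Definition block_mono (b : bool) K nu : {mpoly R[N]} :=
  if b then alt_mono R K nu else sym_mono R K nu.

Lemma monoE M T L :
  mono R M T L = block_mono (antisymI T) (setI_ N M) L * block_mono (antisymJ T) (setJ_ N M) L.
Proof. by case: T. Qed.

Lemma msym_restrict K nu s :
  \prod_(i in K) ('X_(s i) : {mpoly R[N]}) ^+ nu i = msym s 'X_[restrict_mnm K nu].
Proof.
rewrite msymX (mpolyXE R s) big_mkcond; apply: eq_bigr => i _.
by rewrite mnmE permK restrict_mnmE; case: ifP; rewrite ?expr0.
Qed.

Lemma alt_monoE K nu : alt_mono R K nu = block_sym true K 'X_[restrict_mnm K nu].
Proof. by apply: eq_bigr => s _; rewrite msym_restrict. Qed.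

Lemma mpolyX_eq m m' : ('X_[m] == 'X_[m'] :> {mpoly R[N]}) = (m == m').
Proof.
apply/eqP/eqP => [/(congr1 (mcoeff m))|-> //]; rewrite !mcoeffX eqxx.
by case: eqP => // _ /eqP; rewrite oner_eq0.
Qed.

Lemma mcoeff_sym_mono K nu m : (sym_mono R K nu)@_m =
  [exists s : 'S_N, perm_on K s && (restrict_mnm K nu == mperm s m)]%:R.
Proof.
rewrite /sym_mono raddf_sum /=; set l := undup _.
have mcoeff_l p : p \in l -> p@_m = (p == 'X_[m])%:R.
  rewrite mem_undup => /mapP[s _ ->]; rewrite msym_restrict msymX.
  by rewrite mcoeffX mpolyX_eq.
have mem_l : ('X_[m] \in l) = [exists s : 'S_N, perm_on K s && (restrict_mnm K nu == mperm s m)].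
  rewrite mem_undup; apply/mapP/existsP => [[s]|[s /andP[sK /eqP restr]]].
    rewrite mem_enum msym_restrict => sK /(congr1 (msym s^-1%g)).
    rewrite -msymMm mulgV msym1m msymX invgK => /eqP; rewrite mpolyX_eq eq_sym => restr.
    by exists s; apply/andP.
  exists s; first by rewrite mem_enum.
  by rewrite msym_restrict restr msymX -/(mperm _ _) mperm_mul mulVg mperm_id.
rewrite -mem_l big_seq (eq_bigr _ mcoeff_l) -big_seq.
have [Xl|Xl] := boolP ('X_[m] \in l); last first.
  by rewrite big_seq big1 // => p pl; case: eqP Xl pl => // <- /negPf->.
by rewrite (bigD1_seq _ Xl (undup_uniq _)) /= eqxx big1 ?addr0 // => p /negPf->.
Qed.

Lemma mcoeff_block_mono_neq0 b K nu m : (block_mono b K nu)@_m != 0 ->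
  exists2 s : 'S_N, perm_on K s & m = mperm s (restrict_mnm K nu).
Proof.
suff ex : (block_mono b K nu)@_m != 0 ->
    [exists s : 'S_N, perm_on K s && (restrict_mnm K nu == mperm s m)].
  move=> /ex/existsP[s /andP[sK /eqP restr]]; exists s^-1%g; first exact: perm_onV.
  by rewrite restr mperm_mul mulVg mperm_id.
apply: contraNT; case: b => nex; last by rewrite /= mcoeff_sym_mono (negPf nex).
rewrite /= alt_monoE mcoeff_block_sym big1 // => s sK; rewrite mcoeffX.
by have /existsPn/(_ s) := nex; rewrite sK /= => /negPf->; rewrite mulr0.
Qed.

Lemma mcoeff_block_mono_mperm b K nu m u : perm_on K u ->
  (block_mono b K nu)@_(mperm u m) = block_sign R b u * (block_mono b K nu)@_m.
Proof.
move=> uK; case: b => /=.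
  by rewrite alt_monoE -mcoeff_msym msym_block_sym // mcoeffZ.
rewrite !mcoeff_sym_mono mul1r; congr (nat_of_bool _)%:R.
apply/existsP/existsP => -[s /andP[sK /eqP restr]].
  by exists (s * u)%g; rewrite perm_onM // restr mperm_mul /=.
by exists (s * u^-1)%g; rewrite perm_onM ?perm_onV //= mperm_mul mulgKV restr.
Qed.

Lemma mcoeff_block_mono_lead (b : bool) K nu :
  (b -> {in K &, injective nu}) -> (block_mono b K nu)@_(restrict_mnm K nu) = 1.
Proof.
case: b => inj /=; last first.
  rewrite mcoeff_sym_mono (_ : [exists s, _]) //; apply/existsP; exists 1%g.
  by rewrite perm_on1 mperm_id eqxx.
rewrite alt_monoE mcoeff_block_sym (bigD1 1%g) ?perm_on1 //= mperm_id mcoeffX eqxx mulr1.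
rewrite big1 ?addr0 => [|s /andP[sK s1]]; first by rewrite /block_sign odd_perm1.
rewrite mcoeffX; case: eqP => [restr|_]; last by rewrite mulr0.
case/eqP: s1; apply/permP => i; rewrite perm1.
have [iK|iK] := boolP (i \in K); last by rewrite (out_perm sK iK).
apply: (inj isT); rewrite ?perm_closed //.
by have /mnmP/(_ i) := restr; rewrite mpermE !restrict_mnmE perm_closed // iK.
Qed.

Lemma mcoeff_msupp_sum f m : f@_m = \sum_(h <- msupp f) f@_h * (h == m)%:R.
Proof.
by rewrite {1}(mpolyE f) raddf_sum /=; apply: eq_bigr => h _; rewrite mcoeffZ mcoeffX.
Qed.

Lemma mcoeff_mul_disjoint (K J : {set 'I_N}) f g m : (forall i, (i \in J) = (i \notin K)) ->
  {in msupp f, forall h, restrict_mnm K h = h} -> {in msupp g, forall h, restrict_mnm J h = h} ->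
  (f * g)@_m = f@_(restrict_mnm K m) * g@_(restrict_mnm J m).
Proof.
move=> KJ supp_f supp_g; rewrite {1}(mpolyE f) {1}(mpolyE g) mulr_suml raddf_sum /=.
rewrite (mcoeff_msupp_sum f) (mcoeff_msupp_sum g) mulr_suml big_seq [RHS]big_seq.
apply: eq_bigr => h hf; rewrite [X in X@_m]mulr_sumr raddf_sum /= [RHS]mulr_sumr.
rewrite big_seq [RHS]big_seq; apply: eq_bigr => h' hg.
rewrite -scalerAl -scalerAr scalerA mcoeffZ -mpolyXD mcoeffX mulrACA -natrM mulnb.
congr (_ * (nat_of_bool _)%:R); rewrite -(supp_f h hf) -(supp_g h' hg).
apply/eqP/andP => [<-|[/eqP/mnmP hE /eqP/mnmP hE']]; last first.
  apply/mnmP => i; rewrite mnmDE; have := hE i; have := hE' i; rewrite !restrict_mnmE KJ.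
  by case: (i \in K) => /= [_ ->|-> _]; rewrite ?addn0.
by split; apply/eqP/mnmP => i; rewrite !(restrict_mnmE, mnmDE) KJ; case: (i \in K); rewrite ?addn0.
Qed.

End BlockMonomial.

Section IndexSet.
Variables (N M : nat) (T : symtype).
Implicit Types (m L : 'X_{1..N}) (K : {set 'I_N}).
Local Notation I := (setI_ N M).
Local Notation J := (setJ_ N M).

Lemma in_indexE L : in_index M T L =
  [&& superpartition M L, antisymI T ==> decr_on I L & antisymJ T ==> decr_on J L].
Proof. by case: T; rewrite /in_index /= ?andbT. Qed.

Lemma decr_on_inj K L : decr_on K L -> {in K &, injective L}.
Proof.
move=> /forall_inP decr i j iK jK; have [lt|lt|/val_inj//] := ltngtP i j => L_eq.
  by have /forall_inP/(_ j jK) := decr i iK; rewrite lt L_eq ltnn.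
by have /forall_inP/(_ i iK) := decr j jK; rewrite lt L_eq ltnn.
Qed.

Lemma in_index_inj L : in_index M T L ->
  (antisymI T -> {in I &, injective L}) /\ (antisymJ T -> {in J &, injective L}).
Proof.
rewrite in_indexE => /and3P[_ /implyP decrI /implyP decrJ].
by split=> [/decrI|/decrJ]; apply: decr_on_inj.
Qed.

Lemma decr_on_adj m (b : bool) :
  (forall x y, block_adjacent M x y -> (x < M)%N = b -> (m y < m x)%N) ->
  decr_on (if b then I else J) m.
Proof.
have m_trans : transitive (fun x y : 'I_N => m y < m x)%N.
  by move=> v u w lt_vu lt_wv; apply: ltn_trans lt_vu.
move=> /(block_adjacent_transitive m_trans) m_lt.
have in_block i : i \in (if b then I else J) -> (i < M)%N = b.
  by case: b {m_lt}; rewrite inE // leqNgt => /negPf.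
apply/forall_inP => i /in_block iK; apply/forall_inP => j /in_block jK; apply/implyP.
exact: m_lt.
Qed.

Lemma in_index_adj m :
  (forall x y, block_adjacent M x y -> (m y + antisym_at M T x <= m x)%N) -> in_index M T m.
Proof.
move=> m_adj; rewrite in_indexE; apply/and3P; split.
- by apply: superpartition_adj => x y /m_adj; lia.
- apply/implyP => antiI; apply: (@decr_on_adj _ true) => x y /m_adj le_m xM.
  by move: le_m; rewrite /antisym_at xM antiI addn1.
- apply/implyP => antiJ; apply: (@decr_on_adj _ false) => x y /m_adj le_m xM.
  by move: le_m; rewrite /antisym_at xM antiJ addn1.
Qed.

End IndexSet.

Section BiMonomial.
Variables (R : idomainType) (N M : nat) (T : symtype).
Implicit Types m G L : 'X_{1..N}.
Local Notation I := (setI_ N M).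
Local Notation J := (setJ_ N M).

Lemma mcoeff_mono L m : (mono R M T L)@_m =
  (block_mono R (antisymI T) I L)@_(restrict_mnm I m)
  * (block_mono R (antisymJ T) J L)@_(restrict_mnm J m).
Proof.
rewrite monoE; apply: mcoeff_mul_disjoint => [i|h|h]; first exact: mem_setJ.
  rewrite mcoeff_msupp => /mcoeff_block_mono_neq0[s sI ->].
  by rewrite restrict_mperm ?restrict_mnm_id.
rewrite mcoeff_msupp => /mcoeff_block_mono_neq0[s sJ ->].
by rewrite restrict_mperm ?restrict_mnm_id.
Qed.

Lemma block_symmetric_mono L : block_symmetric M T (mono R M T L).
Proof.
move=> x y /block_adjacentP[_ xNy blk]; apply/mpolyP => m.
have signE b : block_sign R b (tperm x y) = (-1) ^+ b by rewrite /block_sign odd_tperm xNy andbT.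
rewrite mcoeff_msym mcoeffZ !mcoeff_mono /antisym_at; have [xM|xM] := ltnP x M.
  have tI : perm_on I (tperm x y) by apply: perm_on_tperm; rewrite inE ?blk.
  rewrite (restrict_mperm _ tI) (restrict_mperm_disjoint _ tI); last first.
    by rewrite disjoint_sym disjoint_setIJ.
  by rewrite mcoeff_block_mono_mperm // signE mulrA.
have tJ : perm_on J (tperm x y) by apply: perm_on_tperm; rewrite inE // leqNgt blk -leqNgt.
rewrite (restrict_mperm _ tJ) (restrict_mperm_disjoint _ tJ) ?disjoint_setIJ //.
by rewrite mcoeff_block_mono_mperm // signE mulrCA.
Qed.

Lemma mcoeff_mono_neq0 L m : (mono R M T L)@_m != 0 -> m \in block_orbit M L.
Proof.
rewrite mcoeff_mono mulf_eq0 negb_or.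
move=> /andP[/mcoeff_block_mono_neq0[s sI /mnmP mI] /mcoeff_block_mono_neq0[t tJ /mnmP mJ]].
apply/block_orbitP; exists (s * t)%g.
  exact: preserves_blocksM (preserves_blocks_onI sI) (preserves_blocks_onJ tJ).
apply/mnmP => i; rewrite mpermE permM; have := mI i; have := mJ i.
rewrite !(mpermE, restrict_mnmE) !perm_closed // !mem_setJ.
have [iI|iI] /= := boolP (i \in I) => mJi mIi.
  by rewrite mIi (out_perm tJ) // mem_setJ perm_closed // iI.
by rewrite mJi (out_perm sI).
Qed.

Lemma mcoeff_mono_index L G : in_index M T L -> in_index M T G ->
  (mono R M T L)@_G = (G == L)%:R.
Proof.
move=> iL iG; have [->|GL] := eqVneq G L.
  by have [injI injJ] := in_index_inj iL; rewrite mcoeff_mono !mcoeff_block_mono_lead // mulr1.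
apply/eqP; apply: contraNT GL => /mcoeff_mono_neq0 GO; apply/eqP.
by apply: block_orbit_superpartition GO; [case/andP: iL | case/andP: iG].
Qed.

End BiMonomial.

Section Triangularity.
Variables (F : numFieldType) (N M : nat) (T : symtype).
Implicit Types (m G L : 'X_{1..N}) (f g : {mpoly F[N]}).

Lemma block_symmetric_sort f m : block_symmetric M T f -> f@_m != 0 ->
  exists G, [/\ in_index M T G, G \in block_orbit M m & f@_G != 0].
Proof.
move=> sym_f; move: m; apply: (@adjacent_swap_ind _ (block_adjacent M) (fun m i => m i)).
- by move=> m x y i _ _; rewrite mpermE.
- move=> m sorted fm; exists m; split=> //; last exact: block_orbit_refl.
  apply: in_index_adj => x y adj; have [xy _ _] := block_adjacentP adj.
  have := sorted x y xy adj; rewrite leq_eqVlt => /orP[/eqP tie|]; last by case: antisym_at; lia.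
  have := mcoeff_block_symmetric m sym_f adj; rewrite mperm_tperm_tie //.
  case: antisym_at => [/eqP|_]; last by rewrite tie; lia.
  by rewrite expr1 mulN1r -addr_eq0 -mulr2n mulrn_eq0 (negPf fm).
move=> m x y _ adj _ IH fm; have [|G [iG GO fG]] := IH.
  by rewrite (mcoeff_block_symmetric _ sym_f adj) mulf_neq0 ?signr_eq0.
exists G; split=> //; case/block_orbitP: GO => s bs ->.
by apply: block_orbit_mperm => //; apply: block_orbit_adj (block_orbit_refl _ _).
Qed.

Lemma block_symmetric_eq f g : block_symmetric M T f -> block_symmetric M T g ->
  (forall G, in_index M T G -> f@_G = g@_G) -> f = g.
Proof.
move=> sym_f sym_g fg; apply/mpolyP => m; apply/eqP; rewrite -subr_eq0 -mcoeffB.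
apply: contraT => /block_symmetric_sort[|G [iG _]]; last by rewrite mcoeffB fg // subrr eqxx.
by rewrite -scaleN1r; apply: block_symmetricD => //; apply: block_symmetricZ.
Qed.

Lemma sum_bmultinom1 (d : nat) (P : pred 'X_{1..N}) (V : nmodType) (c : 'X_{1..N} -> V) m :
  (forall G, G != m -> c G = 0) ->
  \sum_(G : 'X_{1..N < d} | P G) c G = if (mdeg m < d)%N && P m then c m else 0.
Proof.
move=> c0; have [md|md] /= := ltnP (mdeg m) d; last first.
  by rewrite big1 // => G _; apply: c0; apply: contraTneq md => <-; rewrite -ltnNge bmdeg.
case: ifP => Pm; last first.
  by rewrite big1 // => G PG; apply: c0; apply: contraFneq Pm => <-.
by rewrite (bigD1 (BMultinom md)) //= big1 ?addr0 // => G /andP[_]; apply: c0.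
Qed.

Section TriangularSum.
Variables (L : 'X_{1..N}) (iL : in_index M T L).

Definition below_index G : bool := [&& in_index M T G, mdeg G == mdeg L & sp_gt M L G].

Definition triangular_sum (c : 'X_{1..N} -> F) : {mpoly F[N]} :=
  mono F M T L + \sum_(G : 'X_{1..N < (mdeg L).+1} | below_index G) c G *: mono F M T G.

Lemma block_symmetric_triangular_sum c : block_symmetric M T (triangular_sum c).
Proof.
apply: block_symmetricD; first exact: block_symmetric_mono.
apply: big_ind => [x y _|f g|G _]; first by rewrite raddf0 scaler0.
  exact: block_symmetricD.
exact/block_symmetricZ/block_symmetric_mono.
Qed.

Lemma mcoeff_triangular_sum c G : in_index M T G ->
  (triangular_sum c)@_G = (G == L)%:R + if below_index G then c G else 0.
Proof.
move=> iG; rewrite mcoeffD mcoeff_mono_index // raddf_sum /=; congr (_ + _).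
under eq_bigr => H /and3P[iH _ _] do rewrite mcoeffZ mcoeff_mono_index //.
rewrite (@sum_bmultinom1 _ below_index _ (fun H => c H * (G == H)%:R) G) ?eqxx ?mulr1.
  case belowG : (below_index G); rewrite ?andbF //.
  by case/and3P: belowG => _ /eqP->; rewrite ltnSn.
by move=> H /negPf; rewrite eq_sym => ->; rewrite mulr0.
Qed.

Lemma below_index_irr : below_index L = false.
Proof. by rewrite /below_index /sp_gt /dom_gt !eqxx !andbF. Qed.

Lemma triangularP f : triangular M T L f <->
  [/\ block_symmetric M T f, f@_L = 1 &
    forall G, in_index M T G -> G != L -> f@_G != 0 -> below_index G].
Proof.
split=> [[c ->]|[sym_f f_lead f_below]].
  split; first exact: (block_symmetric_triangular_sum c).
    by rewrite (mcoeff_triangular_sum c) // eqxx below_index_irr addr0.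
  move=> G iG /negPf GL; rewrite (mcoeff_triangular_sum c) // GL add0r.
  by case: ifP; rewrite ?eqxx.
exists (fun G => f@_G); apply: (block_symmetric_eq sym_f) => [|G iG].
  exact: (block_symmetric_triangular_sum (fun G => f@_G)).
apply: etrans (esym (mcoeff_triangular_sum (fun G => f@_G) iG)).
have [->|GL] := eqVneq G L; first by rewrite f_lead below_index_irr addr0.
rewrite add0r; case: ifP => // nbelow; apply/eqP; apply: contraFT nbelow.
exact: f_below.
Qed.

End TriangularSum.

End Triangularity.

(** * Specialization *)

Section Reversal.
Variables (N lo hi : nat) (hiN : (hi <= N)%N).
Implicit Types i : 'I_N.

Definition rev_itv i : 'I_N := insubd i (if (lo <= i < hi)%N then lo + hi - i.+1 else i)%N.

Lemma val_rev_itv i : rev_itv i = (if lo <= i < hi then lo + hi - i.+1 else i)%N :> nat.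
Proof. by rewrite val_insubd; have := ltn_ord i; case: ifP; case: ifP; lia. Qed.

Lemma rev_itvK : involutive rev_itv.
Proof. by move=> i; apply/val_inj; rewrite /= !val_rev_itv; case: ifP; case: ifP; lia. Qed.

Definition rev_perm : 'S_N := perm (can_inj rev_itvK).

Lemma val_rev_perm i : rev_perm i = (if lo <= i < hi then lo + hi - i.+1 else i)%N :> nat.
Proof. by rewrite permE val_rev_itv. Qed.

Lemma rev_perm_on : perm_on (ord_itv N lo hi) rev_perm.
Proof.
apply/subsetP => i; rewrite !inE; apply: contraR => /negPf i_out.
by apply/eqP/val_inj; rewrite /= val_rev_perm i_out.
Qed.

End Reversal.

Section ReversedBlocks.
Variables (N M : nat) (MN : (M <= N)%N).
Implicit Types (L : 'X_{1..N}) (i j : 'I_N).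
Local Notation revI := (rev_perm 0 MN).
Local Notation revJ := (rev_perm M (leqnn N)).

Lemma revI_on : perm_on (setI_ N M) revI.
Proof. by rewrite setI_ord_itv; apply: rev_perm_on. Qed.

Lemma revJ_on : perm_on (setJ_ N M) revJ.
Proof. by rewrite setJ_ord_itv; apply: rev_perm_on. Qed.

Lemma val_rev_blocks i :
  revI (revJ i) = (if i < M then M - i.+1 else N + M - i.+1)%N :> nat.
Proof. by rewrite !val_rev_perm; have := ltn_ord i; do !case: ifP; lia. Qed.

Lemma eta_ofE L : eta_of M L = mperm revJ (mperm revI L).
Proof.
apply/mnmP => i; rewrite mnmE !mpermE -nth_parts val_rev_blocks; have iN := ltn_ord i.
have size_take_parts : size (take M (parts L)) = M by rewrite size_takel // size_parts.
have size_drop_parts : size (drop M (parts L)) = (N - M)%N by rewrite size_drop size_parts.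
rewrite nth_cat size_rev size_take_parts; have [iM|Mi] := ltnP i M.
  by rewrite nth_rev ?size_take_parts // nth_take //; lia.
by rewrite nth_rev ?size_drop_parts ?nth_drop; [congr nth | ]; lia.
Qed.

Lemma eta_of_block_orbit L : eta_of M L \in block_orbit M L.
Proof.
rewrite eta_ofE; apply: block_orbit_mperm; first exact: preserves_blocks_onJ revJ_on.
exact: mem_block_orbit (preserves_blocks_onI revI_on).
Qed.

Lemma eta_of_blockwise_increasing L : superpartition M L -> blockwise_increasing M (eta_of M L).
Proof.
move=> sL i j blk ij; rewrite eta_ofE !mpermE.
by apply: superpartition_noninc sL _ _; rewrite !val_rev_blocks;
   have := ltn_ord j; do !case: ifP; lia.
Qed.

End ReversedBlocks.

Section NonsymmetricJack.
Variables (F : numFieldType) (n : nat).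
Local Notation N := n.+1.
Local Notation a := (alpha_gen F).
Implicit Types v m : 'X_{1..N}.

Lemma mcoeff_comp_gt_sum v m (c : 'X_{1..N} -> ratfun F) :
  ('X_[v] + \sum_(nu : 'X_{1..N < (mdeg v).+1} | comp_gt v nu) c nu *: 'X_[nu])@_m
  = (v == m)%:R + if (mdeg m <= mdeg v)%N && comp_gt v m then c m else 0.
Proof.
rewrite mcoeffD mcoeffX raddf_sum /=; congr (_ + _).
under eq_bigr => h _ do rewrite mcoeffZ mcoeffX.
rewrite (@sum_bmultinom1 _ _ (comp_gt v) _ (fun h => c h * (h == m)%:R) m); last first.
  by move=> h /negPf->; rewrite mulr0.
by rewrite eqxx mulr1.
Qed.

Lemma nsJackP v : is_nsJack v (nsJack F v).
Proof.
apply: classical_sets.xgetPex; have gen := @alpha_generic F.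
have [p [p_eigen p_lead _]] := exists_evaluated_nsJack gen v.
exists p; split=> //; exists (fun m => p@_m); apply/mpolyP => m.
rewrite (mcoeff_comp_gt_sum v m (fun m => p@_m)); have [<-|vm] := eqVneq v m.
  by rewrite p_lead /comp_gt eqxx andbF addr0.
rewrite add0r; have [pm|/memN_msupp_eq0->] := boolP (m \in msupp p); last by rewrite if_same.
have [mv _] := joint_eigen_supp gen p_eigen pm.
by rewrite (comp_le_comp_gt mv vm); case: mv => ->; rewrite leqnn.
Qed.

Lemma joint_eigen_nsJack v : joint_eigen a (bar a v) (nsJack F v).
Proof. by case: (nsJackP v). Qed.

Lemma nsJack_lead v : (nsJack F v)@_v = 1.
Proof.
have [[c ->] _] := nsJackP v.
by rewrite (mcoeff_comp_gt_sum v v c) eqxx /comp_gt eqxx andbF addr0.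
Qed.

End NonsymmetricJack.

Section SekiguchiEigenfunctions.
Variables (F : fieldType) (N M : nat) (L : 'X_{1..N}) (a0 : F).
Implicit Types (f g : {mpoly F[N]}) (G : 'X_{1..N}).

Lemma sekiguchi_eigenP f : sekiguchi_eigen a0 M L f <->
  sekiguchi (fun=> 'X) a0%:P (map_mpoly polyC f) = eps N (sp_star L) a0%:P 'X *: map_mpoly polyC f
  /\ sekiguchi (fun j => 'X + a0%:P *+ (j < M)%N) a0%:P (map_mpoly polyC f)
     = eps N (sp_circ M L) a0%:P 'X *: map_mpoly polyC f.
Proof. by rewrite -sekiguchi_starE -sekiguchi_circE. Qed.

Lemma sekiguchi_eigenB f g :
  sekiguchi_eigen a0 M L f -> sekiguchi_eigen a0 M L g -> sekiguchi_eigen a0 M L (f - g).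
Proof.
move=> /sekiguchi_eigenP[f_star f_circ] /sekiguchi_eigenP[g_star g_circ].
apply/sekiguchi_eigenP; rewrite [map_mpoly _ _]raddfB !linearB /=.
by rewrite f_star f_circ g_star g_circ.
Qed.

Lemma sekiguchi_eigen_maximal f G :
  sekiguchi_eigen a0 M L f -> maximal_at G f -> G \in msupp f ->
  eps N (sp_star L) a0%:P 'X = eps N (sp_star G) a0%:P 'X /\
  eps N (sp_circ M L) a0%:P 'X = eps N (sp_circ M G) a0%:P 'X.
Proof.
rewrite mcoeff_msupp => /sekiguchi_eigenP[star circ] max_f fG.
have max_fu : maximal_at G (map_mpoly polyC f).
  by move=> m Gm mG; rewrite mcoeff_map_mpoly /= max_f // polyC0.
have fuG : (map_mpoly polyC f)@_G != 0 by rewrite mcoeff_map_mpoly /= polyC_eq0.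
have top w := maximal_at_mcoeff_sekiguchi w a0%:P max_fu.
split; apply: (mulIf fuG).
  by rewrite (eps_sp_star _ _ G) -(top (fun=> 'X)) star mcoeffZ.
by rewrite (eps_sp_circ _ _ _ G) -(top (fun j => 'X + a0%:P *+ (j < M)%N)) circ mcoeffZ.
Qed.

End SekiguchiEigenfunctions.

Lemma mcoeff_map_mpoly0 (R S : nzRingType) (N : nat) (f : R -> S) (p : {mpoly R[N]}) m :
  f 0 = 0 -> (map_mpoly f p)@_m = f p@_m.
Proof.
move=> f0; rewrite /map_mpoly /mmap raddf_sum /=.
under eq_bigr => h _ do rewrite mmap1_id mul_mpolyC mcoeffZ mcoeffX.
have [pm|pm] := boolP (m \in msupp p).
  rewrite (bigD1_seq m pm (msupp_uniq _)) /= eqxx mulr1 big1 ?addr0 // => h /negPf->.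
  by rewrite mulr0.
rewrite (memN_msupp_eq0 pm) f0 big_seq big1 // => h ph.
by case: eqP pm => [<-|_ _]; rewrite ?ph ?mulr0.
Qed.

Section JackSpecialization.
Variables (F : numFieldType) (k p n M : nat) (T : symtype) (L : 'X_{1..n.+1}) (a0 : F).
Local Notation N := n.+1.
Local Notation a := (alpha_gen F).
Hypotheses (p_gt0 : (0 < p)%N) (cop : coprime k.+1 p) (a0E : a0 *+ p + k.+1%:R = 0).
Hypotheses (MN : (M <= N)%N) (iL : in_index M T L).
Local Notation E := (@nsJack F N).
Local Notation gen := (@alpha_generic F).
Local Notation E_eigen := (@joint_eigen_nsJack F n).
Local Notation E_lead := (@nsJack_lead F n).
Local Notation J := (jack F M T L).
Local Notation val := (ratfun_value a0).
Implicit Types G m : 'X_{1..N}.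

Let sL : superpartition M L. Proof. by case/andP: iL. Qed.

Lemma orbit_span_jack : orbit_span E M L J.
Proof.
apply/orbit_spanZ/(orbit_span_symmetrizer gen E_eigen E_lead)/orbit_span_nsJack.
exact: eta_of_block_orbit.
Qed.

Lemma jack_lead : J@_L = 1.
Proof.
have [injI injJ] := in_index_inj iL.
rewrite mcoeffZ mulVf //; exact: (mcoeff_symmetrizer_neq0 gen (E_eigen _) (E_lead _)
  (eta_of_blockwise_increasing MN sL) (revI_on MN) (revJ_on N M) (eta_ofE MN L)).
Qed.

Lemma block_symmetric_jack : block_symmetric M T J.
Proof. exact/block_symmetricZ/block_symmetric_symmetrizer. Qed.

Lemma jack_below_index G : in_index M T G -> G != L -> J@_G != 0 -> below_index M T L G.
Proof.
move=> iG GL; have [q ->] := orbit_span_jack; rewrite raddf_sum /= => JG.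
have [v vO Gv] : exists2 v, v \in block_orbit M L & G \in msupp (E v).
  apply/hasP; apply: contraNT JG => /hasPn notG; rewrite big_seq big1 // => v /notG Gv.
  by rewrite mcoeffZ (memN_msupp_eq0 Gv) mulr0.
have [Gle _] := joint_eigen_supp gen (E_eigen v) Gv.
have star_v := block_orbit_sp_star vO; have circ_v := block_orbit_sp_circ vO.
rewrite /below_index iG; case: (Gle) => -> _ _; rewrite (block_orbit_mdeg vO) eqxx /=.
rewrite /sp_gt /dom_gt -star_v (comp_le_dom_ge Gle) andbT.
have [star|//] := eqVneq (sp_star v) (sp_star G).
rewrite -circ_v (comp_le_dom_ge_circ M Gle star) andbT; apply: contraNneq GL => circ.
by apply/eqP/(superpartition_eq sL); [case/andP: iG | rewrite -star_v | rewrite -circ_v].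
Qed.

Hypothesis J_reg : no_pole_at a0 J.
Local Notation J0 := (jack_at a0 M T L).

Lemma jack_at_value m : val J@_m J0@_m.
Proof.
rewrite mcoeff_map_mpoly0; last exact/ratfun_value_eval/(ratfun_value_nat a0 0).
by have [y Jy] := J_reg m; rewrite (ratfun_value_eval Jy).
Qed.

Lemma block_symmetric_jack_at : block_symmetric M T J0.
Proof.
move=> x y adj; apply/mpolyP => m; rewrite mcoeff_msym mcoeffZ.
apply: ratfun_value_uniq (jack_at_value _) _.
rewrite (mcoeff_block_symmetric _ block_symmetric_jack adj).
exact: (relM (ratfun_value_ring a0)) (ratfun_value_sign _ _) (jack_at_value m).
Qed.

Lemma jack_at_triangular : triangular M T L J0.
Proof.
apply/(triangularP iL); split; first exact: block_symmetric_jack_at.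
  have := jack_at_value L; rewrite jack_lead => /ratfun_value_uniq; apply.
  exact: (ratfun_value_nat a0 1).
move=> G iG GL nz; apply: jack_below_index => //; apply: contraNneq nz => JG.
have := jack_at_value G; rewrite JG => value0; apply/eqP.
exact: ratfun_value_uniq value0 (ratfun_value_nat a0 0).
Qed.

Lemma jack_at_eigen : sekiguchi_eigen a0 M L J0.
Proof.
pose rl (f : {poly ratfun F}) (g : {poly F}) := poly_rel val f g.
have ring_rl : ring_relation rl := ring_relation_poly (ratfun_value_ring a0).
have rlC c y : val c y -> rl c%:P y%:P.
  by move=> cy i; rewrite !coefC; case: ifP => // _; apply: (ratfun_value_nat a0 0).
have rlX : rl 'X 'X by move=> i; rewrite !coefX; apply: ratfun_value_nat.
have rl_alpha : rl a%:P a0%:P := rlC _ _ (ratfun_value_alpha a0).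
have rlJ : mpoly_rel rl (map_mpoly polyC J) (map_mpoly polyC J0).
  by move=> m; rewrite !mcoeff_map_mpoly /=; apply/rlC/jack_at_value.
have specialize (w : 'I_N -> {poly ratfun F}) w' lam : (forall j, rl (w j) (w' j)) ->
    sekiguchi w a%:P (map_mpoly polyC J) = eps N lam a%:P 'X *: map_mpoly polyC J ->
    sekiguchi w' a0%:P (map_mpoly polyC J0) = eps N lam a0%:P 'X *: map_mpoly polyC J0.
  move=> ww' J_eigen; apply/mpolyP => m; apply/polyP => i.
  have := mpoly_rel_sekiguchi ring_rl ww' rl_alpha rlJ m i; rewrite J_eigen.
  move/ratfun_value_uniq; apply.
  by have /(_ m i) := mpoly_relZ ring_rl (rel_eps N ring_rl lam rl_alpha rlX) rlJ.
have /sekiguchi_eigenP[star circ] := orbit_span_sekiguchi_eigen E_eigen orbit_span_jack.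
apply/sekiguchi_eigenP; split; first by apply: specialize star.
apply: specialize circ.
by move=> j; apply: (relD ring_rl rlX); apply: (rel_muln ring_rl).
Qed.

Lemma collision_antisymI A B : strict M L -> weakly_admissible M k p.+1 L ->
  collision M k p L A B -> antisymI T.
Proof.
move=> strict_L weak_L [AB BkN rows]; apply/negPn/negP => /negPf antiI.
have [gap_L _] := weakly_admissible_gap strict_L weak_L.
have etaO := eta_of_block_orbit MN L; have [q JE] := orbit_span_jack.
have qL : q L = 1 by rewrite -(mcoeff_orbit_sum gen E_eigen E_lead q sL) -JE jack_lead.
have E_reg : no_pole_at a0 (E (eta_of M L)).
  apply: (no_pole_at_orbit p_gt0 cop a0E E_eigen E_lead gap_L weak_L sL antiI qL) => //.
    by rewrite -JE.
  by rewrite -JE; apply: block_symmetric_jack.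
(* Both rows come from the block I, which [eta_of] reverses. *)
have inv r : r = A \/ r = B -> inverted k (eta_of M L) r.
  move=> rAB i j ir jr; have [tight circ_r circ_rk] := rows r rAB.
  move: tight circ_r circ_rk; rewrite -(block_orbit_sp_star etaO) -(block_orbit_sp_circ etaO).
  rewrite -jr -ir !nth_sp_star !nth_sp_circ => tight iM jM.
  have [ij|ij|/val_inj ij] := ltngtP i j; [|by []|by move: tight; rewrite ij; lia].
  have := @eta_of_blockwise_increasing _ _ MN _ sL i j.
  by move: iM jM; case: (i < M)%N; case: (j < M)%N; lia.
have [tight_A _ _] := rows A (or_introl erefl); have [tight_B _ _] := rows B (or_intror erefl).
apply: (inverted_regular_absurd p_gt0 cop a0E E_eigen E_lead gap_L AB BkN tight_A tight_B
  (v := eta_of M L)).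
by split; [exact: block_orbit_sp_star etaO | exact: E_reg | apply: inv; left | apply: inv; right].
Qed.

Hypothesis adm : admissible M k p.+1 L.

Lemma sp_gt_eps_absurd G : in_index M T G -> sp_gt M L G ->
  eps N (sp_star L) a0%:P 'X = eps N (sp_star G) a0%:P 'X ->
  eps N (sp_circ M L) a0%:P 'X = eps N (sp_circ M G) a0%:P 'X -> False.
Proof.
move=> iG gt_LG /(eps_eq_content_perm a0E)[s starE] /(eps_eq_content_perm a0E)[S circE].
have distinct : ~ (sp_star L = sp_star G /\ sp_circ M L = sp_circ M G).
  by case=> star circ; move: gt_LG; rewrite /sp_gt /dom_gt star circ !eqxx.
case: adm => [strong_L|[strict_L weak_L]].
  exact/distinct/(strongly_admissible_rigid cop starE circE).
have [//|[nstrict_G [A [B col]]]] := weakly_admissible_collision cop starE circE strict_L weak_L.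
have antiI := collision_antisymI strict_L weak_L col.
by case/negP: nstrict_G; move: iG; rewrite in_indexE antiI => /and3P[].
Qed.

Lemma jack_at_unique P : triangular M T L P -> sekiguchi_eigen a0 M L P -> P = J0.
Proof.
move=> /(triangularP iL)[P_sym P_lead P_below] P_eigen.
have /(triangularP iL)[J_sym J0_lead J0_below] := jack_at_triangular.
apply/eqP; rewrite -subr_eq0; apply: contraT => /mlead_supp/exists_maximal_at[g [gD _ g_max]].
have [star circ] := sekiguchi_eigen_maximal (sekiguchi_eigenB P_eigen jack_at_eigen) g_max gD.
have D_sym : block_symmetric M T (P - J0).
  by rewrite -scaleN1r; apply: block_symmetricD => //; apply: block_symmetricZ.
move: gD; rewrite mcoeff_msupp => /(block_symmetric_sort D_sym)[G [iG GO DG]].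
rewrite -(block_orbit_sp_star GO) in star; rewrite -(block_orbit_sp_circ GO) in circ.
have GL : G != L by apply: contraNneq DG => ->; rewrite mcoeffB P_lead J0_lead subrr.
have /and3P[_ _ gt_LG] : below_index M T L G.
  have [PG|/(P_below G iG GL)//] := eqVneq P@_G 0.
  by apply: (J0_below G iG GL); apply: contraNneq DG => J0G; rewrite mcoeffB PG J0G subrr.
by case: (sp_gt_eps_absurd iG gt_LG star circ).
Qed.

End JackSpecialization.

Theorem mainTheorem3 (R : realType) (N m n k r : nat) (T : symtype)
    (L : 'X_{1..N})
    (hN : (1 <= N)%N) (hm : (m <= N)%N)
    (hk : (1 <= k)%N) (hr : (2 <= r)%N)
    (hkr : gcdn (k + 1) (r - 1) = 1%N)
    (hn : mdeg L = n)
    (hT : in_index m T L)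
    (hadm : admissible m k r L)
    (hreg : no_pole_at (alpha_kr R[i] k r) (jack R[i] m T L)) :
  let a : R[i] := alpha_kr R[i] k r in
  let P0 : {mpoly R[i][N]} := jack_at a m T L in
  (triangular m T L P0 /\ sekiguchi_eigen a m L P0) /\
  (forall P : {mpoly R[i][N]},
     triangular m T L P /\ sekiguchi_eigen a m L P -> P = P0).
Proof.
case: N L hN hm hn hT hadm hreg => [//|N'] L _ hm _ hT hadm hreg a P0.
case: r hr hkr hadm hreg @a @P0 => [//|[//|p]] _ hkr hadm hreg a P0.
have cop : coprime k.+1 p.+1 by rewrite /coprime -hkr addn1 subn1.
have aE : a *+ p.+1 + k.+1%:R = 0.
  by rewrite /a /alpha_kr -[_ *+ p.+1]mulr_natr divfK ?pnatr_eq0 // addNr.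
split; first split.
- exact: jack_at_triangular hm hT hreg.
- exact: jack_at_eigen hm hreg.
- by move=> P [P_triangular P_eigen]; apply: (jack_at_unique _ cop aE hm hT hreg hadm).
Qed.
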